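(* Let $\Psi$ be either an admissible wavelet (wavelet case) or an admissible window (time-frequency case), and let $G=G_1\times G_2$, $W_\Psi(L_2(\mathbb{R}))$, $P_\Psi$, $U_\Psi$, $Q_\Psi$, $Q_\Psi^*$ be the corresponding objects. The operator $R_\Psi=Q_\Psi^*U_\Psi$ maps the space $L_2(G,\mathrm{d}\zeta)$ onto $L_2(G_2,\mathrm{d}\zeta_2)$, and the restriction $$R_\Psi|_{W_\Psi(L_2(\mathbb{R}))}: W_\Psi(L_2(\mathbb{R}))\to L_2(G_2,\mathrm{d}\zeta_2)$$ is an isometrical isomorphism. The adjoint $$R_\Psi^*=U_\Psi^*Q_\Psi: L_2(G_2,\mathrm{d}\zeta_2)\to W_\Psi(L_2(\mathbb{R}))\subset L_2(G,\mathrm{d}\zeta)$$ is an isometrical isomorphism of $L_2(G_2,\mathrm{d}\zeta_2)$ onto the subspace $W_\Psi(L_2(\mathbb{R}))$ of $L_2(G,\mathrm{d}\zeta)$. Moreover, $$R_\Psi R_\Psi^*=I: L_2(G_2,\mathrm{d}\zeta_2)\to L_2(G_2,\mathrm{d}\zeta_2),\qquad R_\Psi^*R_\Psi=P_\Psi: L_2(G,\mathrm{d}\zeta)\to W_\Psi(L_2(\mathbb{R})).$$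
   Context: Inner products are linear in the first argument. The Fourier transform is $\mathcal{F}\{f\}(\xi)=\hat f(\xi)=\int_{\mathbb{R}}f(x)\mathrm{e}^{-2\pi\mathrm{i}x\xi}\,\mathrm{d}x$, extended to a unitary operator on $L_2(\mathbb{R})$. Two cases are treated in parallel. Wavelet case: $\Psi=\psi\in L_2(\mathbb{R})$ is a real-valued admissible wavelet, i.e. $\int_{\mathbb{R}_+}|\hat\psi(t\xi)|^2\frac{\mathrm{d}t}{t}=1$ for almost every $\xi\in\mathbb{R}$; $G=G_1\times G_2$ with $G_1=\mathbb{R}_+=(0,\infty)$, $G_2=\mathbb{R}$, $\mathrm{d}\zeta_1=u^{-2}\mathrm{d}u$, $\mathrm{d}\zeta_2=\mathrm{d}v$, $\mathrm{d}\zeta=u^{-2}\mathrm{d}u\,\mathrm{d}v$; for $\zeta=(u,v)\in G$, $\Psi_\zeta(x)=\psi_{u,v}(x)=u^{-1/2}\psi((x-v)/u)$; and $\ell_\psi(u,\omega)=\sqrt{u}\,\overline{\hat\psi(u\omega)}$. Time-frequency case: $\Psi=\phi\in L_2(\mathbb{R})$ is an admissible window, i.e. $\|\phi\|_{L_2(\mathbb{R})}=1$; $G=G_1\times G_2$ with $G_1=G_2=\mathbb{R}$, $\mathrm{d}\zeta_1=\mathrm{d}q$, $\mathrm{d}\zeta_2=\mathrm{d}p$, $\mathrm{d}\zeta=\mathrm{d}q\,\mathrm{d}p$; for $\zeta=(q,p)\in G$, $\Psi_\zeta(x)=\phi_{q,p}(x)=\mathrm{e}^{2\pi\mathrm{i}px}\phi(x-q)$;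 and $\ell_\phi(q,\omega)=\overline{\phi(\omega-q)}$. In both cases $(W_\Psi f)(\zeta)=\langle f,\Psi_\zeta\rangle$ for $f\in L_2(\mathbb{R})$; $W_\Psi: L_2(\mathbb{R})\to L_2(G,\mathrm{d}\zeta)$ is an isometry, $W_\Psi(L_2(\mathbb{R}))$ is its (closed) range, and $P_\Psi$ is the orthogonal projection of $L_2(G,\mathrm{d}\zeta)$ onto $W_\Psi(L_2(\mathbb{R}))$. $U_\Psi=I\otimes\mathcal{F}^{\pm1}$ on $L_2(G,\mathrm{d}\zeta)=L_2(G_1,\mathrm{d}\zeta_1)\otimes L_2(G_2,\mathrm{d}\zeta_2)$, with $\mathcal{F}$ in the wavelet case and $\mathcal{F}^{-1}$ in the time-frequency case. The operator $Q_\Psi: L_2(G_2,\mathrm{d}\zeta_2)\to L_2(G,\mathrm{d}\zeta)$ is $(Q_\Psi f)(z,\omega)=f(\omega)\ell_\Psi(z,\omega)$, and its adjoint $Q_\Psi^*: L_2(G,\mathrm{d}\zeta)\to L_2(G_2,\mathrm{d}\zeta_2)$ is $(Q_\Psi^*F)(\xi)=\int_{G_1}F(t,\xi)\overline{\ell_\Psi(t,\xi)}\,\mathrm{d}\zeta_1(t)$. *)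

(* Defs.v *)
From HB Require Import structures.
From mathcomp Require Import all_boot all_order all_algebra.
From mathcomp Require Import all_classical all_reals all_analysis.
From mathcomp Require Import measurable_realfun complex ring.

Set Implicit Arguments.
Unset Strict Implicit.
Unset Printing Implicit Defensive.

Import Order.TTheory GRing.Theory Num.Theory.
Import numFieldNormedType.Exports.

Local Open Scope classical_set_scope.
Local Open Scope ring_scope.
Local Open Scope complex_scope.

Local Notation Re := complex.Re.
Local Notation Im := complex.Im.

Section complex_integration.
Context d (T : measurableType d) (R : realType) (mu : {measure set T -> \bar R}).
Implicit Types f g : T -> R[i].

Definition cmeasurable f :=
  measurable_fun setT (fun x => Re (f x)) /\
  measurable_fun setT (fun x => Im (f x)).

Definition cintegrable f :=
  mu.-integrable setT (fun x => (Re (f x))%:E) /\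
  mu.-integrable setT (fun x => (Im (f x))%:E).

Definition cintegral f : R[i] :=
  (\int[mu]_x Re (f x)) +i* (\int[mu]_x Im (f x)).

Definition sqint f :=
  cmeasurable f /\ (\int[mu]_x (Normc.normc (f x) ^+ 2)%:E < +oo)%E.

Lemma normc2E (z : R[i]) : Normc.normc z ^+ 2 = Re z ^+ 2 + Im z ^+ 2.
Proof. by case: z => a b /=; rewrite sqr_sqrtr// addr_ge0// sqr_ge0. Qed.

Lemma cmeasurableD f g : cmeasurable f -> cmeasurable g ->
  cmeasurable (fun x => f x + g x).
Proof.
move=> [f1 f2] [g1 g2]; split.
  rewrite (_ : (fun x => _) = (fun x => Re (f x)) \+ (fun x => Re (g x))).
    exact: measurable_funD.
  by apply/funext => x /=; case: (f x) (g x) => [? ?] [? ?].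
rewrite (_ : (fun x => _) = (fun x => Im (f x)) \+ (fun x => Im (g x))).
  exact: measurable_funD.
by apply/funext => x /=; case: (f x) (g x) => [? ?] [? ?].
Qed.

Lemma cmeasurableZ (a : R[i]) f : cmeasurable f ->
  cmeasurable (fun x => a * f x).
Proof.
move=> [f1 f2]; split.
  rewrite (_ : (fun x => _) =
    (fun x => Re a * Re (f x)) \- (fun x => Im a * Im (f x))).
    by apply: measurable_funB; exact: measurable_funM.
  by apply/funext => x /=; case: a (f x) => [? ?] [? ?].
rewrite (_ : (fun x => _) =
  (fun x => Re a * Im (f x)) \+ (fun x => Im a * Re (f x))).
  by apply: measurable_funD; exact: measurable_funM.
by apply/funext => x /=; case: a (f x) => [? ?] [? ?].
Qed.

Lemma measurable_normc2 f : cmeasurable f ->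
  measurable_fun setT (fun x => (Normc.normc (f x) ^+ 2)%:E).
Proof.
move=> [f1 f2]; apply/measurable_EFinP.
under eq_fun do rewrite normc2E.
by apply: measurable_funD; exact: measurable_funX.
Qed.

Lemma sqint0 : sqint (fun=> 0).
Proof.
split; first by split; exact: measurable_cst.
rewrite (_ : (\int[mu]_x _)%E = 0%E)// integral0_eq// => x _.
by rewrite normc2E/= expr0n/= addr0.
Qed.

Lemma sqintD f g : sqint f -> sqint g -> sqint (fun x => f x + g x).
Proof.
move=> [mf lf] [mg lg]; split; first exact: cmeasurableD.
pose F x := ((Normc.normc (f x) ^+ 2)%:E : \bar R).
pose G x := ((Normc.normc (g x) ^+ 2)%:E : \bar R).
have mF : measurable_fun setT F by exact: measurable_normc2.
have mG : measurable_fun setT G by exact: measurable_normc2.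
apply: (@le_lt_trans _ _ (\int[mu]_x (2%:E * (F x + G x)))%E).
  apply: ge0_le_integral => //=.
  - by move=> x _; rewrite lee_fin sqr_ge0.
  - by apply: measurable_normc2; exact: cmeasurableD.
  - by apply: emeasurable_funM => //; exact: emeasurable_funD.
  move=> x _; rewrite /F /G -EFinD -EFinM lee_fin !normc2E.
  case: (f x) (g x) => [a b] [a' b'] /=.
  rewrite -subr_ge0 (_ : _ - _ = (a - a') ^+ 2 + (b - b') ^+ 2); last first.
    by ring.
  by rewrite addr_ge0// sqr_ge0.
rewrite ge0_integralZl//.
- rewrite ge0_integralD//.
  + by apply: lte_mul_pinfty => //; rewrite lte_add_pinfty.
  + by move=> x _; rewrite lee_fin sqr_ge0.
  + by move=> x _; rewrite lee_fin sqr_ge0.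
- exact: emeasurable_funD.
- by move=> x _; apply: adde_ge0; rewrite lee_fin sqr_ge0.
Qed.

Lemma sqintZ (a : R[i]) f : sqint f -> sqint (fun x => a * f x).
Proof.
move=> [mf lf]; split; first exact: cmeasurableZ.
under eq_integral do rewrite Normc.normcM exprMn EFinM.
rewrite ge0_integralZl//.
- by apply: lte_mul_pinfty => //; rewrite lee_fin sqr_ge0.
- exact: measurable_normc2.
- by move=> x _; rewrite lee_fin sqr_ge0.
- by rewrite lee_fin sqr_ge0.
Qed.

End complex_integration.

Section L2_space.
Context d (T : measurableType d) (R : realType).
Variable mu : {measure set T -> \bar R}.

Definition L2fun := {f : T -> R[i] | `[< sqint mu f >]}.

Definition ae_eq_L2 (f g : L2fun) : bool :=
  `[< {ae mu, forall x, sval f x = sval g x} >].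

Lemma ae_eq_L2_refl : reflexive ae_eq_L2.
Proof. by move=> f; apply/asboolP; exact: aeW. Qed.

Lemma ae_eq_L2_sym : symmetric ae_eq_L2.
Proof.
by move=> f g; apply/idP/idP => /asboolP h; apply/asboolP; apply: filterS h.
Qed.

Lemma ae_eq_L2_trans : transitive ae_eq_L2.
Proof.
move=> g f h /asboolP fg /asboolP gh; apply/asboolP.
by apply: filterS2 fg gh => x -> ->.
Qed.

Canonical ae_eq_L2_equiv :=
  EquivRel ae_eq_L2 ae_eq_L2_refl ae_eq_L2_sym ae_eq_L2_trans.

Local Open Scope quotient_scope.

Definition L2 : Type := {eq_quot ae_eq_L2}.
HB.instance Definition _ := Choice.on L2.
HB.instance Definition _ := EqQuotient.on L2.

Definition L2_fun (f : L2) : T -> R[i] := sval (repr f).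
Coercion L2_fun : L2 >-> Funclass.

Definition L2_zero : L2 := \pi_L2 (exist _ (fun=> 0) (asboolT (sqint0 mu))).

(* The class of f; total, with value 0 when f is not square-integrable *)
Definition toL2 (f : T -> R[i]) : L2 :=
  if pselect (sqint mu f) is left sf then \pi_L2 (exist _ f (asboolT sf))
  else L2_zero.

Lemma L2_sqint (f : L2) : sqint mu f.
Proof. by rewrite /L2_fun; case: (repr f) => /= g /asboolP. Qed.

Lemma toL2_ae (f : T -> R[i]) : sqint mu f ->
  {ae mu, forall x, toL2 f x = f x}.
Proof.
rewrite /toL2; case: pselect => // sf _.
set F := exist _ f _.
have : F == repr (\pi_L2 F) %[mod L2] by rewrite reprK.
rewrite eqmodE => /asboolP.
by apply: filterS => x /esym.
Qed.

Lemma L2_eqP (f g : L2) : {ae mu, forall x, f x = g x} <-> f = g.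
Proof.
split=> [fg|->]; last exact: aeW.
by rewrite -[f]reprK -[g]reprK; apply/eqP; rewrite eqmodE; exact/asboolP.
Qed.

Definition L2_add (f g : L2) := toL2 (fun x => f x + g x).
Definition L2_scale (a : R[i]) (f : L2) := toL2 (fun x => a * f x).
Definition L2_opp (f : L2) := L2_scale (-1) f.

Lemma L2_add_ae (f g : L2) : {ae mu, forall x, L2_add f g x = f x + g x}.
Proof. by apply: toL2_ae; apply: sqintD; exact: L2_sqint. Qed.

Lemma L2_scale_ae a (f : L2) : {ae mu, forall x, L2_scale a f x = a * f x}.
Proof. by apply: toL2_ae; apply: sqintZ; exact: L2_sqint. Qed.

Lemma L2_zero_ae : {ae mu, forall x, L2_zero x = 0}.
Proof.
have -> : L2_zero = toL2 (fun=> 0).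
  by rewrite /toL2; case: pselect => // s; congr (\pi_L2 _); apply: val_inj.
exact/toL2_ae/sqint0.
Qed.

Lemma L2_addA : associative L2_add.
Proof.
move=> f g h; apply/L2_eqP.
apply: filterS3 (L2_add_ae f (L2_add g h)) (L2_add_ae (L2_add f g) h)
  (filterI (L2_add_ae f g) (L2_add_ae g h)).
by move=> x -> -> [-> ->]; rewrite addrA.
Qed.

Lemma L2_addC : commutative L2_add.
Proof.
move=> f g; apply/L2_eqP.
by apply: filterS2 (L2_add_ae f g) (L2_add_ae g f) => x -> ->; rewrite addrC.
Qed.

Lemma L2_add0 : left_id L2_zero L2_add.
Proof.
move=> f; apply/L2_eqP.
by apply: filterS2 (L2_add_ae L2_zero f) L2_zero_ae => x -> ->; rewrite add0r.
Qed.

Lemma L2_addN : left_inverse L2_zero L2_opp L2_add.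
Proof.
move=> f; apply/L2_eqP.
apply: filterS3 (L2_add_ae (L2_opp f) f) (L2_scale_ae (-1) f) L2_zero_ae.
by move=> x -> -> ->; rewrite mulN1r addNr.
Qed.

HB.instance Definition _ :=
  GRing.isZmodule.Build L2 L2_addA L2_addC L2_add0 L2_addN.

Lemma L2_scaleA a b (f : L2) : L2_scale a (L2_scale b f) = L2_scale (a * b) f.
Proof.
apply/L2_eqP.
apply: filterS3 (L2_scale_ae a (L2_scale b f)) (L2_scale_ae b f)
  (L2_scale_ae (a * b) f).
by move=> x -> -> ->; rewrite mulrA.
Qed.

Lemma L2_scale1 : left_id 1 L2_scale.
Proof.
by move=> f; apply/L2_eqP; apply: filterS (L2_scale_ae 1 f) => x ->; rewrite mul1r.
Qed.

Lemma L2_scaleDr : right_distributive L2_scale +%R.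
Proof.
move=> a f g; apply/L2_eqP.
apply: filterS3 (L2_scale_ae a (L2_add f g)) (L2_add_ae f g)
  (filterI (L2_add_ae (L2_scale a f) (L2_scale a g))
    (filterI (L2_scale_ae a f) (L2_scale_ae a g))).
by move=> x h1 h2 [h3 [e1 e2]]; rewrite [LHS]h1 h2 [RHS]h3 e1 e2 mulrDr.
Qed.

Lemma L2_scaleDl (f : L2) : {morph L2_scale^~ f : a b / a + b}.
Proof.
move=> a b; apply/L2_eqP.
apply: filterS3 (L2_scale_ae (a + b) f)
  (L2_add_ae (L2_scale a f) (L2_scale b f))
  (filterI (L2_scale_ae a f) (L2_scale_ae b f)).
by move=> x h1 h2 [e1 e2]; rewrite [LHS]h1 [RHS]h2 e1 e2 mulrDl.
Qed.

HB.instance Definition _ := GRing.Zmodule_isLmodule.Build R[i] L2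
  L2_scaleA L2_scale1 L2_scaleDr L2_scaleDl.

Definition inner (f g : L2) : R[i] := cintegral mu (fun x => f x * (g x)^*).

Definition L2norm (f : L2) : R :=
  Num.sqrt (\int[mu]_x (Normc.normc (f x) ^+ 2)).

End L2_space.

Section operators.
Context d1 d2 (T1 : measurableType d1) (T2 : measurableType d2) (R : realType).
Variables (mu : {measure set T1 -> \bar R}) (nu : {measure set T2 -> \bar R}).

Definition bounded_operator (A : L2 mu -> L2 nu) :=
  linear A /\ exists C : R, forall f, L2norm (A f) <= C * L2norm f.

Definition unitary_operator (A : L2 mu -> L2 nu) :=
  [/\ linear A, range A = setT & forall f g, inner (A f) (A g) = inner f g].

(* S is meant to be a linear subspace; A need only be linear on S *)
Definition isometric_isomorphism (S : set (L2 mu)) (S' : set (L2 nu))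
    (A : L2 mu -> L2 nu) :=
  [/\ forall (a : R[i]) f g, S f -> S g -> A (a *: f + g) = a *: A f + A g,
      set_bij S S' A
    & forall f, S f -> L2norm (A f) = L2norm f].

(* Definite descriptions: the default value 0 is not reached when A is a bounded
   operator, resp. when S is a closed subspace *)
Definition adjoint (A : L2 mu -> L2 nu) (g : L2 nu) : L2 mu :=
  xget 0 [set h | forall f, inner (A f) g = inner f h].

Definition orth_proj (S : set (L2 mu)) (f : L2 mu) : L2 mu :=
  xget 0 [set p | S p /\ forall g, S g -> inner (f - p) g = 0].

End operators.

Section tensor.
Context d1 d2 (T1 : measurableType d1) (T2 : measurableType d2) (R : realType).
Variables (mu : {sigma_finite_measure set T1 -> \bar R}).
Variables (nu : {sigma_finite_measure set T2 -> \bar R}).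

Definition tensor (f : L2 mu) (g : L2 nu) : L2 (mu \x nu)%E :=
  toL2 (mu \x nu)%E (fun z => f z.1 * g z.2).

(* The bounded operator acting factorwise on elementary tensors, which span a
   dense subspace *)
Definition tensor_operator (A : L2 mu -> L2 mu) (B : L2 nu -> L2 nu) :
    L2 (mu \x nu)%E -> L2 (mu \x nu)%E :=
  xget (fun=> 0) [set U | bounded_operator U /\
    forall f g, U (tensor f g) = tensor (A f) (B g)].

End tensor.

Section fourier.
Variable R : realType.
Local Notation leb := (@lebesgue_measure R).

Definition cexpi (t : R) : R[i] := cos t +i* sin t.

(* The unitary operator on L2 extending the Fourier integral from the
   intersection of L1 and L2 *)
Definition fourier : L2 leb -> L2 leb :=
  xget (fun=> 0) [set F : L2 leb -> L2 leb | unitary_operator F /\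
    forall f : L2 leb, cintegrable leb f ->
      {ae leb, forall xi, F f xi =
        cintegral leb (fun x => f x * cexpi (- (2 * pi * x * xi)))}].

Definition inverse_fourier : L2 leb -> L2 leb := 'pinv_(fun=> 0) setT fourier.

End fourier.

Section inverse_square_measure.
Variable R : realType.
Local Notation leb := (@lebesgue_measure R).

Definition isq_density (u : R) : \bar R := (if 0 < u then u ^- 2 else 0)%:E.

(* u^-2 du on (0, +oo), as a measure on R under which ]-oo, 0] is null *)
Definition isq_measure (A : set (measurableTypeR R)) : \bar R :=
  (\int[leb]_(u in A) isq_density u)%E.

Lemma isq_density_ge0 u : (0 <= isq_density u)%E.
Proof. by rewrite lee_fin; case: ifPn => // _; rewrite invr_ge0 sqr_ge0. Qed.

Lemma measurable_isq_density : measurable_fun setT isq_density.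
Proof.
apply/measurable_EFinP; apply: measurable_fun_if => //=.
- exact: measurable_fun_ltr.
- rewrite setTI (_ : _ @^-1` _ = `]0, +oo[%classic); last first.
    by apply/seteqP; split => u /=; rewrite in_itv/= andbT.
  apply: open_continuous_measurable_fun => //.
  move=> u; rewrite inE/= in_itv/= andbT => u0.
  apply: cvgV; first by rewrite expf_neq0// gt_eqF.
  exact: exprn_continuous.
Qed.

Lemma isq_measure0 : isq_measure set0 = 0%E.
Proof. exact: integral_set0. Qed.

Lemma isq_measure_ge0 A : (0 <= isq_measure A)%E.
Proof. by apply: integral_ge0 => u _; exact: isq_density_ge0. Qed.

Lemma isq_measure_sigma_additive : semi_sigma_additive isq_measure.
Proof.
apply: (@semi_sigma_additive_nng_induced _ _ _ leb isq_density).
- exact: measurable_isq_density.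
- exact: isq_density_ge0.
Qed.

HB.instance Definition _ := isMeasure.Build _ _ _ isq_measure
  isq_measure0 isq_measure_ge0 isq_measure_sigma_additive.

Lemma isq_measure_sigma_finite : sigma_finite setT isq_measure.
Proof.
pose F (n : nat) : set (measurableTypeR R) :=
  `[- n%:R, 0] `|` `[n.+1%:R^-1, n%:R].
have mF n : measurable (F n) by apply: measurableU; exact: measurable_itv.
exists F.
  apply/esym; rewrite -subTset => u _.
  have [u0|u0] := leP u 0.
    exists (Num.truncn (- u)).+1 => //; left; rewrite /= in_itv /= u0 andbT.
    by rewrite lerNl ltW// truncnS_gt.
  pose n := maxn (Num.truncn u).+1 (Num.truncn u^-1).+1.
  exists n => //; right; rewrite /= in_itv /=; apply/andP; split.
    rewrite invf_ple ?posrE//.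
    apply: le_trans (_ : (Num.truncn u^-1).+1%:R <= _).
      by rewrite ltW// truncnS_gt.
    by rewrite ler_nat ltnW// ltnS leq_maxr.
  apply: le_trans (_ : (Num.truncn u).+1%:R <= _).
    by rewrite ltW// truncnS_gt.
  by rewrite ler_nat leq_maxl.
move=> n; split => //.
apply: (@le_lt_trans _ _ (\int[leb]_(u in F n) (n.+1%:R ^+ 2)%:E)%E).
  apply: ge0_le_integral => //.
  - by move=> u _; exact: isq_density_ge0.
  - exact: measurable_funTS measurable_isq_density.
  move=> u Fu; rewrite lee_fin; case: ifPn => [u0|_]; last exact: sqr_ge0.
  case: Fu => /=; rewrite in_itv /= => /andP[].
    by move=> _ /(lt_le_trans u0); rewrite ltxx.
  move=> nu _; have uVn : u^-1 <= n.+1%:R by rewrite invf_ple ?posrE.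
  by rewrite -exprVn; apply: lerXn2r; rewrite ?nnegrE ?invr_ge0 // ltW.
rewrite integral_cst//; apply: lte_mul_pinfty => //.
apply: (@le_lt_trans _ _ (leb `[(- n%:R)%R, 0%R] +
    leb `[(n.+1%:R^-1)%R, n%:R%R])%E).
  by apply: measureU2; exact: measurable_itv.
by apply: lte_add_pinfty; rewrite lebesgue_measure_itv; case: ifPn; rewrite ?ltry.
Qed.

HB.instance Definition _ :=
  Measure_isSigmaFinite.Build _ _ _ isq_measure isq_measure_sigma_finite.

End inverse_square_measure.

(* Wavelet: G = (0, +oo) x R with dzeta = u^-2 du dv and zeta = (u, v).
   TimeFrequency: G = R x R with dzeta = dq dp and zeta = (q, p). *)
Variant transform_case := Wavelet | TimeFrequency.

Section transforms.
Variables (R : realType) (c : transform_case).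
Local Notation leb := (@lebesgue_measure R).
Implicit Type Psi : L2 leb.

Definition admissible_wavelet (psi : L2 leb) :=
  {ae leb, forall x, Im (psi x) = 0} /\
  {ae leb, forall xi : R,
    (\int[leb]_(t in `]0%R, +oo[)
      (Normc.normc (fourier psi (t * xi)) ^+ 2 / t)%:E = 1)%E}.

Definition admissible_window (phi : L2 leb) := L2norm phi = 1.

Definition admissible Psi :=
  match c with
  | Wavelet => admissible_wavelet Psi
  | TimeFrequency => admissible_window Psi
  end.

Definition measure_G1 :
    {sigma_finite_measure set (measurableTypeR R) -> \bar R} :=
  match c with
  | Wavelet => @isq_measure R
  | TimeFrequency => leb
  end.

Definition measure_G := (measure_G1 \x leb)%E.

(* Psi_zeta; in the wavelet case only u > 0 is relevant *)
Definition atom Psi (zeta : R * R) : L2 leb :=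
  match c with
  | Wavelet => let: (u, v) := zeta in
      toL2 leb (fun x => ((Num.sqrt u)^-1)%:C * Psi ((x - v) / u))
  | TimeFrequency => let: (q, p) := zeta in
      toL2 leb (fun x => cexpi (2 * pi * p * x) * Psi (x - q))
  end.

Definition ell Psi (z omega : R) : R[i] :=
  match c with
  | Wavelet => (Num.sqrt z)%:C * (fourier Psi (z * omega))^*
  | TimeFrequency => (Psi (omega - z))^*
  end.

Definition W_op Psi (f : L2 leb) : L2 measure_G :=
  toL2 measure_G (fun zeta => inner f (atom Psi zeta)).

Definition U_op : L2 measure_G -> L2 measure_G :=
  tensor_operator (mu := measure_G1) (nu := leb) id
    match c with
    | Wavelet => @fourier R
    | TimeFrequency => @inverse_fourier R
    end.

Definition Q_op Psi (f : L2 leb) : L2 measure_G :=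
  toL2 measure_G (fun z => f z.2 * ell Psi z.1 z.2).

Definition Q_adj Psi (F : L2 measure_G) : L2 leb :=
  toL2 leb (fun xi =>
    cintegral measure_G1 (fun t => F (t, xi) * (ell Psi t xi)^*)).

End transforms.

Arguments measure_G1 : clear implicits.
Arguments measure_G : clear implicits.
Arguments U_op : clear implicits.
Arguments W_op {R} c Psi f.
Arguments Q_op {R} c Psi f.
Arguments Q_adj {R} c Psi F.

(* Main.v *)
(* Put V = U_Psi^{-1}.  Admissibility says that the squared modulus of ell_Psi
   integrates to 1 over G_1 for almost every omega, so Q_Psi is an isometry and
   Q_Psi^* Q_Psi = I.  By Plancherel the transform factors as W_Psi = V Q_Psi F
   (wavelet case) or W_Psi = V Q_Psi (time-frequency case); hence the range of
   W_Psi is that of V Q_Psi = R_Psi^*, and everything follows from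
   R_Psi = Q_Psi^* U_Psi.

   The unitary Fourier transform and the operator I (x) F are extensions of
   isometries prescribed on total families: signed indicators of intervals,
   whose Gram matrix is preserved because the integral of (1 - cos x) / x^2
   over [0, +oo[ is pi / 2, and elementary tensors.  Almost everywhere
   identities are tested against indicators of intervals or of rectangles. *)
From HB Require Import structures.
Require Import Defs.
From mathcomp Require Import all_boot all_order all_algebra.
From mathcomp Require Import all_classical all_reals all_analysis.
From mathcomp Require Import measurable_realfun complex ring lra.

Set Implicit Arguments.
Unset Strict Implicit.
Unset Printing Implicit Defensive.

Import Order.TTheory GRing.Theory Num.Theory.
Import numFieldNormedType.Exports.

Local Open Scope classical_set_scope.
Local Open Scope complex_scope.
Local Open Scope ring_scope.

Local Notation Re := complex.Re.
Local Notation Im := complex.Im.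
Local Notation normc := Normc.normc.

(** * Complex-valued integration *)

Section complex_facts.
Context {R : realType}.
Implicit Types z w : R[i].

(** [fourier], [tensor_operator], [adjoint] and [orth_proj] are definite descriptions, so each must
    be shown to exist and to be unique before it can be computed with. For the first two, both
    halves rest on one principle: a closed subspace containing a total family is the whole space
    ([hclosed_setT]). Surjectivity of the Fourier transform does not come from a study of its range.
    The extensions for the kernels exp(-2 pi i x xi) and exp(2 pi i x xi) are adjoint to each other,
    by Fubini on boxes, and two mutually adjoint isometries are inverse to each other. The obstacle
    in the factorization is that W f is given pointwise, as a family of Fourier integrals. Nothing
    says beforehand that it is square-integrable on G, while [toL2] sends every function outside L2
    to 0. It is however bounded, hence integrable over rectangles of finite measure. Testing there
    identifies it almost everywhere with an element of L2, from which it inherits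
    square-integrability. The two cases then differ only in the sign s of the kernel and in a
    preliminary Fourier transform of f. *)

Lemma normc_ge0 z : 0 <= normc z.
Proof. by case: z => a b; exact: sqrtr_ge0. Qed.

Lemma Re_le_normc z : `|Re z| <= normc z.
Proof.
case: z => a b /=; rewrite -sqrtr_sqr ler_wsqrtr// lerDl sqr_ge0//.
Qed.

Lemma Im_le_normc z : `|Im z| <= normc z.
Proof.
case: z => a b /=; rewrite -sqrtr_sqr ler_wsqrtr// lerDr sqr_ge0//.
Qed.

Lemma normc_le_ReIm z : normc z <= `|Re z| + `|Im z|.
Proof.
rewrite -[leLHS]ger0_norm ?normc_ge0// -ler_sqr ?nnegrE// ?addr_ge0//.
rewrite real_normK ?num_real// normc2E sqrrD !real_normK ?num_real//.
by rewrite -addrA lerD2l lerDr mulrn_wge0// mulr_ge0.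
Qed.

Lemma conjcE z : conjc z = z^*.
Proof. by []. Qed.

Lemma normcJ z : normc z^* = normc z.
Proof. by rewrite -conjcE; case: z => a b /=; rewrite sqrrN. Qed.

Lemma ReM z w : Re (z * w) = Re z * Re w - Im z * Im w.
Proof. by case: z w => [a b] [c d]. Qed.
Lemma ImM z w : Im (z * w) = Re z * Im w + Im z * Re w.
Proof. by case: z w => [a b] [c d]. Qed.
Lemma ReD z w : Re (z + w) = Re z + Re w.
Proof. by case: z w => [a b] [c d]. Qed.
Lemma ImD z w : Im (z + w) = Im z + Im w.
Proof. by case: z w => [a b] [c d]. Qed.
Lemma ReJ z : Re z^* = Re z.
Proof. by rewrite -conjcE; case: z. Qed.
Lemma ImJ z : Im z^* = - Im z.
Proof. by rewrite -conjcE; case: z. Qed.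
Lemma ReN z : Re (- z) = - Re z.
Proof. by case: z. Qed.
Lemma ImN z : Im (- z) = - Im z.
Proof. by case: z. Qed.
Lemma complex_ext z w : Re z = Re w -> Im z = Im w -> z = w.
Proof. by case: z w => [a b] [c d] /= -> ->. Qed.

Lemma mulcJ z : z * z^* = (normc z ^+ 2)%:C.
Proof.
by rewrite normc2E; case: z => a b; apply: complex_ext => /=; ring.
Qed.

(** From (|z| - |w|)^2 >= 0. It makes products of square-integrable functions integrable and bounds
    their Fourier integrals uniformly. *)
Lemma normcM_le z w : normc (z * w) <= normc z ^+ 2 + normc w ^+ 2.
Proof.
rewrite Normc.normcM -subr_ge0.
have := sqr_ge0 (normc z - normc w); have := normc_ge0 z; have := normc_ge0 w.
by nra.
Qed.

End complex_facts.

Section cmeasurable_facts.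
Context d (T : measurableType d) (R : realType).
Implicit Types f g : T -> R[i].

Lemma cmeasurableM f g : cmeasurable f -> cmeasurable g ->
  cmeasurable (fun x => f x * g x).
Proof.
move=> [f1 f2] [g1 g2]; split.
  under eq_fun do rewrite ReM.
  by apply: measurable_funB; exact: measurable_funM.
under eq_fun do rewrite ImM.
by apply: measurable_funD; exact: measurable_funM.
Qed.

Lemma cmeasurableB f g : cmeasurable f -> cmeasurable g ->
  cmeasurable (fun x => f x - g x).
Proof.
move=> [f1 f2] [g1 g2]; split.
  by under eq_fun do rewrite ReD ReN; exact: measurable_funB.
by under eq_fun do rewrite ImD ImN; exact: measurable_funB.
Qed.

Lemma cmeasurableJ f : cmeasurable f -> cmeasurable (fun x => (f x)^*).
Proof.
move=> [f1 f2]; split; first by under eq_fun do rewrite ReJ.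
by under eq_fun do rewrite ImJ; exact: measurableT_comp.
Qed.

Lemma cmeasurable_if (b : T -> bool) f g : measurable_fun setT b ->
  cmeasurable f -> cmeasurable g ->
  cmeasurable (fun x => if b x then f x else g x).
Proof.
move=> mb [f1 f2] [g1 g2]; split.
  have -> : (fun x => Re (if b x then f x else g x)) =
      (fun x => if b x then Re (f x) else Re (g x)).
    by apply/funext => x; case: (b x).
  exact: measurable_fun_ifT.
have -> : (fun x => Im (if b x then f x else g x)) =
    (fun x => if b x then Im (f x) else Im (g x)).
  by apply/funext => x; case: (b x).
exact: measurable_fun_ifT.
Qed.

Lemma cmeasurable_cst (a : R[i]) : cmeasurable (fun _ : T => a).
Proof. by split; exact: measurable_cst. Qed.

Lemma cmeasurable_real (h : T -> R) : measurable_fun setT h ->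
  cmeasurable (fun x => (h x)%:C).
Proof. by move=> mh; split => //; exact: measurable_cst. Qed.

Lemma cmeasurable_comp d' (T' : measurableType d') (h : T' -> T) f :
  measurable_fun setT h -> cmeasurable f -> cmeasurable (f \o h).
Proof. by move=> mh [f1 f2]; split; [exact: (measurableT_comp f1 mh)|exact: (measurableT_comp f2 mh)]. Qed.

Lemma measurable_normc f : cmeasurable f ->
  measurable_fun setT (fun x => normc (f x)).
Proof.
move=> [f1 f2].
rewrite (_ : (fun _ => _) = (fun x => Num.sqrt (Re (f x) ^+ 2 + Im (f x) ^+ 2))).
  apply: measurableT_comp; first exact: (continuous_measurable_fun (@sqrt_continuous R)).
  by apply: measurable_funD; exact: measurable_funX.
by apply/funext => x; case: (f x).
Qed.

End cmeasurable_facts.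

Section cintegral_facts.
Context d (T : measurableType d) (R : realType) (mu : {measure set T -> \bar R}).
Implicit Types f g : T -> R[i].

Lemma cintegrable_measurable f : cintegrable mu f -> cmeasurable f.
Proof.
by move=> [/measurable_int /measurable_EFinP f1 /measurable_int /measurable_EFinP f2].
Qed.

Lemma cintegrable_le f (h : T -> R) : cmeasurable f ->
  mu.-integrable setT (EFin \o h) -> (forall x, normc (f x) <= h x) ->
  cintegrable mu f.
Proof.
move=> [f1 f2] ih fh; split.
  apply: (le_integrable _ _ _ ih) => //; first exact/measurable_EFinP.
  move=> x _ /=; rewrite lee_fin (le_trans (Re_le_normc _))//.
  by rewrite (le_trans (fh x))// ler_norm.
apply: (le_integrable _ _ _ ih) => //; first exact/measurable_EFinP.
move=> x _ /=; rewrite lee_fin (le_trans (Im_le_normc _))//.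
by rewrite (le_trans (fh x))// ler_norm.
Qed.

Lemma integrable_normc f : cintegrable mu f ->
  mu.-integrable setT (fun x => (normc (f x))%:E).
Proof.
move=> fi; have mf := cintegrable_measurable fi; case: fi => i1 i2.
have := integrableD measurableT (integrable_norm i1) (integrable_norm i2).
move/le_integrable; apply => //.
  by apply/measurable_EFinP; exact: measurable_normc.
move=> x _ /=; rewrite lee_fin ger0_norm ?normc_ge0//.
by rewrite ger0_norm ?normc_le_ReIm// addr_ge0.
Qed.

Lemma cintegrableP f : cmeasurable f ->
  (\int[mu]_x (normc (f x))%:E < +oo)%E -> cintegrable mu f.
Proof.
move=> mf fi; apply: (@cintegrable_le _ (fun x => normc (f x))) => //.
apply/integrableP; split; first by apply/measurable_EFinP; exact: measurable_normc.
rewrite (le_lt_trans _ fi)//; apply: ge0_le_integral => //=.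
- by apply/measurable_EFinP/measurableT_comp => //; exact: measurable_normc.
- by apply/measurable_EFinP; exact: measurable_normc.
- by move=> x _; rewrite lee_fin ger0_norm ?normc_ge0.
Qed.

Lemma cintegrable_lt f : cintegrable mu f ->
  (\int[mu]_x (normc (f x))%:E < +oo)%E.
Proof.
move=> /integrable_normc /integrableP[_].
by under eq_integral do rewrite /= ger0_norm ?normc_ge0//.
Qed.

Lemma cintegrable_dom f g : cmeasurable f -> cintegrable mu g ->
  (forall x, normc (f x) <= normc (g x)) -> cintegrable mu f.
Proof. by move=> mf /integrable_normc; exact: cintegrable_le. Qed.

Lemma cintegrableD f g : cintegrable mu f -> cintegrable mu g ->
  cintegrable mu (fun x => f x + g x).
Proof.
move=> [f1 f2] [g1 g2]; split.
  under eq_fun do rewrite ReD EFinD.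
  exact: (integrableD _ f1 g1).
under eq_fun do rewrite ImD EFinD.
exact: (integrableD _ f2 g2).
Qed.

Lemma cintegrableZ (a : R[i]) f : cintegrable mu f ->
  cintegrable mu (fun x => a * f x).
Proof.
move=> fi; apply: (@cintegrable_le _ (fun x => normc a * normc (f x))).
- by apply: cmeasurableM; [exact: cmeasurable_cst|exact: cintegrable_measurable].
- have := integrableZl measurableT (normc a) (integrable_normc fi).
  by apply: eq_integrable.
- by move=> x; rewrite Normc.normcM.
Qed.

Lemma cintegrableJ f : cintegrable mu f -> cintegrable mu (fun x => (f x)^*).
Proof.
move=> fi; apply: (cintegrable_dom _ fi); last by move=> x; rewrite normcJ.
exact: (cmeasurableJ (cintegrable_measurable fi)).
Qed.

Lemma eq_cintegral f g : f =1 g -> cintegral mu f = cintegral mu g.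
Proof. by move/funext ->. Qed.

Lemma cintegralD f g : cintegrable mu f -> cintegrable mu g ->
  cintegral mu (fun x => f x + g x) = cintegral mu f + cintegral mu g.
Proof.
move=> [f1 f2] [g1 g2]; apply: complex_ext => /=.
  by under eq_Rintegral do rewrite ReD; rewrite RintegralD.
by under eq_Rintegral do rewrite ImD; rewrite RintegralD.
Qed.

Lemma cintegralZ (a : R[i]) f : cintegrable mu f ->
  cintegral mu (fun x => a * f x) = a * cintegral mu f.
Proof.
move=> [f1 f2].
have rf (r : R) (h : T -> R) : mu.-integrable setT (EFin \o h) ->
    mu.-integrable setT (EFin \o (fun x => r * h x)).
  by move=> /(integrableZl measurableT r); apply: eq_integrable.
apply: complex_ext => /=; rewrite ?ReM ?ImM/=.
  under eq_Rintegral do rewrite ReM.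
  by rewrite RintegralB ?RintegralZl//; exact: rf.
under eq_Rintegral do rewrite ImM.
by rewrite RintegralD ?RintegralZl//; exact: rf.
Qed.

Lemma cintegralB f g : cintegrable mu f -> cintegrable mu g ->
  cintegral mu (fun x => f x - g x) = cintegral mu f - cintegral mu g.
Proof.
move=> fi gi; under [X in cintegral _ X]eq_fun do rewrite -mulN1r.
by rewrite cintegralD ?cintegralZ ?mulN1r//; exact: cintegrableZ.
Qed.

Lemma cintegralJ f : cintegrable mu f ->
  cintegral mu (fun x => (f x)^*) = (cintegral mu f)^*.
Proof.
move=> [f1 f2]; apply: complex_ext => /=.
  by under eq_Rintegral do rewrite ReJ.
under eq_Rintegral do rewrite ImJ -mulN1r.
by rewrite RintegralZl// mulN1r.
Qed.

Lemma ae_eq_cintegral f g : cmeasurable f -> cmeasurable g ->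
  {ae mu, forall x, f x = g x} -> cintegral mu f = cintegral mu g.
Proof.
move=> [f1 f2] [g1 g2] fg; apply: complex_ext => /=; congr fine.
  apply: ae_eq_integral => //; try exact/measurable_EFinP.
  by apply: filterS fg => x /= ->.
apply: ae_eq_integral => //; try exact/measurable_EFinP.
by apply: filterS fg => x /= ->.
Qed.

Lemma ae_eq_cintegrable f g : cmeasurable g ->
  {ae mu, forall x, f x = g x} -> cintegrable mu f -> cintegrable mu g.
Proof.
move=> mg fg fi; apply: cintegrableP => //.
rewrite (le_lt_trans _ (cintegrable_lt fi))// le_eqVlt; apply/orP; left; apply/eqP.
apply: ae_eq_integral => //.
- by apply/measurable_EFinP; exact: measurable_normc.
- apply/measurable_EFinP; apply: measurable_normc.
  exact: (cintegrable_measurable fi).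
- by apply: filterS fg => x /= ->.
Qed.

Lemma sqint_cintegrable f g : sqint mu f -> sqint mu g ->
  cintegrable mu (fun x => f x * g x).
Proof.
move=> [mf f2] [mg g2]; apply: cintegrableP; first exact: cmeasurableM.
apply: (@le_lt_trans _ _ (\int[mu]_x ((normc (f x) ^+ 2)%:E + (normc (g x) ^+ 2)%:E))%E).
  apply: ge0_le_integral => //=.
  - by move=> x _; rewrite lee_fin normc_ge0.
  - by apply/measurable_EFinP; apply: measurable_normc; exact: cmeasurableM.
  - by apply: emeasurable_funD; exact: measurable_normc2.
  - by move=> x _; rewrite lee_fin normcM_le.
rewrite ge0_integralD//; last 4 first.
- by move=> x _; rewrite lee_fin sqr_ge0.
- exact: measurable_normc2.
- by move=> x _; rewrite lee_fin sqr_ge0.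
- exact: measurable_normc2.
by rewrite lte_add_pinfty.
Qed.

Lemma sqintJ f : sqint mu f -> sqint mu (fun x => (f x)^*).
Proof.
move=> [mf lf]; split; first exact: cmeasurableJ.
by under eq_integral do rewrite normcJ.
Qed.

Lemma sqint_cintegrableJ f g : sqint mu f -> sqint mu g ->
  cintegrable mu (fun x => f x * (g x)^*).
Proof. by move=> sf sg; apply: sqint_cintegrable => //; exact: sqintJ. Qed.

Lemma ae_eq_sqint f g : cmeasurable g ->
  {ae mu, forall x, f x = g x} -> sqint mu f -> sqint mu g.
Proof.
move=> mg fg [mf fi]; split => //.
rewrite (le_lt_trans _ fi)// le_eqVlt; apply/orP; left; apply/eqP.
apply: ae_eq_integral => //; try exact: measurable_normc2.
by apply: filterS fg => x /= ->.
Qed.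

End cintegral_facts.

(** * Fubini and Tonelli for complex kernels *)

Section complex_fubini.
Context d1 d2 (T1 : measurableType d1) (T2 : measurableType d2) (R : realType).
Variables (mu : {sigma_finite_measure set T1 -> \bar R}).
Variables (nu : {sigma_finite_measure set T2 -> \bar R}).
Implicit Types k : T1 * T2 -> R[i].

(** No integrability is assumed: [Rintegral] is [fine] of the difference of the Tonelli integrals of
    the positive and negative parts, and each of these is measurable in x. *)
Let measurable_fine_pi1 (h : T1 * T2 -> R) : measurable_fun setT h ->
  measurable_fun setT (fun x => \int[nu]_y h (x, y)).
Proof.
move=> mh; apply: measurableT_comp => //.
have -> : (fun x => \int[nu]_z (h (x, z))%:E)%E =
    (fubini_F nu (EFin \o h)^\+ \- fubini_F nu (EFin \o h)^\-)%E.
  apply/funext => x; rewrite [LHS]integralE /=; congr (_ - _)%E; apply: eq_integral => y _.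
    exact: (congr1 (@^~ y) (funepos_comp (EFin \o h) (pair x))).
  exact: (congr1 (@^~ y) (funeneg_comp (EFin \o h) (pair x))).
apply: emeasurable_funB.
  apply: (@measurable_fun_fubini_tonelli_F _ _ _ _ _ nu (EFin \o h)^\+%E) => //.
  by apply: measurable_funepos; exact/measurable_EFinP.
apply: (@measurable_fun_fubini_tonelli_F _ _ _ _ _ nu (EFin \o h)^\-%E) => //.
by apply: measurable_funeneg; exact/measurable_EFinP.
Qed.

Let measurable_fine_pi2 (h : T1 * T2 -> R) : measurable_fun setT h ->
  measurable_fun setT (fun y => \int[mu]_x h (x, y)).
Proof.
move=> mh; apply: measurableT_comp => //.
have -> : (fun y => \int[mu]_z (h (z, y))%:E)%E =
    (fubini_G mu (EFin \o h)^\+ \- fubini_G mu (EFin \o h)^\-)%E.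
  apply/funext => x; rewrite [LHS]integralE /=; congr (_ - _)%E; apply: eq_integral => y _.
    exact: (congr1 (@^~ y) (funepos_comp (EFin \o h) (pair^~ x))).
  exact: (congr1 (@^~ y) (funeneg_comp (EFin \o h) (pair^~ x))).
apply: emeasurable_funB.
  apply: (@measurable_fun_fubini_tonelli_G _ _ _ _ _ mu (EFin \o h)^\+%E) => //.
  by apply: measurable_funepos; exact/measurable_EFinP.
apply: (@measurable_fun_fubini_tonelli_G _ _ _ _ _ mu (EFin \o h)^\-%E) => //.
by apply: measurable_funeneg; exact/measurable_EFinP.
Qed.

Lemma cmeasurable_cintegral1 k : cmeasurable k ->
  cmeasurable (fun x => cintegral nu (fun y => k (x, y))).
Proof.
by move=> [k1 k2]; split => /=;
  [exact: (measurable_fine_pi1 k1)|exact: (measurable_fine_pi1 k2)].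
Qed.

Lemma cmeasurable_cintegral2 k : cmeasurable k ->
  cmeasurable (fun y => cintegral mu (fun x => k (x, y))).
Proof.
by move=> [k1 k2]; split => /=;
  [exact: (measurable_fine_pi2 k1)|exact: (measurable_fine_pi2 k2)].
Qed.

(** [Rintegral] agrees with the extended inner integral only where the latter is finite.
    Integrability of h makes this happen almost everywhere, and the equality is transported through
    that set. *)
Let Rfubini1 (h : T1 * T2 -> R) : (mu \x nu)%E.-integrable setT (EFin \o h) ->
  (mu.-integrable setT (fun x => (\int[nu]_y h (x, y))%:E)) /\
  \int[(mu \x nu)%E]_z h z = \int[mu]_x \int[nu]_y h (x, y).
Proof.
move=> hi.
have aefin : {ae mu, forall x, (fubini_F nu (EFin \o h) x \is a fin_num)}.
  have := ae_integrable1 hi; apply: filterS => x hx.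
  exact: integrable_fin_num.
have mR : measurable_fun setT (fun x => (\int[nu]_y h (x, y))%:E).
  apply/measurable_EFinP; apply: measurable_fine_pi1.
  by apply/measurable_EFinP; exact: (measurable_int _ hi).
have aeE : {ae mu, forall x, setT x ->
    (\int[nu]_y h (x, y))%:E = fubini_F nu (EFin \o h) x}.
  by apply: filterS aefin => x hx _; rewrite /Rintegral fineK.
split.
  apply/integrableP; split => //.
  have /integrableP[_] := integrable_fubini_F hi.
  apply: le_lt_trans; rewrite le_eqVlt; apply/orP; left; apply/eqP.
  apply: ae_eq_integral => //.
  - exact: measurableT_comp.
  - by apply: measurableT_comp => //; exact: (measurable_fubini_F hi).
  - by apply: filterS aeE => x hx xT; rewrite (hx xT).
rewrite {1}/Rintegral -integral12_prod_meas1//; congr fine.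
apply: ae_eq_integral => //; first exact: (measurable_fubini_F hi).
by apply: filterS aeE => x hx xT; rewrite (hx xT).
Qed.

Let Rfubini2 (h : T1 * T2 -> R) : (mu \x nu)%E.-integrable setT (EFin \o h) ->
  (nu.-integrable setT (fun y => (\int[mu]_x h (x, y))%:E)) /\
  \int[(mu \x nu)%E]_z h z = \int[nu]_y \int[mu]_x h (x, y).
Proof.
move=> hi.
have aefin : {ae nu, forall x, (fubini_G mu (EFin \o h) x \is a fin_num)}.
  have := ae_integrable2 hi; apply: filterS => x hx.
  exact: integrable_fin_num.
have mR : measurable_fun setT (fun y => (\int[mu]_x h (x, y))%:E).
  apply/measurable_EFinP; apply: measurable_fine_pi2.
  by apply/measurable_EFinP; exact: (measurable_int _ hi).
have aeE : {ae nu, forall y, setT y ->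
    (\int[mu]_x h (x, y))%:E = fubini_G mu (EFin \o h) y}.
  by apply: filterS aefin => x hx _; rewrite /Rintegral fineK.
have i21 := integral21_prod_meas1 hi.
have mG := measurable_fubini_G hi.
split.
  apply/integrableP; split => //.
  have /integrableP[mh hoo] := hi.
  (* The iterated integral of |h| in this order is finite and dominates the integral of
     |[fubini_G]|. *)
  move/(integrable21ltyP mu nu mh) : hi => hi.
  apply: le_lt_trans hi.
  apply: (@le_trans _ _ (\int[nu]_y `|fubini_G mu (EFin \o h) y|)%E).
    rewrite le_eqVlt; apply/orP; left; apply/eqP; apply: ae_eq_integral => //.
    - exact: measurableT_comp.
    - exact: measurableT_comp.
    - by apply: filterS aeE => x hx xT; rewrite (hx xT).
  apply: ge0_le_integral => //.
  - exact: measurableT_comp.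
  - apply: (@measurable_fun_fubini_tonelli_G _ _ _ _ _ mu (abse \o (EFin \o h))).
      exact: measurableT_comp.
    by move=> z; exact: abse_ge0.
  move=> y _; apply: le_abse_integral => //.
  by apply: measurableT_comp => //; exact: measurableT_comp.
rewrite {1}/Rintegral -i21; congr fine.
apply: ae_eq_integral => //.
by apply: filterS aeE => x hx xT; rewrite (hx xT).
Qed.

Lemma cintegrable_cintegral2 k : cintegrable (mu \x nu)%E k ->
  cintegrable nu (fun y => cintegral mu (fun x => k (x, y))).
Proof.
by move=> [k1 k2]; split => /=;
  [exact: (Rfubini2 k1).1|exact: (Rfubini2 k2).1].
Qed.

Lemma cfubini1 k : cintegrable (mu \x nu)%E k ->
  cintegral (mu \x nu)%E k = cintegral mu (fun x => cintegral nu (fun y => k (x, y))).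
Proof.
by move=> [k1 k2]; apply: complex_ext => /=;
  [exact: (Rfubini1 k1).2|exact: (Rfubini1 k2).2].
Qed.

Lemma cfubini2 k : cintegrable (mu \x nu)%E k ->
  cintegral (mu \x nu)%E k = cintegral nu (fun y => cintegral mu (fun x => k (x, y))).
Proof.
by move=> [k1 k2]; apply: complex_ext => /=;
  [exact: (Rfubini2 k1).2|exact: (Rfubini2 k2).2].
Qed.

Lemma ae_cintegrable2 k : cintegrable (mu \x nu)%E k ->
  {ae nu, forall y, cintegrable mu (fun x => k (x, y))}.
Proof.
move=> [k1 k2]; apply: filterS2 (ae_integrable2 k1) (ae_integrable2 k2).
by move=> x h1 h2; split.
Qed.

Lemma cintegrable_prod k : cmeasurable k ->
  (\int[mu]_x \int[nu]_y (normc (k (x, y)))%:E < +oo)%E ->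
  cintegrable (mu \x nu)%E k.
Proof.
move=> mk kfin; apply: cintegrableP => //.
rewrite (@fubini_tonelli1 _ _ _ _ _ mu nu (fun z => (normc (k z))%:E))//.
- by apply/measurable_EFinP; exact: measurable_normc.
- by move=> z; rewrite lee_fin normc_ge0.
Qed.

Lemma cintegrable_tensor f g : cintegrable mu f -> cintegrable nu g ->
  cintegrable (mu \x nu)%E (fun z => f z.1 * g z.2).
Proof.
move=> fi gi; have mf := cintegrable_measurable fi.
have mg := cintegrable_measurable gi.
apply: cintegrable_prod.
  by apply: cmeasurableM; [exact: (cmeasurable_comp measurable_fst mf)|
    exact: (cmeasurable_comp measurable_snd mg)].
have mnf : measurable_fun setT (fun x => (normc (f x))%:E).
  by apply/measurable_EFinP; exact: measurable_normc.
have mng : measurable_fun setT (fun x => (normc (g x))%:E).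
  by apply/measurable_EFinP; exact: measurable_normc.
have g0 : (0 <= \int[nu]_y (normc (g y))%:E)%E.
  by apply: integral_ge0 => y _; rewrite lee_fin normc_ge0.
have -> : (\int[mu]_x \int[nu]_y (normc (f x * g y))%:E =
    \int[mu]_x ((\int[nu]_y (normc (g y))%:E) * (normc (f x))%:E))%E.
  apply: eq_integral => x _.
  under eq_integral do rewrite Normc.normcM EFinM.
  rewrite ge0_integralZl//; first exact: muleC.
  - by move=> y _; rewrite lee_fin normc_ge0.
  - by rewrite lee_fin normc_ge0.
rewrite ge0_integralZl//; last by move=> y _; rewrite lee_fin normc_ge0.
apply: lte_mul_pinfty => //; last exact: cintegrable_lt.
by rewrite ge0_fin_numE//; exact: cintegrable_lt.
Qed.

End complex_fubini.

(** The inner product is an explicit argument, so that one theory serves the L2 spaces of several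
    measures at once. Positivity is asked of the real part only; that p f f is real follows from
    [ipC]. *)
Record inner_product (R : realType) (H : lmodType R[i]) := InnerProduct {
  ip :> H -> H -> R[i];
  ipDl : forall f g h, ip (f + g) h = ip f h + ip g h;
  ipZl : forall a f h, ip (a *: f) h = a * ip f h;
  ipC : forall f g, ip g f = (ip f g)^*;
  ip_ge0 : forall f, 0 <= Re (ip f f);
  ip_eq0 : forall f, ip f f = 0 -> f = 0 }.

Definition hnorm (R : realType) (H : lmodType R[i]) (p : inner_product H)
  (f : H) : R := Num.sqrt (Re (p f f)).

(* Geometrically fast Cauchy sequences suffice for completeness; the explicit
   rate replaces limits. *)
Definition hcomplete (R : realType) (H : lmodType R[i]) (p : inner_product H) :=
  forall u : nat -> H, (forall n, hnorm p (u n.+1 - u n) <= 2 ^- n) ->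
  exists f, forall n, hnorm p (u n - f) <= 2 * 2 ^- n.

Definition hclosed (R : realType) (H : lmodType R[i]) (p : inner_product H)
    (S : set H) :=
  forall f, (forall e, 0 < e -> exists2 g, S g & hnorm p (f - g) < e) -> S f.

(** Density expressed by orthogonality, without forming spans; [hclosed_setT] turns it back into an
    induction principle for closed subspaces. *)
Definition htotal (R : realType) (H : lmodType R[i]) (p : inner_product H)
    (I : Type) (e : I -> H) :=
  forall h, (forall i, p h (e i) = 0) -> h = 0.

Lemma eq0_of_small (R : realType) (x C : R) : 0 <= x -> 0 <= C ->
  (forall e, 0 < e -> x <= e * C) -> x = 0.
Proof.
move=> x0 C0 H; apply/eqP; rewrite eq_le x0 andbT leNgt; apply/negP => xp.
have C1 : 0 < 2 * (C + 1) by lra.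
have := H (x / (2 * (C + 1))) (divr_gt0 xp C1).
rewrite mulrAC ler_pdivlMr//; nra.
Qed.

Lemma exp2V_small (R : realType) (e : R) : 0 < e -> exists n, 2 ^- n < e.
Proof.
move=> e0.
have /cvgrPdist_lt/(_ e e0)[n _ /(_ n (leqnn n))] :=
  @cvg_geometric R 1 2^-1 ltac:(rewrite ger0_norm; lra).
rewrite /= sub0r normrN mul1r ger0_norm ?exprn_ge0// exprVn.
by exists n.
Qed.

(** * Abstract inner product spaces *)

Section inner_product_theory.
Context {R : realType} {H : lmodType R[i]} (p : inner_product H).
Implicit Types f g h : H.
Local Notation N := (hnorm p).

Lemma ipDr f g h : p h (f + g) = p h f + p h g.
Proof. by rewrite ipC ipDl rmorphD/= -!ipC. Qed.

Lemma ipZr (a : R[i]) f h : p h (a *: f) = a^* * p h f.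
Proof. by rewrite ipC ipZl rmorphM/= -ipC. Qed.

Lemma ipNl f h : p (- f) h = - p f h.
Proof. by rewrite -scaleN1r ipZl mulN1r. Qed.

Lemma ipNr f h : p h (- f) = - p h f.
Proof. by rewrite ipC ipNl rmorphN/= -ipC. Qed.

Lemma ipBl f g h : p (f - g) h = p f h - p g h.
Proof. by rewrite ipDl ipNl. Qed.

Lemma ipBr f g h : p h (f - g) = p h f - p h g.
Proof. by rewrite ipDr ipNr. Qed.

Lemma ip0l h : p 0 h = 0.
Proof. by rewrite -(scale0r (0 : H)) ipZl mul0r. Qed.

Lemma ip0r h : p h 0 = 0.
Proof. by rewrite ipC ip0l conjC0. Qed.

Lemma hnorm_ge0 f : 0 <= N f.
Proof. exact: sqrtr_ge0. Qed.

Lemma hnorm_sqr f : N f ^+ 2 = Re (p f f).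
Proof. by rewrite sqr_sqrtr// ip_ge0. Qed.

Lemma ip_self f : p f f = (N f ^+ 2)%:C.
Proof.
apply: complex_ext; first by rewrite hnorm_sqr.
have := congr1 (@complex.Im R) (ipC p f f); rewrite ImJ => /eqP.
by rewrite -addr_eq0 -mulr2n mulrn_eq0 => /eqP ->.
Qed.

Lemma hnorm_eq0 f : N f = 0 -> f = 0.
Proof. by move=> f0; apply: (@ip_eq0 _ _ p); rewrite ip_self f0 expr0n. Qed.

Lemma ip_extl f g : (forall h, p f h = p g h) -> f = g.
Proof.
move=> fg; apply/eqP; rewrite -subr_eq0; apply/eqP/(@ip_eq0 _ _ p).
by rewrite ipBl fg subrr.
Qed.

Lemma ip_extr f g : (forall h, p h f = p h g) -> f = g.
Proof. by move=> fg; apply: ip_extl => h; rewrite ipC fg -ipC. Qed.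

Lemma hnormZ (a : R[i]) f : N (a *: f) = normc a * N f.
Proof.
apply/eqP; rewrite -(@eqrXn2 _ 2)// ?mulr_ge0 ?hnorm_ge0 ?normc_ge0//.
rewrite hnorm_sqr ipZl ipZr mulrA mulcJ ip_self exprMn.
by rewrite ReM/= mul0r subr0.
Qed.

Lemma hnormN f : N (- f) = N f.
Proof.
rewrite -scaleN1r hnormZ.
by rewrite (_ : normc _ = 1) ?mul1r//= oppr0 expr0n addr0 sqrrN expr1n sqrtr1.
Qed.

Lemma hnormB f g : N (f - g) = N (g - f).
Proof. by rewrite -hnormN opprB. Qed.

Lemma hnorm0 : N ((0 : H)) = 0.
Proof. by apply/eqP; rewrite -sqrf_eq0 hnorm_sqr ip0l. Qed.

Lemma cauchy_schwarz f g : normc (p f g) <= N f * N g.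
Proof.
have [g0|g0] := eqVneq (N g) 0.
  by rewrite (hnorm_eq0 g0) ip0r Normc.normc0 hnorm0 mulr0.
have gpos : 0 < N g ^+ 2 by rewrite exprn_gt0// lt0r g0 hnorm_ge0.
rewrite -ler_sqr ?nnegrE ?mulr_ge0 ?hnorm_ge0 ?normc_ge0//.
set c := p f g; set G := N g ^+ 2.
(* The squared distance from f to its projection on the line of g; expanded, it is |f|^2 - |c|^2 /
   G. *)
have : 0 <= Re (p (f - (c / G%:C) *: g) (f - (c / G%:C) *: g)).
  by rewrite -hnorm_sqr sqr_ge0.
rewrite !ipBl !ipBr !ipZl !ipZr (ipC p f g) -/c !ip_self -/G.
rewrite exprMn -/G normc2E.
move: (N f ^+ 2) => F; move: c => [a b].
rewrite (_ : (a +i* b) / G%:C = (a / G) +i* (b / G)); last first.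
  by apply: complex_ext => /=; field; exact: lt0r_neq0.
move=> /= h.
have {h} : 0 <= F - (a ^+ 2 + b ^+ 2) / G.
  apply: le_trans h _; rewrite le_eqVlt; apply/orP; left; apply/eqP.
  by field; exact: lt0r_neq0.
by rewrite subr_ge0 ler_pdivrMr.
Qed.

Lemma hnormD f g : N (f + g) <= N f + N g.
Proof.
rewrite -ler_sqr ?nnegrE ?addr_ge0 ?hnorm_ge0// hnorm_sqr.
rewrite ipDl !ipDr (ipC p f g) !ReD ReJ -!hnorm_sqr.
have := le_trans (ler_norm _) (le_trans (Re_le_normc _) (cauchy_schwarz f g)).
by rewrite sqrrD; lra.
Qed.

Lemma hnorm_dist3 g f h : N (f - h) <= N (f - g) + N (g - h).
Proof. by rewrite -{1}(subrK g f) -addrA hnormD. Qed.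

Lemma parallelogram f g :
  N (f + g) ^+ 2 + N (f - g) ^+ 2 = 2 * N f ^+ 2 + 2 * N g ^+ 2.
Proof.
rewrite !hnorm_sqr !ipDl !ipDr !ipNl !ipNr !(ReD, ReN).
by ring.
Qed.

(** With the coefficient t <r, g>, t real, the squared distance is a real quadratic polynomial in t.
    Its first-order term forces <r, g> = 0 when r is of minimal norm. *)
Lemma hnorm_subZ r g (t : R) : N (r - (t%:C * p r g) *: g) ^+ 2 =
  N r ^+ 2 - 2 * t * normc (p r g) ^+ 2 + t ^+ 2 * normc (p r g) ^+ 2 * N g ^+ 2.
Proof.
rewrite hnorm_sqr !ipBl !ipBr !ipZl !ipZr (ipC p r g) !ip_self normc2E.
move: (p r g) => [a b]; rewrite -!conjcE /=.
by ring.
Qed.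

End inner_product_theory.

(** * Orthogonal projection on a closed subspace *)

Section projection.
Context {R : realType} {H : lmodType R[i]} (p : inner_product H).
Hypothesis pC : hcomplete p.
Variable S : set H.
Hypotheses (S0 : S 0) (SL : forall a f g, S f -> S g -> S (a *: f + g)).
Hypothesis Scl : hclosed p S.
Local Notation N := (hnorm p).

(* A sequence in S minimizing the distance to h is Cauchy by the parallelogram
   law, and the difference to its limit is orthogonal to S. *)
Lemma projection h : exists2 s, S s & forall g, S g -> p (h - s) g = 0.
Proof.
pose D := [set N (h - s) ^+ 2 | s in S].
pose m := inf D.
have Dlb : lbound D 0 by move=> _ [s _ <-]; exact: sqr_ge0.
have Dinf : has_inf D by split; [exists (N (h - 0) ^+ 2), 0|exists 0].
have mle s : S s -> m <= N (h - s) ^+ 2.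
  by move=> Ss; apply: ge_inf; [exists 0|exists s].
have m0 : 0 <= m by apply: lb_le_inf => //; exact: Dinf.1.
(* Since midpoints stay in S, the gap 4^-(n+1) bounds the squared increments by 2 (4^-(n+1) +
   4^-(n+2)) = 5/8 * 4^-n, within the rate that [hcomplete] demands. *)
have exs n : exists2 s, S s & N (h - s) ^+ 2 < m + 4 ^- n.+1.
  have e0 : 0 < (4 : R) ^- n.+1 by rewrite invr_gt0 exprn_gt0.
  have [_ [s Ss <-] sm] := inf_adherent e0 Dinf.
  by exists s.
have /choice[s sP] : forall n, exists s, S s /\ N (h - s) ^+ 2 < m + 4 ^- n.+1.
  by move=> n; have [s] := exs n; exists s.
have sS n : S (s n) := (sP n).1.
have SZ a f : S f -> S (a *: f) by move=> Sf; rewrite -[_ *: _]addr0; exact: SL.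
have SD f g : S f -> S g -> S (f + g).
  by move=> Sf Sg; rewrite -[f]scale1r; exact: SL.
have scauchy n : N (s n.+1 - s n) <= 2 ^- n.
  rewrite -ler_sqr ?nnegrE ?hnorm_ge0 ?invr_ge0 ?exprn_ge0//.
  have := parallelogram p (h - s n) (h - s n.+1).
  have -> : h - s n - (h - s n.+1) = s n.+1 - s n.
    by rewrite opprB addrC addrA subrK.
  have -> : h - s n + (h - s n.+1) = 2 *: (h - 2^-1 *: (s n + s n.+1)).
    rewrite scalerBr scalerA divff ?pnatr_eq0// scale1r scaler_nat mulr2n.
    by rewrite addrACA opprD.
  rewrite hnormZ (_ : normc 2 = 2); last first.
    rewrite -(rmorph_nat (real_complex R)) /= expr0n addr0 sqrtr_sqr.
    by rewrite ger0_norm.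
  have := mle _ (SZ 2^-1 _ (SD _ _ (sS n) (sS n.+1))).
  have := (sP n).2; have := (sP n.+1).2.
  have -> : (2 ^- n : R) ^+ 2 = 4 ^- n by rewrite -exprVn -exprM mulnC exprM -exprVn expr2 -invfM -natrM.
  rewrite exprMn !exprS !invfM.
  have : 0 <= (4 : R) ^- n by rewrite invr_ge0 exprn_ge0.
  by move: (4 ^- n) => t; rewrite (_ : (2 : R) * (2 * 1) = 4); lra.
have [t tP] := pC scauchy.
have St : S t.
  apply: Scl => e e0.
  have [n] := exp2V_small (divr_gt0 e0 (ltr0n R 2)).
  rewrite ltr_pdivlMr// mulrC => ne.
  exists (s n) => //; rewrite hnormB; exact: le_lt_trans (tP n) ne.
exists t => // g Sg.
have tm : N (h - t) ^+ 2 <= m.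
  apply/ler_addgt0Pr => e e0.
  (* With q = 2^-n <= 1 and A the distance from h to s n, one has A^2 <= m + q^2 and A <= m + 2, so
     (A + 2 q)^2 <= m + q (4 m + 13). *)
  have C0 : 0 < 4 * m + 13 by lra.
  have [n ne] := exp2V_small (divr_gt0 e0 C0).
  have XAB := hnorm_dist3 p (s n) h t.
  have Bq := tP n; have Am := (sP n).2.
  have q4q : (4 : R) ^- n.+1 <= (2 ^- n) ^+ 2.
    have -> : (2 ^- n : R) ^+ 2 = 4 ^- n by rewrite -exprVn -exprM mulnC exprM -exprVn expr2 -invfM -natrM.
    by rewrite exprS invfM ger_pMl ?invr_gt0 ?exprn_gt0//; lra.
  have q1 : (2 : R) ^- n <= 1 by rewrite invf_le1 ?exprn_gt0// exprn_ege1// ler1n.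
  have q0 : 0 < (2 : R) ^- n by rewrite invr_gt0 exprn_gt0.
  move: ne; rewrite ltr_pdivlMr// => ne.
  have X0 := hnorm_ge0 p (h - t); have A0 := hnorm_ge0 p (h - s n).
  have B0 := hnorm_ge0 p (s n - t).
  have AA : N (h - s n) <= m + 2 by nra.
  have : N (h - t) ^+ 2 <= (N (h - s n) + 2 * 2 ^- n) ^+ 2.
    by rewrite ler_sqr ?nnegrE; lra.
  by nra.
have orth (tau : R) : N (h - t) ^+ 2 <=
    N (h - t - (tau%:C * p (h - t) g) *: g) ^+ 2.
  apply: (le_trans tm); rewrite -addrA -opprD; apply: mle; apply: SD => //.
  exact: SZ.
(* The minimizing parameter 1 / |g|^2 would be undefined for g = 0. With the added 1, minimality
   becomes - c (|g|^2 + 2) >= 0 for c = |<h - t, g>|^2, whence c = 0. *)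
have := orth (1 / (N g ^+ 2 + 1)).
rewrite hnorm_subZ.
move=> le; apply: Normc.eq0_normc; apply/eqP; rewrite -sqrf_eq0; apply/eqP.
have := sqr_ge0 (normc (p (h - t) g)); have := sqr_ge0 (N g); move: le.
move: (N (h - t) ^+ 2) (N g ^+ 2) (normc (p (h - t) g) ^+ 2) => r G c.
have [->//|c0] := eqVneq c 0.
move=> le G0 c0'; have cp : 0 < c by rewrite lt0r c0.
have G1 : 0 < G + 1 by lra.
have : (G + 1) ^+ 2 * r <= (G + 1) ^+ 2 * r - 2 * (G + 1) * c + c * G.
  rewrite -subr_ge0 [X in 0 <= X](_ : _ = (G + 1) ^+ 2 *
    (r - 2 * (1 / (G + 1)) * c + (1 / (G + 1)) ^+ 2 * c * G - r)).
    by rewrite mulr_ge0 ?sqr_ge0 ?subr_ge0.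
  by field; exact: lt0r_neq0.
by nra.
Qed.

(** The difference between h and its projection on S is orthogonal to the family, hence 0. In use, S
    is the set of vectors with a given property, which then has to be checked on the family only. *)
Lemma hclosed_setT (I : Type) (e : I -> H) : htotal p e -> (forall i, S (e i)) ->
  forall h, S h.
Proof.
move=> etot Se h; have [s Ss hs] := projection h.
suff : h - s = 0 by move/eqP; rewrite subr_eq0 => /eqP ->.
by apply: etot => i; exact: hs.
Qed.

End projection.

(** * Uniqueness and extension of operators given on a total family *)

Section bounded_maps.
Context {R : realType} {H1 H2 : lmodType R[i]}.
Variables (p1 : inner_product H1) (p2 : inner_product H2).

Definition hbounded (A : H1 -> H2) :=
  linear A /\ exists C : R, forall f, hnorm p2 (A f) <= C * hnorm p1 f.

Definition hisometry (A : H1 -> H2) :=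
  linear A /\ forall f g, p2 (A f) (A g) = p1 f g.

Lemma linearB_of (A : H1 -> H2) : linear A -> forall f g, A (f - g) = A f - A g.
Proof.
move=> Al f g; have := Al (-1) g f.
by rewrite !scaleN1r ![- _ + _]addrC.
Qed.

Lemma linear0_of (A : H1 -> H2) : linear A -> A 0 = 0.
Proof. by move=> /linearB_of/(_ 0 0); rewrite !subrr. Qed.

Lemma hisometry_norm A : hisometry A -> forall f, hnorm p2 (A f) = hnorm p1 f.
Proof. by move=> [_ Ai] f; rewrite /hnorm Ai. Qed.

Lemma hisometry_bounded A : hisometry A -> hbounded A.
Proof.
move=> Ai; split; first exact: Ai.1.
by exists 1 => f; rewrite mul1r (hisometry_norm Ai).
Qed.

Hypothesis p1C : hcomplete p1.

(** The set where A and B agree is a closed subspace. This is the uniqueness by which [fourier] and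
    [tensor_operator] are evaluated. *)
Lemma hbounded_eq (I : Type) (e : I -> H1) (A B : H1 -> H2) : htotal p1 e ->
  hbounded A -> hbounded B -> (forall i, A (e i) = B (e i)) -> A = B.
Proof.
move=> etot [Al [C AC]] [Bl [D BD]] ABe; apply/funext => f.
apply: (@hclosed_setT _ _ p1 p1C [set f | A f = B f] _ _ _ I e) => //=.
- by rewrite (linear0_of Al) (linear0_of Bl).
- by move=> a g h gE hE; rewrite Al Bl gE hE.
move=> g gS; apply/eqP; rewrite -subr_eq0; apply/eqP/(@hnorm_eq0 _ _ p2).
apply: (@eq0_of_small _ _ (`|C| + `|D|)); rewrite ?hnorm_ge0 ?addr_ge0//.
move=> eps eps0; have [h hS gh] := gS _ eps0.
have -> : A g - B g = A (g - h) - B (g - h).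
  by rewrite (linearB_of Al) (linearB_of Bl) hS opprB addrA subrK.
apply: (le_trans (hnormD _ _ _)); rewrite hnormN.
apply: (le_trans (lerD (AC _) (BD _))).
rewrite -mulrDl mulrC; apply: (@le_trans _ _ (hnorm p1 (g - h) * (`|C| + `|D|))).
  by rewrite ler_wpM2l ?hnorm_ge0// lerD ?ler_norm.
by rewrite ler_wpM2r ?addr_ge0// ltW.
Qed.

Hypothesis p2C : hcomplete p2.

(* The graph of the isometry is the smallest closed subspace of the product
   containing all pairs (e i, e' i). *)
Lemma isometry_extension (I : Type) (e : I -> H1) (e' : I -> H2) :
  htotal p1 e -> (forall i j, p1 (e i) (e j) = p2 (e' i) (e' j)) ->
  exists2 A : H1 -> H2, hisometry A & forall i, A (e i) = e' i.
Proof.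
move=> etot gram.
pose pairK (K : H1 -> H2 -> Prop) := [/\ K 0 0,
  forall a f f' g g', K f f' -> K g g' -> K (a *: f + g) (a *: f' + g'),
  forall f f', (forall eps, 0 < eps -> exists g g',
    [/\ K g g', hnorm p1 (f - g) < eps & hnorm p2 (f' - g') < eps]) -> K f f' &
  forall i, K (e i) (e' i)].
pose Rel f f' := forall K, pairK K -> K f f'.
have RelK : pairK Rel.
  split.
  - by move=> K [].
  - move=> a f f' g g' ff' gg' K Kp; have [_ KL _ _] := Kp.
    by apply: KL; [exact: ff'|exact: gg'].
  - move=> f f' H K Kp; have [_ _ Kc _] := Kp; apply: Kc => eps /H[g [g' [gg' ? ?]]].
    by exists g, g'; split => //; exact: gg'.
  - by move=> i K [].
(* For fixed h and h', the pairs (g, g') with <g, h> = <g', h'> form a closed linear relation.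
   Instantiating [Rel] at it twice, first for a generating pair (h, h') and then for an arbitrary
   related one, shows that [Rel] preserves inner products. *)
have orthK h h' : (forall i, p1 (e i) h = p2 (e' i) h') ->
    pairK (fun g g' => p1 g h = p2 g' h').
  move=> ehe; split => //.
  - by rewrite !ip0l.
  - by move=> a f f' g g' ff' gg'; rewrite !ipDl !ipZl ff' gg'.
  move=> f f' H; apply/eqP; rewrite -subr_eq0; apply/eqP/Normc.eq0_normc.
  apply: (@eq0_of_small _ _ (hnorm p1 h + hnorm p2 h')).
  - exact: normc_ge0.
  - by rewrite addr_ge0 ?hnorm_ge0.
  move=> eps eps0; have [g [g' [gg' fg fg']]] := H _ eps0.
  have -> : p1 f h - p2 f' h' = p1 (f - g) h - p2 (f' - g') h'.
    by rewrite !ipBl gg' opprB addrA subrK.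
  apply: (le_trans (le_normcD _ _)); rewrite normcN mulrDr lerD//.
    by rewrite (le_trans (cauchy_schwarz _ _ _))// ler_wpM2r ?hnorm_ge0// ltW.
  by rewrite (le_trans (cauchy_schwarz _ _ _))// ler_wpM2r ?hnorm_ge0// ltW.
have Rel_e i f f' : Rel f f' -> p1 f (e i) = p2 f' (e' i).
  by move=> ff'; exact: (ff' _ (orthK (e i) (e' i) (fun j => gram j i))).
have Rel_ip f f' g g' : Rel f f' -> Rel g g' -> p1 g f = p2 g' f'.
  move=> ff' gg'; apply: (gg' _ (orthK f f' _)) => i.
  by rewrite ipC (Rel_e _ _ _ ff') -ipC.
have [Rel0 RelL Relc Rele] := RelK.
have RelB f f' g g' : Rel f f' -> Rel g g' -> Rel (f - g) (f' - g').
  move=> ff' gg'; have := RelL (-1) _ _ _ _ gg' ff'.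
  by rewrite !scaleN1r ![- _ + _]addrC.
have Rel_norm f f' : Rel f f' -> hnorm p2 f' = hnorm p1 f.
  by move=> ff'; rewrite /hnorm (Rel_ip _ _ _ _ ff' ff').
have dom f : exists f', Rel f f'.
  apply: (@hclosed_setT _ _ p1 p1C [set f | exists f', Rel f f'] _ _ _ I e) => //=.
  - by exists 0.
  - move=> a g h [g' gg'] [h' hh']; exists (a *: g' + h'); exact: RelL.
  - move=> g gS.
    (* Approximations within 2^-(n+1) have consecutive distances at most 2^-n. Since [Rel] preserves
       norms, their images form a Cauchy sequence of the rate accepted by [p2C]. *)
    have e0 n : 0 < (2 : R) ^- n.+1 by rewrite invr_gt0 exprn_gt0.
    have /choice[u uP] : forall n, exists hh : H1 * H2,
        Rel hh.1 hh.2 /\ hnorm p1 (g - hh.1) < 2 ^- n.+1.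
      by move=> n; have [h [h' hh'] gh] := gS _ (e0 n); exists (h, h').
    have [|g' g'P] := p2C (u := fun n => (u n).2).
      move=> n; rewrite (Rel_norm _ _ (RelB _ _ _ _ (uP n.+1).1 (uP n).1)).
      rewrite (le_trans (hnorm_dist3 p1 g _ _))// hnormB.
      have := (uP n).2; have := (uP n.+1).2; rewrite !exprS !invfM.
      have : 0 < (2 : R) ^- n by rewrite invr_gt0 exprn_gt0.
      move: (2 ^- n : R) => q; lra.
    exists g'; apply: Relc => eps eps0.
    have [n ne] := exp2V_small (divr_gt0 eps0 (ltr0n R 2)).
    exists (u n).1, (u n).2; split; first exact: (uP n).1.
      apply: lt_trans (uP n).2 _; rewrite exprS invfM.
      have : 0 < (2 : R) ^- n by rewrite invr_gt0 exprn_gt0.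
      move: ne; rewrite ltr_pdivlMr//; move: (2 ^- n : R) => q; lra.
    rewrite hnormB; apply: le_lt_trans (g'P n) _.
    by move: ne; rewrite ltr_pdivlMr// mulrC.
  - by move=> i; exists (e' i).
have /choice[A AP] := dom.
have Reluniq f f' f'' : Rel f f' -> Rel f f'' -> f' = f''.
  move=> ff' ff''; apply/eqP; rewrite -subr_eq0; apply/eqP/(@hnorm_eq0 _ _ p2).
  by rewrite (Rel_norm _ _ (RelB _ _ _ _ ff' ff'')) subrr; exact: hnorm0.
exists A; last by move=> i; exact: Reluniq (AP _) (Rele i).
split; first by move=> a f g; exact: Reluniq (AP _) (RelL _ _ _ _ _ (AP f) (AP g)).
by move=> f g; rewrite (Rel_ip _ _ _ _ (AP g) (AP f)).
Qed.

End bounded_maps.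

#[local] Opaque toL2 L2_add L2_scale L2_opp L2_zero.

(** * The Hilbert space L2 *)

Section L2_inner.
Context d (T : measurableType d) (R : realType) (mu : {measure set T -> \bar R}).
Implicit Types f g h : L2 mu.

Lemma L2_cmeasurable f : cmeasurable f.
Proof. by have [] := L2_sqint f. Qed.

Lemma inner_cintegrable f g : cintegrable mu (fun x => f x * (g x)^*).
Proof. by apply: sqint_cintegrableJ; exact: L2_sqint. Qed.

Lemma inner_ae f g (f' g' : T -> R[i]) : cmeasurable f' -> cmeasurable g' ->
  {ae mu, forall x, f x = f' x} -> {ae mu, forall x, g x = g' x} ->
  inner f g = cintegral mu (fun x => f' x * (g' x)^*).
Proof.
move=> mf' mg' ff' gg'; apply: ae_eq_cintegral.
- by apply: cmeasurableM; [|apply: cmeasurableJ]; exact: L2_cmeasurable.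
- by apply: cmeasurableM => //; exact: cmeasurableJ.
- by apply: filterS2 ff' gg' => x -> ->.
Qed.

Lemma inner_toL2 (f g : T -> R[i]) : sqint mu f -> sqint mu g ->
  inner (toL2 mu f) (toL2 mu g) = cintegral mu (fun x => f x * (g x)^*).
Proof.
move=> sf sg; apply: inner_ae; [exact: sf.1|exact: sg.1|exact: toL2_ae..].
Qed.

Lemma inner_toL2r f (g : T -> R[i]) : sqint mu g ->
  inner f (toL2 mu g) = cintegral mu (fun x => f x * (g x)^*).
Proof.
move=> sg; apply: inner_ae; [exact: L2_cmeasurable|exact: sg.1|exact: aeW|].
exact: toL2_ae.
Qed.

Lemma innerDl f g h : inner (f + g) h = inner f h + inner g h.
Proof.
rewrite -cintegralD; [|exact: inner_cintegrable..].
rewrite -(eq_cintegral mu (fun x => mulrDl (f x) (g x) (h x)^*)).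
apply: (@inner_ae _ _ _ h).
- by apply: cmeasurableD; exact: L2_cmeasurable.
- exact: L2_cmeasurable.
- exact: L2_add_ae.
- exact: aeW.
Qed.

Lemma innerZl (a : R[i]) f h : inner (a *: f) h = a * inner f h.
Proof.
rewrite -cintegralZ; last exact: inner_cintegrable.
rewrite (eq_cintegral mu (fun x => mulrA a (f x) (h x)^*)).
apply: (@inner_ae _ _ _ h).
- by apply: cmeasurableZ; exact: L2_cmeasurable.
- exact: L2_cmeasurable.
- exact: L2_scale_ae.
- exact: aeW.
Qed.

Lemma innerC f g : inner g f = (inner f g)^*.
Proof.
rewrite -cintegralJ; last exact: inner_cintegrable.
by apply: eq_cintegral => x; rewrite rmorphM/= conjCK mulrC.
Qed.

Lemma L2norm_sqrE f : (L2norm f ^+ 2)%:E = (\int[mu]_x (normc (f x) ^+ 2)%:E)%E.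
Proof.
have i0 : (0 <= \int[mu]_x (normc (f x) ^+ 2)%:E)%E.
  by apply: integral_ge0 => x _; rewrite lee_fin sqr_ge0.
rewrite sqr_sqrtr; last by apply: Rintegral_ge0 => // x _; exact: sqr_ge0.
by rewrite fineK// ge0_fin_numE//; have [] := L2_sqint f.
Qed.

Lemma inner_self f : inner f f = (L2norm f ^+ 2)%:C.
Proof.
apply: complex_ext => /=.
  rewrite sqr_sqrtr; last by apply: Rintegral_ge0 => // x _; exact: sqr_ge0.
  by apply: eq_Rintegral => x _; rewrite mulcJ.
under eq_Rintegral do rewrite mulcJ/=.
by rewrite /Rintegral integral0.
Qed.

Lemma inner_ge0 f : 0 <= Re (inner f f).
Proof. by rewrite inner_self sqr_ge0. Qed.

Lemma inner_eq0 f : inner f f = 0 -> f = 0.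
Proof.
rewrite inner_self => -[] /eqP; rewrite sqrf_eq0 => /eqP f0; apply/L2_eqP.
have mf := measurable_normc2 (L2_cmeasurable f).
have : (\int[mu]_x `|(normc (f x) ^+ 2)%:E| = 0)%E.
  under eq_integral do rewrite gee0_abs ?lee_fin ?sqr_ge0//.
  by rewrite -L2norm_sqrE f0 expr0n.
move/(ae_eq_integral_abs _ measurableT mf).
apply: filterS2 (L2_zero_ae mu) => x x0 /(_ I)/= [] fx0.
rewrite [RHS]x0; apply: Normc.eq0_normc; apply/eqP.
by rewrite -sqrf_eq0; apply/eqP.
Qed.

Definition L2ip : inner_product (L2 mu) :=
  InnerProduct innerDl innerZl innerC inner_ge0 inner_eq0.

Lemma hnorm_L2 f : hnorm L2ip f = L2norm f.
Proof.
rewrite /hnorm (_ : L2ip f f = (L2norm f ^+ 2)%:C); last exact: inner_self.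
by rewrite /= sqrtr_sqr ger0_norm// sqrtr_ge0.
Qed.

(** Because [toL2] falls back on 0 outside L2, the point is that g inherits square-integrability
    from f; it need not be known in advance. *)
Lemma ae_eq_toL2 f (g : T -> R[i]) : cmeasurable g ->
  {ae mu, forall x, g x = f x} -> toL2 mu g = f.
Proof.
move=> mg gf; apply/L2_eqP.
have sg : sqint mu g.
  by apply: ae_eq_sqint mg _ (L2_sqint f); apply: filterS gf => x ->.
by apply: filterS2 (toL2_ae sg) gf => x -> ->.
Qed.

Lemma ae_L2_sub f g : {ae mu, forall x, (f - g : L2 mu) x = f x - g x}.
Proof.
have -> : f - g = f + (-1) *: g by rewrite scaleN1r.
apply: filterS2 (L2_add_ae f (-1 *: g)) (L2_scale_ae (-1) g) => x h1 h2.
by rewrite [LHS]h1 [X in _ + X]h2 mulN1r.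
Qed.

Lemma L2norm_subE f g :
  (L2norm (f - g) ^+ 2)%:E = (\int[mu]_x (normc (f x - g x) ^+ 2)%:E)%E.
Proof.
rewrite L2norm_sqrE; apply: ae_eq_integral => //.
- exact/measurable_normc2/L2_cmeasurable.
- apply: measurable_normc2.
  under eq_fun do rewrite -mulN1r.
  by apply: cmeasurableD; [|apply: cmeasurableZ]; exact: L2_cmeasurable.
- by apply: filterS (ae_L2_sub f g) => x h _; rewrite h.
Qed.

End L2_inner.

(** * Completeness of L2 (Riesz-Fischer) *)

Section riesz_fischer.
Context d (T : measurableType d) (R : realType) (mu : {measure set T -> \bar R}).

Lemma summable_increments_cvg (v : R ^nat) (b : R) :
  (forall n, \sum_(0 <= k < n) `|v k.+1 - v k| <= b) -> cvgn v.
Proof.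
move=> vb.
have : cvgn (series (telescope v)).
  apply: normed_cvg; apply: nondecreasing_is_cvgn.
    apply: nondecreasing_series => k _ _; exact: normr_ge0.
  by exists b => _ [n _ <-]; exact: vb.
move=> h; rewrite (_ : v = (fun n => v 0%N + series (telescope v) n)).
  by apply: is_cvgD => //; exact: is_cvg_cst.
by apply/funext => n; rewrite -eq_sum_telescope.
Qed.

Lemma sum_half_le n : \sum_(0 <= k < n) (2 : R) ^- k <= 2.
Proof.
have -> : \sum_(0 <= k < n) (2 : R) ^- k = 2 - 2 * 2 ^- n.
  elim: n => [|n IH]; first by rewrite big_geq// expr0; lra.
  by rewrite big_nat_recr//= IH exprS invfM; lra.
by rewrite lerBlDr lerDl mulr_ge0// invr_ge0 exprn_ge0.
Qed.

(* t <= s + t^2 / s turns summability of 2^k |u_{k+1} - u_k|^2 into that of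
   |u_{k+1} - u_k|. *)
Lemma le_add_sqr (s t : R) : 0 < s -> t <= s + s^-1 * t ^+ 2.
Proof.
move=> s0; rewrite -subr_ge0.
rewrite (_ : _ - _ = s^-1 * (s ^+ 2 - s * t + t ^+ 2)); last first.
  by field; exact: lt0r_neq0.
by rewrite mulr_ge0 ?invr_ge0 ?(ltW s0)//; nra.
Qed.

Lemma L2_cauchy_cvg (u : nat -> L2 mu) :
  (forall n, L2norm (u n.+1 - u n) <= 2 ^- n) ->
  exists f : L2 mu, forall n, L2norm (u n - f) <= 2 * 2 ^- n.
Proof.
move=> du.
pose a n x : R := normc (u n.+1 x - u n x).
have mu_ n : cmeasurable (u n) by exact: L2_cmeasurable.
have ma n : measurable_fun setT (fun x => (2 ^+ n * a n x ^+ 2)%:E).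
  apply/measurable_EFinP; apply: measurable_funM => //; apply/measurable_EFinP.
  by apply: measurable_normc2; exact: cmeasurableB.
have ma0 n x : (0 <= (2 ^+ n * a n x ^+ 2)%:E)%E.
  by rewrite lee_fin mulr_ge0 ?sqr_ge0 ?exprn_ge0.
(* The squared increments have integrals at most 4^-n. The weight 2^n leaves the summable bound
   2^-n, so M is integrable, and it is the weight that [le_add_sqr] needs for s = 2^-n. *)
pose M x : \bar R := (\sum_(0 <= n <oo) (2 ^+ n * a n x ^+ 2)%:E)%E.
have mM : measurable_fun setT M.
  by apply: ge0_emeasurable_sum => // k x _ _; exact: ma0.
have M0 x : (0 <= M x)%E by apply: nneseries_ge0 => k _ _; exact: ma0.
have intM : (\int[mu]_x M x <= 2%:E)%E.
  rewrite integral_nneseries//.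
  apply: lime_le.
    by apply: is_cvg_nneseries => k _ _; apply: integral_ge0 => x _; exact: ma0.
  apply: nearW => n.
  apply: (@le_trans _ _ (\sum_(0 <= k < n) (2 ^- k)%:E)%E); last first.
    by rewrite sumEFin lee_fin sum_half_le.
  apply: lee_sum => k _.
  under eq_integral do rewrite EFinM.
  rewrite ge0_integralZl//; last 2 first.
  - by apply: measurable_normc2; exact: cmeasurableB.
  - by move=> x _; rewrite lee_fin sqr_ge0.
  rewrite -L2norm_subE -EFinM lee_fin.
  apply: (@le_trans _ _ (2 ^+ k * (2 ^- k) ^+ 2)).
    by rewrite ler_wpM2l ?exprn_ge0// ler_sqr ?nnegrE ?invr_ge0 ?exprn_ge0 ?sqrtr_ge0.
  by rewrite expr2 mulrA divff ?mul1r// expf_neq0.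
have aeM : {ae mu, forall x, (M x < +oo)%E}.
  have : mu.-integrable setT M.
    apply/integrableP; split => //.
    under eq_integral do rewrite gee0_abs//.
    by rewrite (le_lt_trans intM)// ltry.
  by move/(integrable_ae measurableT); apply: filterS => x /(_ I); rewrite ge0_fin_numE.
(* Resetting the sequence to 0 where M is infinite makes it converge at every point, so that the
   pointwise limit is measurable. *)
pose v n x := if (M x < +oo)%E then u n x else 0.
have mE : measurable_fun setT (fun x => (M x < +oo)%E).
  by apply: (measurable_fun_bool true); exact: measurable_lte.
have mv n : cmeasurable (v n).
  by apply: cmeasurable_if => //; exact: cmeasurable_cst.
have aev n : {ae mu, forall x, v n x = u n x}.
  by apply: filterS aeM => x; rewrite /v => ->.
have cv (pr : R[i] -> R) x : (forall z w, pr (z - w) = pr z - pr w) ->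
    (forall z, `|pr z| <= normc z) -> cvgn (fun n => pr (v n x)).
  move=> prB prle; have [Mx|Mx] := boolP (M x < +oo)%E; last first.
    rewrite (_ : (fun _ => _) = cst (pr 0)); first exact: is_cvg_cst.
    by apply/funext => n; rewrite /v (negbTE Mx).
  rewrite (_ : (fun _ => _) = (fun n => pr (u n x))); last first.
    by apply/funext => n; rewrite /v Mx.
  apply: (@summable_increments_cvg _ (2 + fine (M x))) => n.
  apply: (@le_trans _ _ (\sum_(0 <= k < n) (2 ^- k + 2 ^+ k * a k x ^+ 2))).
    apply: ler_sum => k _; rewrite -prB (le_trans (prle _))//.
    rewrite -[X in _ + X * _]invrK; apply: le_add_sqr.
    by rewrite invr_gt0 exprn_gt0.
  rewrite big_split/= lerD ?sum_half_le// -lee_fin fineK ?ge0_fin_numE//.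
  rewrite -sumEFin; apply: nneseries_lim_ge => k _ _; exact: ma0.
have ReB (z w : R[i]) : Re (z - w) = Re z - Re w by rewrite ReD ReN.
have ImB (z w : R[i]) : Im (z - w) = Im z - Im w by rewrite ImD ImN.
have cRe x := cv _ x ReB (@Re_le_normc R).
have cIm x := cv _ x ImB (@Im_le_normc R).
pose f x := limn (fun n => Re (v n x)) +i* limn (fun n => Im (v n x)).
have mf : cmeasurable f.
  split.
    by apply: (@measurable_fun_cvg _ _ _ _ (fun n x => Re (v n x))) => [n|x _];
      [have [] := mv n|exact: cRe].
  by apply: (@measurable_fun_cvg _ _ _ _ (fun n x => Im (v n x))) => [n|x _];
    [have [] := mv n|exact: cIm].
have dist n m : (n <= m)%N -> L2norm (u n - u m) <= 2 * 2 ^- n.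
  move=> nm; have -> : u n - u m = - \sum_(n <= k < m) (u k.+1 - u k).
    by rewrite telescope_sumr// opprB.
  rewrite -hnorm_L2 hnormN.
  have -> : 2 * 2 ^- n = \sum_(n <= k < m) 2 ^- k + 2 * 2 ^- m :> R.
    elim: m nm => [|m IH]; first by rewrite leqn0 => /eqP ->; rewrite big_geq// add0r.
    rewrite leq_eqVlt => /predU1P[->|]; first by rewrite big_geq// add0r.
    rewrite ltnS => nm; rewrite big_nat_recr//= IH// exprS invfM; lra.
  apply: (@le_trans _ _ (\sum_(n <= k < m) 2 ^- k)); last first.
    by rewrite lerDl mulr_ge0// invr_ge0 exprn_ge0.
  elim: m nm => [|m IH] nm; first by rewrite !big_geq// hnorm0.
  move: nm; rewrite leq_eqVlt => /predU1P[->|]; first by rewrite !big_geq// hnorm0.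
  rewrite ltnS => nm; rewrite !big_nat_recr//= (le_trans (hnormD _ _ _))//.
  by rewrite lerD ?IH// hnorm_L2 du.
(* Fatou's lemma in m: the distance from the n-th term to the limit inherits the bound on its
   distances to later terms. *)
have key n : (\int[mu]_x (normc (v n x - f x) ^+ 2)%:E <= ((2 * 2 ^- n) ^+ 2)%:E)%E.
  have cvx x : ((normc (v n x - v m x) ^+ 2)%:E @[m --> \oo] -->
      (normc (v n x - f x) ^+ 2)%:E)%E.
    have hR : Re (v n x) - Re (v m x) @[m --> \oo] --> Re (v n x) - Re (f x).
      by apply: cvgB; [exact: cvg_cst|exact: cRe].
    have hI : Im (v n x) - Im (v m x) @[m --> \oo] --> Im (v n x) - Im (f x).
      by apply: cvgB; [exact: cvg_cst|exact: cIm].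
    have h := cvgD (cvgM hR hR) (cvgM hI hI).
    apply: cvg_EFin; first exact: nearW.
    rewrite normc2E ReB ImB !expr2.
    rewrite (_ : fine \o _ = (fun m =>
      (Re (v n x) - Re (v m x)) * (Re (v n x) - Re (v m x)) +
      (Im (v n x) - Im (v m x)) * (Im (v n x) - Im (v m x)))); first exact: h.
    by apply/funext => m /=; rewrite normc2E ReB ImB !expr2.
  have -> : (\int[mu]_x (normc (v n x - f x) ^+ 2)%:E =
      \int[mu]_x limn_einf (fun m => (normc (v n x - v m x) ^+ 2)%:E))%E.
    by apply: eq_integral => x _; rewrite (cvg_limn_einf_sup (cvx x)).1.
  apply: le_trans (fatou _ _ _ _) _ => //.
  - by move=> m; apply: measurable_normc2; exact: cmeasurableB.
  - by move=> m x _; rewrite lee_fin sqr_ge0.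
  rewrite limn_einf_lim; apply: lime_le; first exact: is_cvg_einfs.
  apply: nearW => m; apply: ereal_inf_le.
  (* The index must be at least m to lie in the tail, and at least n for [dist] to apply. *)
  exists ((\int[mu]_x (normc (v n x - v (maxn n m) x) ^+ 2)%:E))%E.
    by exists (maxn n m) => //=; exact: leq_maxr.
  rewrite (_ : integral _ _ _ = (L2norm (u n - u (maxn n m)) ^+ 2)%:E).
    rewrite lee_fin ler_sqr ?nnegrE ?sqrtr_ge0 ?mulr_ge0 ?invr_ge0 ?exprn_ge0//.
    by apply: dist; exact: leq_maxl.
  rewrite L2norm_subE; apply: ae_eq_integral => //.
  - by apply: measurable_normc2; exact: cmeasurableB.
  - by apply: measurable_normc2; exact: cmeasurableB.
  - by apply: filterS2 (aev n) (aev (maxn n m)) => x -> ->.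
have sf : sqint mu f.
  have -> : f = (fun x => v 0%N x - (v 0%N x - f x)).
    by apply/funext => x; rewrite opprB addrC subrK.
  have sv : sqint mu (v 0%N).
    apply: (ae_eq_sqint _ _ (L2_sqint (u 0%N))) => //.
    by apply: filterS (aev 0%N) => x ->.
  have sd : sqint mu (fun x => v 0%N x - f x).
    by split; [exact: cmeasurableB|rewrite (le_lt_trans (key 0%N))// ltry].
  under eq_fun do rewrite -[X in _ + X]mulN1r.
  by apply: sqintD => //; exact: sqintZ.
exists (toL2 mu f) => n.
rewrite -ler_sqr ?nnegrE ?sqrtr_ge0 ?mulr_ge0 ?invr_ge0 ?exprn_ge0//.
rewrite -lee_fin; apply: le_trans (key n).
rewrite L2norm_subE le_eqVlt; apply/orP; left; apply/eqP; apply: ae_eq_integral => //.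
- by apply: measurable_normc2; apply: cmeasurableB => //; exact: L2_cmeasurable.
- by apply: measurable_normc2; exact: cmeasurableB.
- by apply: filterS2 (aev n) (toL2_ae sf) => x -> ->.
Qed.

Lemma L2_complete : hcomplete (L2ip mu).
Proof.
move=> u du; have [|f fP] := @L2_cauchy_cvg u.
  by move=> n; rewrite -hnorm_L2; exact: du.
by exists f => n; rewrite hnorm_L2.
Qed.

End riesz_fischer.

(** * Identification of functions by their integrals *)

Section density.
Context d (T : measurableType d) (R : realType).
Variables (nu mu : {measure set T -> \bar R}) (w : T -> R).
Hypotheses (mw : measurable_fun setT w) (w0 : forall x, 0 <= w x).
Hypothesis nuE : forall A, measurable A -> nu A = (\int[mu]_(x in A) (w x)%:E)%E.
Local Open Scope ereal_scope.

Import HBNNSimple.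

Let density_nnsfun (f : {nnsfun T >-> R}) :
  \int[nu]_x (f x)%:E = \int[mu]_x ((f x)%:E * (w x)%:E).
Proof.
under [LHS]eq_integral do rewrite fimfunE -fsumEFin//.
rewrite [LHS]ge0_integral_fsum//; last 2 first.
- by move=> r; exact/measurable_EFinP/measurableT_comp.
- by move=> n x _; rewrite EFinM nnfun_muleindic_ge0.
under [RHS]eq_integral.
  move=> x xD; rewrite fimfunE -fsumEFin// ge0_mule_fsuml; last first.
    by move=> r; rewrite EFinM nnfun_muleindic_ge0.
  over.
rewrite [RHS]ge0_integral_fsum//; last 2 first.
- move=> r; apply: emeasurable_funM; last exact/measurable_EFinP.
  by apply/measurable_EFinP; exact: measurableT_comp.
- by move=> n x _; rewrite mule_ge0 ?lee_fin// -lee_fin EFinM nnfun_muleindic_ge0.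
apply: eq_fsbigr => r _.
rewrite integralZl_indic_nnsfun//= integral_indic//= setIT nuE//.
have [r0|r0] := ltP r 0%R.
  by rewrite preimage_nnfun0//= integral_set0 mule0 integral0_eq// => x _;
    rewrite indicE in_set0 mulr0 mul0e.
under [RHS]eq_integral do rewrite EFinM -muleA.
rewrite ge0_integralZl//; last 2 first.
- by apply: emeasurable_funM => //; exact/measurable_EFinP.
- by move=> x _; rewrite mule_ge0// lee_fin.
congr *%E; rewrite integral_mkcond; apply: eq_integral => x _.
by rewrite epatch_indic/= muleC.
Qed.

(** Approximation by simple functions extends [nuE] from sets to integrands. It serves to turn
    integrals against u^-2 du into Lebesgue integrals. *)
Lemma ge0_integral_density (f : T -> \bar R) : measurable_fun setT f ->
  (forall x, 0 <= f x) -> \int[nu]_x f x = \int[mu]_x (f x * (w x)%:E).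
Proof.
move=> mf f0.
pose f_ := nnsfun_approx measurableT mf.
have cf x : (f_ n x)%:E @[n --> \oo] --> f x.
  by apply: cvg_nnsfun_approx.
transitivity (lim (\int[nu]_x (f_ n x)%:E @[n --> \oo])).
  rewrite -monotone_convergence//=.
  - by apply: eq_integral => x _; apply/esym/cvg_lim.
  - by move=> n; exact/measurable_EFinP/measurable_funTS.
  - by move=> n ? _; rewrite lee_fin.
  - by move=> ? _ ? ? mn; rewrite lee_fin; exact/lefP/nd_nnsfun_approx.
rewrite (_ : (fun n => _) = (fun n => \int[mu]_x ((f_ n x)%:E * (w x)%:E))); last first.
  by apply/funext => n; exact: density_nnsfun.
rewrite -monotone_convergence//=.
- apply: eq_integral => x _; apply/cvg_lim => //.
  by apply: cvgeZr => //; exact: cf.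
- move=> n; apply: emeasurable_funM => //; last exact/measurable_EFinP.
  by apply/measurable_EFinP/measurable_funTS.
- by move=> n x _; rewrite mule_ge0// lee_fin.
- move=> x _ m n mn; rewrite lee_wpmul2r ?lee_fin//.
  exact/lefP/nd_nnsfun_approx.
Qed.

End density.

Section identification.
Context d (T : measurableType d) (R : realType) (mu : {measure set T -> \bar R}).

(* The measures with densities h^+ and h^- agree on the pi-system G. *)
Lemma ae_eq0_pisystem (h : T -> R) (G : set (set T)) (g : (set T)^nat) :
  measurable = <<s G >> -> setI_closed G -> (forall n, G (g n)) ->
  \bigcup_n g n = setT -> measurable_fun setT h ->
  (forall A, G A -> mu.-integrable A (EFin \o h)) ->
  (forall A, G A -> (\int[mu]_(x in A) (h x)%:E = 0)%E) ->
  {ae mu, forall x, h x = 0}.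
Proof.
move=> mG GI Gg gT mh hi h0.
have GM A : G A -> measurable A by move=> GA; rewrite mG; exact: sub_sigma_algebra.
pose m (f : T -> \bar R) A := (\int[mu]_(x in A) f x)%E.
have mea (f : T -> \bar R) : measurable_fun setT f -> (forall x, 0 <= f x)%E ->
    exists M : {measure set T -> \bar R}, forall A, M A = m f A.
  move=> mf f0.
  have m_0 : m f set0 = 0%E by exact: integral_set0.
  have m_ge0 A : (0 <= m f A)%E by apply: integral_ge0.
  have m_add : semi_sigma_additive (m f) by exact: semi_sigma_additive_nng_induced.
  pose mx := isMeasure.Build _ _ _ (m f) m_0 m_ge0 m_add.
  by pose M : {measure set T -> \bar R} := HB.pack (m f) mx; exists M.
have mhE : measurable_fun setT (EFin \o h) by exact/measurable_EFinP.
have [M1 M1E] := mea _ (measurable_funepos mhE) (funepos_ge0 _).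
have [M2 M2E] := mea _ (measurable_funeneg mhE) (funeneg_ge0 _).
have GMeq A : G A -> M1 A = M2 A.
  move=> GA; rewrite M1E M2E; have h0A : (\int[mu]_(x in A) (EFin \o h) x = 0)%E := h0 A GA.
  have pfin := integrable_pos_fin_num (GM _ GA) (hi _ GA).
  have nfin := integrable_neg_fin_num (GM _ GA) (hi _ GA).
  have := integralE mu A (EFin \o h); rewrite h0A => /esym/eqP.
  by rewrite sube_eq// ?fin_num_adde_defl// add0e => /eqP.
have fin n : (M1 (g n) < +oo)%E.
  rewrite M1E; have := integrable_pos_fin_num (GM _ (Gg n)) (hi _ (Gg n)).
  by rewrite fin_numE ltey => /andP[].
(* The agreement now holds on all measurable sets; on those inside some g n, where both values are
   finite, it says that h has integral 0. *)
have Meq := measure_unique _ _ mG GI Gg gT _ _ GMeq fin.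
have : {ae mu, forall x, forall n, g n x -> h x = 0}.
  apply: ae_foralln => n.
  have := @integral_ae_eq _ _ _ mu (g n) (GM _ (Gg n)) (cst 0%E) (EFin \o h)
    (hi _ (Gg n)) (measurable_cst _).
  have H E : E `<=` g n -> measurable E ->
      (\int[mu]_(x in E) (EFin \o h) x = \int[mu]_(x in E) cst 0%E x)%E.
    move=> Egn mE; rewrite integral_cst// mul0e integralE.
    have := Meq E mE; rewrite M1E M2E /m => <-; rewrite subee//.
    apply: integrable_pos_fin_num => //.
    exact: integrableS (GM _ (Gg n)) mE Egn (hi _ (Gg n)).
  by move/(_ H); apply: filterS => x /= hx gnx; have [] := hx gnx.
apply: filterS => x hx.
have : (\bigcup_n g n) x by rewrite gT.
by move=> [n _ /hx].
Qed.

End identification.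

Definition cindic (T : Type) (R : realType) (A : set T) (x : T) : R[i] := (\1_A x)%:C.

Section complex_identification.
Context d (T : measurableType d) (R : realType) (mu : {measure set T -> \bar R}).
Implicit Types (f g : T -> R[i]) (A B : set T).

Lemma cmeasurable_cindic A : measurable A -> cmeasurable (cindic R A).
Proof. by move=> mA; apply: cmeasurable_real; exact: measurable_indic. Qed.

Lemma normc_cindic A x : normc (cindic R A x) = \1_A x.
Proof.
by rewrite /cindic /= expr0n addr0 sqrtr_sqr ger0_norm// indicE; case: (_ \in _).
Qed.

Lemma cindic_conj A x : (cindic R A x)^* = cindic R A x.
Proof. exact: conjc_real. Qed.

Lemma indic_sqr A (x : T) : \1_A x ^+ 2 = \1_A x :> R.
Proof. by rewrite indicE; case: (_ \in _); rewrite ?expr1n ?expr0n. Qed.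

Lemma sqint_cindic A : measurable A -> (mu A < +oo)%E -> sqint mu (cindic R A).
Proof.
move=> mA Afin; split; first exact: cmeasurable_cindic.
under eq_integral do rewrite normc_cindic indic_sqr.
by rewrite integral_indic// setIT.
Qed.

Lemma cintegrable_cindic A : measurable A -> (mu A < +oo)%E ->
  cintegrable mu (cindic R A).
Proof.
move=> mA Afin; apply: cintegrableP; first exact: cmeasurable_cindic.
under eq_integral do rewrite normc_cindic.
by rewrite integral_indic// setIT.
Qed.

Let cindicM_Re A f : (fun x => (Re (cindic R A x * f x))%:E) =
  ((EFin \o (fun x => Re (f x))) \_ A).
Proof.
by apply/funext => x; rewrite epatch_indic/= ReM/= mul0r subr0 EFinM muleC.
Qed.

Let cindicM_Im A f : (fun x => (Im (cindic R A x * f x))%:E) =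
  ((EFin \o (fun x => Im (f x))) \_ A).
Proof.
by apply/funext => x; rewrite epatch_indic/= ImM/= mul0r addr0 EFinM muleC.
Qed.

Lemma cae_eq0_pisystem f (G : set (set T)) (g : (set T)^nat) :
  measurable = <<s G >> -> setI_closed G -> (forall n, G (g n)) ->
  \bigcup_n g n = setT -> cmeasurable f ->
  (forall A, G A -> cintegrable mu (fun x => cindic R A x * f x)) ->
  (forall A, G A -> cintegral mu (fun x => cindic R A x * f x) = 0) ->
  {ae mu, forall x, f x = 0}.
Proof.
move=> mG GI Gg gT [mf1 mf2] fi f0.
have GM A : G A -> measurable A by move=> GA; rewrite mG; exact: sub_sigma_algebra.
have f1 : {ae mu, forall x, Re (f x) = 0}.
  apply: (ae_eq0_pisystem mG GI Gg gT mf1) => A GA.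
    by have [+ _] := fi A GA; rewrite cindicM_Re => /(integrable_mkcond _ (GM _ GA)).
  have [+ _] := fi A GA => i1.
  have := congr1 (@complex.Re R) (f0 A GA); rewrite /= /Rintegral.
  have := integrable_fin_num measurableT i1.
  by rewrite cindicM_Re -integral_mkcond => ? /eqP; rewrite fine_eq0// => /eqP.
have f2 : {ae mu, forall x, Im (f x) = 0}.
  apply: (ae_eq0_pisystem mG GI Gg gT mf2) => A GA.
    by have [_ +] := fi A GA; rewrite cindicM_Im => /(integrable_mkcond _ (GM _ GA)).
  have [_ +] := fi A GA => i1.
  have := congr1 (@complex.Im R) (f0 A GA); rewrite /= /Rintegral.
  have := integrable_fin_num measurableT i1.
  by rewrite cindicM_Im -integral_mkcond => ? /eqP; rewrite fine_eq0// => /eqP.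
by apply: filterS2 f1 f2 => x r0 i0; apply: complex_ext.
Qed.

End complex_identification.

Section product_identification.
Context d1 d2 (T1 : measurableType d1) (T2 : measurableType d2) (R : realType).
Variables (mu : {sigma_finite_measure set T1 -> \bar R}).
Variables (nu : {sigma_finite_measure set T2 -> \bar R}).

Lemma cindicX (A : set T1) (B : set T2) z :
  cindic R (A `*` B) z = cindic R A z.1 * cindic R B z.2.
Proof. by rewrite /cindic -rmorphM/= !indicE in_setX; case: (_ \in _); rewrite ?mul1r ?mul0r. Qed.

Lemma cae_eq0_rectangles (f : T1 * T2 -> R[i]) : cmeasurable f ->
  (forall A B, measurable A -> measurable B -> (mu A < +oo)%E -> (nu B < +oo)%E ->
    cintegrable (mu \x nu)%E (fun z => cindic R (A `*` B) z * f z) /\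
    cintegral (mu \x nu)%E (fun z => cindic R (A `*` B) z * f z) = 0) ->
  {ae (mu \x nu)%E, forall z, f z = 0}.
Proof.
move=> mf H.
have [F FT Ffin] := sigma_finiteT mu; have [E ET Efin] := sigma_finiteT nu.
have mF n := (Ffin n).1; have mE n := (Efin n).1.
(* After a cut-off by F n x E m, every measurable rectangle is an admissible test. The pi-system of
   all measurable rectangles contains the whole space, so a constant exhausting sequence
   suffices. *)
have nm n m : {ae (mu \x nu)%E, forall z, cindic R (F n `*` E m) z * f z = 0}.
  have Hi A B : measurable A -> measurable B ->
      cintegrable (mu \x nu)%E (fun z => cindic R (A `*` B) z * (cindic R (F n `*` E m) z * f z)) /\
      cintegral (mu \x nu)%E (fun z => cindic R (A `*` B) z * (cindic R (F n `*` E m) z * f z)) = 0.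
    move=> mA mB.
    have -> : (fun z => cindic R (A `*` B) z * (cindic R (F n `*` E m) z * f z)) =
        (fun z => cindic R ((A `&` F n) `*` (B `&` E m)) z * f z).
      apply/funext => z; rewrite mulrA; congr (_ * _); rewrite /cindic -rmorphM/=.
      by rewrite !indicE !in_setX !in_setI -!natrM !mulnb andbACA.
    apply: H; [exact: measurableI|exact: measurableI|..].
      apply: le_lt_trans (Ffin n).2; apply: le_measure; rewrite ?inE//.
      exact: measurableI.
    apply: le_lt_trans (Efin m).2; apply: le_measure; rewrite ?inE//.
    exact: measurableI.
  apply: (@cae_eq0_pisystem _ _ _ _ _ [set A `*` B | A in measurable & B in measurable]
    (fun=> setT)).
  - exact: measurable_prod_measurableType.
  - move=> _ _ [A mA [B mB <-]] [A' mA' [B' mB' <-]].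
    rewrite -setXI; exists (A `&` A'); first exact: measurableI.
    by exists (B `&` B') => //; exact: measurableI.
  - by move=> _; exists setT => //; exists setT => //; rewrite setXTT.
  - by rewrite bigcup_const//; exists 0%N.
  - by apply: cmeasurableM => //; apply: cmeasurable_cindic; exact: measurableX.
  - by move=> _ [A mA [B mB <-]]; exact: (Hi A B mA mB).1.
  - by move=> _ [A mA [B mB <-]]; exact: (Hi A B mA mB).2.
have : {ae (mu \x nu)%E, forall z, forall n m, cindic R (F n `*` E m) z * f z = 0}.
  by apply: ae_foralln => n; apply: ae_foralln => m; exact: nm.
apply: filterS => z Hz.
have [n _ Fn] : (\bigcup_i F i) z.1 by rewrite -FT.
have [m _ Em] : (\bigcup_i E i) z.2 by rewrite -ET.
have := Hz n m; rewrite /cindic indicE mem_set ?mul1r//.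
Qed.

End product_identification.

(** * Affine changes of variable and the Dirichlet integral *)

Section lebesgue_affine.
Context {R : realType}.
Local Notation leb := (@lebesgue_measure R).
Local Open Scope ereal_scope.
Implicit Types f : R -> \bar R.

Lemma measurable_affine (a b : R) : measurable_fun setT (fun x : R => a * x + b)%R.
Proof. by apply: measurable_funD => //; exact: measurable_funM. Qed.

Lemma ge0_integral_opp f : measurable_fun setT f -> (forall x, 0 <= f x) ->
  \int[leb]_x f (- x)%R = \int[leb]_x f x.
Proof.
move=> mf f0.
have mN : measurable_fun setT (-%R : R -> measurableTypeR R) by [].
have := @ge0_integral_pushforward _ _ (measurableTypeR R) (measurableTypeR R) R _ mN leb setT f measurableT mf
  (fun x _ => f0 x).
rewrite preimage_setT => <-; apply: eq_measure_integral => A mA _.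
exact: lebesgue_measureN.
Qed.

Let ge0_integral_affine_pos f (a b : R) : (0 < a)%R -> measurable_fun setT f ->
  (forall x, 0 <= f x) ->
  \int[leb]_x f (a * x + b)%R = (a^-1)%:E * \int[leb]_x f x.
Proof.
move=> a0 mf f0.
have mp : measurable_fun setT ((fun x => a * x + b)%R : R -> measurableTypeR R).
  exact: measurable_affine.
have := @ge0_integral_pushforward _ _ (measurableTypeR R) (measurableTypeR R) R _ mp leb setT f measurableT mf
  (fun x _ => f0 x).
rewrite preimage_setT => <-.
have aV0 : (0 <= a^-1)%R by rewrite invr_ge0 ltW.
rewrite -(@ge0_integral_mscale _ _ _ leb _ measurableT (NngNum aV0))//.
apply: eq_measure_integral => A mA _.
(* The image of Lebesgue measure under x -> a x + b, multiplied by a, agrees with Lebesgue measure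
   on half-open intervals, hence on all measurable sets. *)
pose M : {measure set (measurableTypeR R) -> \bar R} :=
  mscale (NngNum (ltW a0))
    (measure_function_pushforward__canonical__measure_function_Measure leb mp).
have ME X : ocitv X -> leb X = M X.
  move=> [[c d]] _ <- /=; rewrite /M /mscale /=.
  have -> : pushforward leb ((fun x => a * x + b)%R : R -> measurableTypeR R) `]c, d] =
      leb `]((c - b) / a)%R, ((d - b) / a)%R].
    congr (leb _); apply/seteqP; split => x /=; rewrite !in_itv/=.
      by rewrite ltr_pdivrMr// ler_pdivlMr// mulrC ltrBlDr lerBrDr.
    by rewrite ltr_pdivrMr// ler_pdivlMr// mulrC ltrBlDr lerBrDr.
  rewrite !lebesgue_measure_itv/= !lte_fin ltr_pM2r ?invr_gt0// ltrD2r.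
  case: ifPn => _; last by rewrite mule0.
  by rewrite -!EFinB -EFinM; congr EFin; field; exact: lt0r_neq0.
have lebA : leb A = M A := lebesgue_measure_unique ME mA.
transitivity ((a^-1)%:E * M A); last by rewrite -lebA.
by rewrite /M /= /mscale /= muleA -EFinM mulVf ?mul1e// lt0r_neq0.
Qed.

Lemma ge0_integral_affine f (a b : R) : a != 0%R -> measurable_fun setT f ->
  (forall x, 0 <= f x) ->
  \int[leb]_x f (a * x + b)%R = (`|a|^-1)%:E * \int[leb]_x f x.
Proof.
move=> a0 mf f0; have [ap|an] := ltP 0%R a.
  by rewrite ger0_norm ?(ltW ap)//; exact: ge0_integral_affine_pos.
have na : (0 < - a)%R by rewrite oppr_gt0 lt_neqAle a0.
rewrite ler0_norm// -(@ge0_integral_affine_pos f (- a) b)// -[RHS]ge0_integral_opp.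
- by apply: eq_integral => x _; rewrite mulrNN.
- apply: (measurableT_comp mf); exact: measurable_affine.
- by move=> x.
Qed.

End lebesgue_affine.

Section complex_affine.
Context {R : realType}.
Local Notation leb := (@lebesgue_measure R).
Implicit Types f : R -> R[i].

Lemma cmeasurable_affine f (a b : R) : cmeasurable f ->
  cmeasurable (fun x : R => f (a * x + b)).
Proof. by move=> mf; apply: cmeasurable_comp mf; exact: measurable_affine. Qed.

Let Rintegral_affine (h : R -> R) (a b : R) : a != 0 -> measurable_fun setT h ->
  leb.-integrable setT (EFin \o h) ->
  \int[leb]_x h (a * x + b) = `|a|^-1 * \int[leb]_x h x.
Proof.
move=> a0 mh hi.
have mhE : measurable_fun setT (EFin \o h) by exact/measurable_EFinP.
rewrite /Rintegral.
have pfin := integrable_pos_fin_num measurableT hi.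
have nfin := integrable_neg_fin_num measurableT hi.
rewrite (_ : integral leb setT (fun x => (h (a * x + b))%:E) =
  (`|a|^-1)%:E * \int[leb]_x (h x)%:E)%E.
  by rewrite fineM//; exact: integrable_fin_num.
have fE : (\int[leb]_x (h x)%:E = \int[leb]_x (EFin \o h)^\+ x -
   \int[leb]_x (EFin \o h)^\- x)%E by rewrite -integralE.
rewrite fE muleBr//; last by rewrite fin_num_adde_defl// fin_numN.
rewrite -(@ge0_integral_affine _ (EFin \o h)^\+%E a b)// -?(@ge0_integral_affine _ (EFin \o h)^\-%E a b)//.
- rewrite integralE; congr (_ - _)%E; apply: eq_integral => x _.
    by rewrite !funeposE.
  by rewrite !funenegE.
- exact: measurable_funeneg.
- exact: measurable_funepos.
Qed.

Lemma cintegrable_affine f (a b : R) : a != 0 -> cintegrable leb f ->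
  cintegrable leb (fun x => f (a * x + b)).
Proof.
move=> a0 fi; have mf := cintegrable_measurable fi.
apply: cintegrableP; first exact: cmeasurable_affine.
rewrite (@ge0_integral_affine _ (fun x => (normc (f x))%:E))//.
- by rewrite lte_mul_pinfty ?lee_fin ?invr_ge0//; exact: cintegrable_lt.
- by apply/measurable_EFinP; exact: measurable_normc.
- by move=> x; rewrite lee_fin normc_ge0.
Qed.

Lemma cintegral_affine f (a b : R) : a != 0 -> cintegrable leb f ->
  cintegral leb (fun x => f (a * x + b)) = (`|a|^-1)%:C * cintegral leb f.
Proof.
move=> a0 fi; have [mf1 mf2] := cintegrable_measurable fi; have [f1 f2] := fi.
apply: complex_ext; rewrite ?ReM ?ImM /= mul0r ?subr0 ?addr0.
  exact: (Rintegral_affine _ a0 mf1 f1).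
exact: (Rintegral_affine _ a0 mf2 f2).
Qed.

Lemma sqint_affine f (a b : R) : a != 0 -> sqint leb f ->
  sqint leb (fun x => f (a * x + b)).
Proof.
move=> a0 [mf fi]; split; first exact: cmeasurable_affine.
rewrite (@ge0_integral_affine _ (fun x => (normc (f x) ^+ 2)%:E))//.
- by rewrite lte_mul_pinfty ?lee_fin ?invr_ge0.
- exact: measurable_normc2.
- by move=> x; rewrite lee_fin sqr_ge0.
Qed.

End complex_affine.

Section dirichlet.
Context {R : realType}.
Local Notation leb := (@lebesgue_measure R).

Lemma cvg_expRM (t : R) : 0 < t -> expR (- (t * x)) @[x --> +oo] --> (0 : R).
Proof.
move=> t0; apply: (@cvg_comp _ _ _ (fun x => t * x) (fun y => expR (- y)) _ (pinfty_nbhs R)).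
  exact: gt0_cvgMry.
exact: cvgr_expR.
Qed.

Lemma cvg_bounded_expR (t M : R) (h : R -> R) : 0 < t ->
  (forall x, 0 <= x -> `|h x| <= M) ->
  h x * expR (- (t * x)) @[x --> +oo] --> (0 : R).
Proof.
move=> t0 hM.
apply: (@squeeze_cvgr _ _ _ _ (fun x => - (M * expR (- (t * x)))) (fun x => M * expR (- (t * x)))).
- near=> x; have x0 : 0 <= x by near: x; exact: nbhs_pinfty_ge.
  have := hM x x0.
  rewrite ler_norml => /andP[h1 h2].
  by rewrite -mulNr !ler_wpM2r ?expR_ge0.
- rewrite -[X in _ --> X]oppr0 -[X in _ --> - X](mulr0 M).
  by apply: cvgN; apply: cvgMr; exact: cvg_expRM.
- by rewrite -[X in _ --> X](mulr0 M); apply: cvgMr; exact: cvg_expRM.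
Unshelve. all: by end_near. Qed.

(** The Laplace transform of 1 - cos, which is the x-integral in the double integral behind
    [integral_dirichlet]. *)
Lemma integral_cos_laplace (t : R) : 0 < t ->
  (\int[leb]_(x in `[0%R, +oo[) ((1 - cos x) * expR (- (t * x)))%:E =
   ((t * (1 + t ^+ 2))^-1)%:E)%E.
Proof.
move=> t0.
(* Against exp(-t x), the term -1/t integrates the constant 1 and (t cos x - sin x) / (1 + t^2)
   integrates -cos x. *)
pose F (x : R) : R := (- t^-1 + (t * cos x - sin x) / (1 + t ^+ 2)) * expR (- (t * x)).
have t2 : 1 + t ^+ 2 != 0 by rewrite gt_eqF// ltr_wpDr ?sqr_ge0.
have dF (x : R) : is_derive x 1 F ((1 - cos x) * expR (- (t * x))).
  rewrite /F; apply: is_derive_eq.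
  rewrite /GRing.scale/=; field.
  by rewrite t2 gt_eqF.
have cF x : {for x, continuous F} by apply/differentiable_continuous/derivable1_diffP; apply: ex_derive.
have cf : continuous (fun x => (1 - cos x) * expR (- (t * x))).
  move=> x; apply: cvgM; first by apply: cvgB; [exact: cvg_cst|exact: continuous_cos].
  apply: continuous_comp; last exact: continuous_expR.
  by apply: cvgN; apply: cvgMr; exact: cvg_id.
rewrite (@ge0_continuous_FTC2y _ _ F 0 0).
- congr EFin; rewrite /F mulr0 oppr0 expR0 cos0 sin0; field.
  by rewrite t2 gt_eqF.
- by move=> x _; rewrite mulr_ge0 ?expR_ge0// subr_ge0 cos_le1.
- exact: continuous_subspaceT.
- rewrite /F; apply: (@cvg_bounded_expR _ (t^-1 + (t + 1) / (1 + t ^+ 2))) => // x _.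
  rewrite (le_trans (ler_normD _ _))// lerD//.
    by rewrite normrN ger0_norm// invr_ge0 ltW.
  rewrite normrM [X in _ * X <= _]ger0_norm ?invr_ge0 ?addr_ge0 ?sqr_ge0//.
  rewrite ler_wpM2r ?invr_ge0 ?addr_ge0 ?sqr_ge0// (le_trans (ler_normB _ _))// lerD//.
    by rewrite normrM ger0_norm ?(ltW t0)// ler_piMr ?(ltW t0)// cos_max.
  exact: sin_max.
- by move=> x _; apply: ex_derive.
- by apply: cvg_at_right_filter; exact: cF.
- by move=> x _; rewrite derive1E; exact: derive_val.
Qed.

(** Writes x^-2 as a superposition of exponentials, which opens (1 - cos x) / x^2 to Tonelli. *)
Lemma integral_gamma2 (x : R) : 0 < x ->
  (\int[leb]_(t in `[0%R, +oo[) (t * expR (- (x * t)))%:E = (x ^- 2)%:E)%E.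
Proof.
move=> x0.
pose F (t : R) : R := - (t / x + x ^- 2) * expR (- (x * t)).
have dF (t : R) : is_derive t 1 F (t * expR (- (x * t))).
  rewrite /F; apply: is_derive_eq.
  by rewrite /GRing.scale/=; field; rewrite gt_eqF.
have cF t : {for t, continuous F}.
  by apply/differentiable_continuous/derivable1_diffP; apply: ex_derive.
have cf : continuous (fun t : R => t * expR (- (x * t))).
  move=> t; apply: cvgM; first exact: cvg_id.
  apply: continuous_comp; last exact: continuous_expR.
  by apply: cvgN; apply: cvgMr; exact: cvg_id.
rewrite (@ge0_continuous_FTC2y _ _ F 0 0).
- by congr EFin; rewrite /F mulr0 oppr0 expR0; field; rewrite gt_eqF.
- by move=> t t0; rewrite mulr_ge0 ?expR_ge0.
- exact: continuous_subspaceT.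
(* Half of the exponential absorbs the polynomial factor: with y = x t / 2 that factor is x^-2 (1 +
   2 y), and 1 + y <= exp y gives 1 + 2 y <= 3 exp y. *)
- have -> : F = (fun t => (- (t / x + x ^- 2) * expR (- (x / 2 * t))) * expR (- (x / 2 * t))).
    by apply/funext => t; rewrite /F -mulrA -expRD; congr (_ * expR _); field.
  have x2 : 0 < x / 2 by rewrite divr_gt0.
  apply: (@cvg_bounded_expR _ (3 * x ^- 2)) => // t t0.
  rewrite mulNr normrN ger0_norm; last first.
    by rewrite mulr_ge0 ?expR_ge0// addr_ge0 ?divr_ge0 ?(ltW x0)// invr_ge0 sqr_ge0.
  have := expR_ge1Dx (x / 2 * t).
  have E0 := expR_gt0 (x / 2 * t).
  rewrite expRN ler_pdivrMr//.
  have xt : 0 <= x / 2 * t by rewrite mulr_ge0// ltW.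
  move=> e1; rewrite (_ : t / x + _ = x ^- 2 * (1 + 2 * (x / 2 * t))); last first.
    by field; rewrite gt_eqF.
  rewrite (_ : 3 * x ^- 2 * _ = x ^- 2 * (3 * expR (x / 2 * t))); last by ring.
  by rewrite ler_wpM2l ?invr_ge0 ?sqr_ge0//; lra.
- by move=> t _; apply: ex_derive.
- by apply: cvg_at_right_filter; exact: cF.
- by move=> t _; rewrite derive1E; exact: derive_val.
Qed.

Local Notation mR := (measurableTypeR R).

Lemma measurable_fst_R : measurable_fun setT (fun z : mR * mR => z.1 : R).
Proof. exact: (@measurable_fst _ _ mR mR). Qed.

Lemma measurable_snd_R : measurable_fun setT (fun z : mR * mR => z.2 : R).
Proof. exact: (@measurable_snd _ _ mR mR). Qed.

(* Integrate (1 - cos x) t e^(-tx) over the quadrant in both orders. *)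
Lemma integral_dirichlet :
  (\int[leb]_(x in `[0%R, +oo[) ((1 - cos x) / x ^+ 2)%:E = (pi / 2)%:E)%E.
Proof.
(* A is closed as in the statement; B is open because [integral_cos_laplace] requires t > 0. *)
pose A : set R := `[0%R, +oo[%classic; pose B : set R := `]0%R, +oo[%classic.
pose g (x t : R) : R := (1 - cos x) * (t * expR (- (t * x))).
pose k (z : mR * mR) : \bar R := (\1_A z.1 * \1_B z.2 * g z.1 z.2)%:E.
have mA : measurable A by exact: measurable_itv.
have mB : measurable B by exact: measurable_itv.
have m1 := measurable_fst_R; have m2 := measurable_snd_R.
have mcomp (h : R -> R) (p : mR * mR -> R) : measurable_fun setT h ->
    measurable_fun setT p -> measurable_fun setT (fun z => h (p z)).
  by move=> mh mp; exact: measurableT_comp.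
have mk : measurable_fun setT k.
  apply/measurable_EFinP; apply: measurable_funM.
    by apply: measurable_funM; apply: (mcomp) => //; exact: measurable_indic.
  apply: measurable_funM.
    apply: measurable_funB => //; apply: (mcomp) => //.
    exact: (continuous_measurable_fun (@continuous_cos R)).
  apply: measurable_funM => //; apply: (mcomp); first exact: measurable_expR.
  by apply: (mcomp -%R) => //; exact: measurable_funM.
have g0 x t : B t -> 0 <= g x t.
  rewrite /B/= in_itv/= andbT => t0.
  by rewrite /g !mulr_ge0 ?expR_ge0 ?(ltW t0)// subr_ge0 cos_le1.
have k0 z : (0 <= k z)%E.
  rewrite lee_fin; have [/(g0 z.1) gz|Bz] := pselect (B z.2).
    by rewrite mulr_ge0// mulr_ge0// indicE.
  by rewrite (_ : \1_B z.2 = 0) ?mulr0 ?mul0r// indicE memNset.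
have me (s : R) : measurable_fun setT (fun x : R => expR (- (s * x))).
  apply: continuous_measurable_fun => x.
  apply: continuous_comp; last exact: continuous_expR.
  by apply: cvgN; apply: cvgMr; exact: cvg_id.
have mt (s : R) : measurable_fun setT (fun t : R => t * expR (- (s * t))).
  by apply: measurable_funM; [exact: measurable_id|exact: me].
have mc : measurable_fun setT (fun x : R => 1 - cos x).
  by apply: measurable_funB => //; exact: (continuous_measurable_fun (@continuous_cos R)).
have := @fubini_tonelli _ _ mR mR R leb leb k mk k0.
have -> : (\int[leb]_x fubini_F leb k x =
    \int[leb]_(x in `[0%R, +oo[) ((1 - cos x) / x ^+ 2)%:E)%E.
  rewrite [RHS]integral_mkcond; apply: eq_integral => x _.
  rewrite epatch_indic /fubini_F /k /=.
  rewrite -/A; have [xA|xA] := pselect (A x); last first.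
    rewrite [\1_A x]indicE memNset//= mule0 integral0_eq// => t _.
    by rewrite !mul0r.
  rewrite [\1_A x]indicE mem_set//= mule1.
  under eq_integral do rewrite mul1r EFinM muleC.
  transitivity (\int[leb]_(t in B) (g x t)%:E)%E.
    by rewrite [RHS]integral_mkcond; apply: eq_integral => t _; rewrite epatch_indic.
  (* At x = 0 the integral of t exp(-x t) diverges, but its factor 1 - cos x vanishes, and so does
     the right-hand side. *)
  have [x0|x0] := eqVneq x 0.
    rewrite x0 cos0 subrr mul0r integral0_eq// => t _.
    by rewrite /g cos0 subrr mul0r.
  have xp : 0 < x by move: xA; rewrite /A/= in_itv/= andbT lt_neqAle eq_sym x0.
  rewrite /g /B integral_itv_obnd_cbnd; last first.
    apply/measurable_EFinP/measurable_funTS.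
    apply: measurable_funM => //.
    by rewrite (_ : (fun t => _) = (fun t => t * expR (- (x * t))))//;
      apply/funext => t; rewrite [t * x]mulrC.
  under eq_integral do rewrite EFinM [_ * x]mulrC.
  rewrite ge0_integralZl.
  - by rewrite integral_gamma2// -EFinM.
  - exact: measurable_itv.
  - by apply/measurable_EFinP/measurable_funTS; exact: mt.
  - by move=> t; rewrite /= in_itv/= andbT => t0; rewrite lee_fin mulr_ge0 ?expR_ge0.
  - by rewrite lee_fin subr_ge0 cos_le1.
have -> : (\int[leb]_t fubini_G leb k t =
    \int[leb]_(t in `[0%R, +oo[) (oneDsqr t)^-1%:E)%E.
  rewrite -[RHS]integral_itv_obnd_cbnd; last first.
    apply/measurable_EFinP/measurable_funTS.
    exact: (continuous_measurable_fun (@continuous_oneDsqrV R)).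
  rewrite [RHS]integral_mkcond; apply: eq_integral => t _.
  rewrite epatch_indic /fubini_G /k /=.
  rewrite -/B; have [tB|tB] := pselect (B t); last first.
    rewrite [\1_B t]indicE memNset//= mule0 integral0_eq// => x _.
    by rewrite mulr0 mul0r.
  rewrite [\1_B t]indicE mem_set//= mule1.
  under eq_integral do rewrite mulr1 EFinM muleC.
  transitivity (\int[leb]_(x in A) (g x t)%:E)%E.
    by rewrite [RHS]integral_mkcond; apply: eq_integral => x _; rewrite epatch_indic.
  have tp : 0 < t by move: tB; rewrite /B/= in_itv/= andbT.
  rewrite /g /A.
  under eq_integral do rewrite mulrCA EFinM.
  rewrite ge0_integralZl.
  - rewrite integral_cos_laplace// -EFinM; congr EFin; rewrite /oneDsqr; field.
    by rewrite (gt_eqF tp) gt_eqF// ltr_wpDr ?sqr_ge0.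
  - exact: measurable_itv.
  - by apply/measurable_EFinP/measurable_funTS; apply: measurable_funM; [exact: mc|exact: me].
  - by move=> x; rewrite /= in_itv/= andbT => x0; rewrite lee_fin mulr_ge0 ?expR_ge0// subr_ge0 cos_le1.
  - by rewrite lee_fin ltW.
by move=> ->; exact: integral0y_oneDsqr.
Qed.

End dirichlet.

Lemma ae_imp d (T : measurableType d) (R : realType)
    (mu : {measure set T -> \bar R}) (P Q : T -> Prop) :
  (forall x, P x -> Q x) -> {ae mu, forall x, P x} -> {ae mu, forall x, Q x}.
Proof. by move=> PQ; apply: filterS. Qed.

Lemma ae_imp2 d (T : measurableType d) (R : realType)
    (mu : {measure set T -> \bar R}) (P Q S : T -> Prop) :
  (forall x, P x -> Q x -> S x) ->
  {ae mu, forall x, P x} -> {ae mu, forall x, Q x} -> {ae mu, forall x, S x}.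
Proof. by move=> PQ; apply: filterS2. Qed.

Lemma integral_ae_imp d (T : measurableType d) (R : realType)
    (mu : {measure set T -> \bar R}) (P : T -> Prop) (f g : T -> \bar R) :
  {ae mu, forall x, P x} -> (forall x, P x -> f x = g x) ->
  measurable_fun setT f -> measurable_fun setT g ->
  (\int[mu]_x f x = \int[mu]_x g x)%E.
Proof.
move=> aeP Pfg mf mg; apply: ae_eq_integral => //.
by apply: filterS aeP => x Px _; exact: Pfg.
Qed.

Section dirichlet_full_line.
Context {R : realType}.

Lemma measurable_invr : measurable_fun setT (fun x : R => x^-1).
Proof.
have -> : (fun x : R => x^-1) = (fun x => if x == 0 then 0 else x^-1).
  by apply/funext => x; case: eqP => // ->; rewrite invr0.
apply: measurable_fun_if => //.
  exact: measurable_fun_eqr.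
rewrite setTI (_ : _ @^-1` _ = [set x | x != 0]); last first.
  by apply/seteqP; split => x /=; [move/negbT|move/negbTE].
apply: open_continuous_measurable_fun; first exact: open_neq.
by move=> x /set_mem /= x0; exact: inv_continuous.
Qed.
Local Notation leb := (@lebesgue_measure R).

Let phi (x : R) : R := (1 - cos x) / x ^+ 2.

Let phi_ge0 x : 0 <= phi x.
Proof. by rewrite mulr_ge0 ?invr_ge0 ?sqr_ge0// subr_ge0 cos_le1. Qed.

Let measurable_phi : measurable_fun setT phi.
Proof.
apply: measurable_funM.
  by apply: measurable_funB => //; exact: (continuous_measurable_fun (@continuous_cos R)).
under eq_fun do rewrite -exprVn.
apply: measurable_funX; exact: measurable_invr.
Qed.

Let integral_phi : (\int[leb]_x (phi x)%:E = pi%:E)%E.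
Proof.
have mphi : measurable_fun setT (EFin \o phi).
  by apply/measurable_EFinP; exact: measurable_phi.
have -> : [set: R] = `]-oo, 0%R] `|` `]0%R, +oo[ :> set R.
  by apply/seteqP; split => // x _ /=; rewrite !in_itv/= andbT; case: (leP x 0); [left|right].
rewrite ge0_integral_setU//=; first last.
- apply/disj_setPS => x /= []; rewrite !in_itv/= andbT => x0 /(le_lt_trans x0).
  by rewrite ltxx.
- by move=> x _; rewrite lee_fin.
- exact: (measurable_funTS mphi).
rewrite integral_itv_obnd_cbnd; last exact: (measurable_funTS mphi).
have -> : (\int[leb]_(x in `]-oo, 0%R]) (phi x)%:E = \int[leb]_(x in `]-oo, 0%R]) (EFin \o phi) (- x)%R)%E.
  by apply: eq_integral => x _; rewrite /= /phi cosN sqrrN.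
rewrite -ge0_integration_by_substitution0// integral_dirichlet -EFinD.
by congr EFin; lra.
Qed.

(** The integrand is the squared modulus of the integral of exp(i w x) over an interval of length
    |c|, so this is Plancherel for one interval in the angular frequency w. *)
Lemma integral_cos_scaled (c : R) :
  (\int[leb]_w (2 * (1 - cos (w * c)) / w ^+ 2)%:E = (2 * pi * `|c|)%:E)%E.
Proof.
have [->|c0] := eqVneq c 0.
  rewrite normr0 mulr0 integral0_eq// => w _.
  by rewrite mulr0 cos0 subrr mulr0 mul0r.
transitivity (\int[leb]_w ((2 * c ^+ 2)%:E * (EFin \o phi) (c * w + 0)%R))%E.
  apply: eq_integral => w _; rewrite /= -EFinM addr0 /phi; congr EFin.
  have [->|w0] := eqVneq w 0; first by rewrite mulr0 mul0r cos0 subrr !(mulr0, mul0r).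
  by rewrite [w * c]mulrC; field; rewrite w0 c0.
have mphi : measurable_fun setT (EFin \o phi).
  by apply/measurable_EFinP; exact: measurable_phi.
rewrite ge0_integralZl//.
- rewrite ge0_integral_affine//= integral_phi -!EFinM; congr EFin.
  rewrite -[c ^+ 2]real_normK ?num_real//; field; by rewrite normr_eq0.
- apply: (measurableT_comp mphi); exact: measurable_affine.
- by move=> w _; rewrite /= lee_fin.
- by rewrite lee_fin mulr_ge0// sqr_ge0.
Qed.

End dirichlet_full_line.

(** * The Fourier integral *)

Section cexpi_facts.
Context {R : realType}.
Implicit Types a b : R.

Lemma cexpiD a b : cexpi (a + b) = cexpi a * cexpi b.
Proof. by apply: complex_ext => /=; rewrite ?sinD ?cosD//; ring. Qed.

Lemma cexpiN a : cexpi (- a) = (cexpi a)^*.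
Proof. by rewrite -conjcE /cexpi cosN sinN. Qed.

Lemma normc_cexpi a : normc (cexpi a) = 1.
Proof. by rewrite /= cos2Dsin2 sqrtr1. Qed.

Lemma cmeasurable_cexpi d (T : measurableType d) (h : T -> R) :
  measurable_fun setT h -> cmeasurable (fun x => cexpi (h x)).
Proof.
move=> mh; split => /=; apply: measurableT_comp mh.
  exact: (continuous_measurable_fun (@continuous_cos R)).
exact: (continuous_measurable_fun (@continuous_sin R)).
Qed.

End cexpi_facts.

Section cintegral_bound.
Context d (T : measurableType d) (R : realType) (mu : {measure set T -> \bar R}).

(** The factor 2 comes from estimating the real and imaginary parts separately. *)
Lemma normc_cintegral_le (f : T -> R[i]) : cintegrable mu f ->
  normc (cintegral mu f) <= 2 * \int[mu]_x normc (f x).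
Proof.
move=> fi; have [f1 f2] := fi; have fn := integrable_normc fi.
rewrite (le_trans (normc_le_ReIm _))//= mulrDl mul1r lerD//.
  rewrite (le_trans (le_normr_Rintegral _ _))// le_Rintegral//.
    exact: integrable_norm.
  by move=> x _; exact: Re_le_normc.
rewrite (le_trans (le_normr_Rintegral _ _))// le_Rintegral//.
  exact: integrable_norm.
by move=> x _; exact: Im_le_normc.
Qed.

End cintegral_bound.

Section fourier_integral.
Context {R : realType}.
Local Notation leb := (@lebesgue_measure R).
Local Notation mR := (measurableTypeR R).
Implicit Types (s : R) (f g : R -> R[i]).

(* The Fourier integral for s = -1, the inverse one for s = 1. *)
Definition ftk s f (xi : R) : R[i] :=
  cintegral leb (fun x => f x * cexpi (s * (2 * pi * x * xi))).

Lemma cmeasurable_ft_kernel s :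
  cmeasurable (fun z : mR * mR => cexpi (s * (2 * pi * (z.1 : R) * (z.2 : R)))).
Proof.
apply: cmeasurable_cexpi; apply: measurable_funM => //.
apply: measurable_funM; last exact: measurable_snd_R.
by apply: measurable_funM => //; exact: measurable_fst_R.
Qed.

Lemma cmeasurable_fst f : cmeasurable f -> cmeasurable (fun z : mR * mR => f z.1).
Proof. by move=> mf; apply: (cmeasurable_comp measurable_fst_R mf). Qed.

Lemma cmeasurable_snd f : cmeasurable f -> cmeasurable (fun z : mR * mR => f z.2).
Proof. by move=> mf; apply: (cmeasurable_comp measurable_snd_R mf). Qed.

Lemma cmeasurable_ftk s f : cmeasurable f -> cmeasurable (ftk s f).
Proof.
move=> mf; apply: (@cmeasurable_cintegral2 _ _ mR mR R leb
  (fun z => f z.1 * cexpi (s * (2 * pi * (z.1 : R) * (z.2 : R))))).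
by apply: cmeasurableM; [exact: cmeasurable_fst|exact: cmeasurable_ft_kernel].
Qed.

Lemma cmeasurable_wave (c : R) : cmeasurable (fun x : R => cexpi (c * x)).
Proof. by apply: cmeasurable_cexpi; exact: measurable_funM. Qed.

Lemma cintegrable_cexpi f (w : R) : cintegrable leb f ->
  cintegrable leb (fun x => f x * cexpi (w * x)).
Proof.
move=> fi; apply: (cintegrable_dom _ fi).
  by apply: cmeasurableM; [exact: cintegrable_measurable fi|exact: cmeasurable_wave].
by move=> x; rewrite Normc.normcM normc_cexpi mulr1.
Qed.

Lemma cintegrable_wave f s xi : cintegrable leb f ->
  cintegrable leb (fun x => f x * cexpi (s * (2 * pi * x * xi))).
Proof.
move=> fi; have := cintegrable_cexpi (s * (2 * pi * xi)) fi.
rewrite (_ : (fun x => _) = (fun x => f x * cexpi (s * (2 * pi * x * xi))))//.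
by apply/funext => x; congr (_ * cexpi _); ring.
Qed.

Lemma normc_ftk_le s f xi : cintegrable leb f ->
  normc (ftk s f xi) <= 2 * \int[leb]_x normc (f x).
Proof.
move=> fi; rewrite (le_trans (normc_cintegral_le (cintegrable_wave _ _ fi)))//.
rewrite ler_pM2l// le_eqVlt; apply/orP; left; apply/eqP; apply: eq_Rintegral => x _.
by rewrite Normc.normcM normc_cexpi mulr1.
Qed.

Let kernel s f g (z : mR * mR) : R[i] :=
  f z.1 * cexpi (s * (2 * pi * (z.1 : R) * (z.2 : R))) * (g z.2)^*.

Let cintegrable_kernel s f g : cintegrable leb f -> cintegrable leb g ->
  cintegrable (leb \x leb)%E (kernel s f g).
Proof.
move=> fi gi; have mf := cintegrable_measurable fi; have mg := cintegrable_measurable gi.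
apply: (cintegrable_dom _ (cintegrable_tensor fi (cintegrableJ gi))).
  apply: cmeasurableM; last by apply: cmeasurableJ; exact: cmeasurable_snd.
  by apply: cmeasurableM; [exact: cmeasurable_fst|exact: cmeasurable_ft_kernel].
by move=> z; rewrite /kernel !Normc.normcM normc_cexpi mulr1.
Qed.

Let kernel1 s f g x : cintegrable leb g ->
  cintegral leb (fun xi => kernel s f g (x, xi)) = f x * (ftk (- s) g x)^*.
Proof.
move=> gi; rewrite -cintegralJ; last exact: cintegrable_wave.
rewrite -cintegralZ; last by apply: cintegrableJ; exact: cintegrable_wave.
apply: eq_cintegral => xi; rewrite /kernel /= rmorphM/= -cexpiN mulNr opprK.
by rewrite -mulrA [_ * (g xi)^*]mulrC [2 * pi * xi * x]mulrAC.
Qed.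

Let kernel2 s f g xi : cintegrable leb f ->
  cintegral leb (fun x => kernel s f g (x, xi)) = ftk s f xi * (g xi)^*.
Proof.
move=> fi; rewrite [RHS]mulrC -cintegralZ; last exact: cintegrable_wave.
by apply: eq_cintegral => x; rewrite /kernel /= mulrC.
Qed.

(** The kernel f(x) exp(2 pi i s x xi) conj(g(xi)) is absolutely integrable on the product, and
    conjugation moves the exponential to g with the opposite sign. So [ftk s] and [ftk (- s)] are
    formally adjoint. *)
Lemma ftk_mult s f g : cintegrable leb f -> cintegrable leb g ->
  cintegral leb (fun xi => ftk s f xi * (g xi)^*) =
  cintegral leb (fun x => f x * (ftk (- s) g x)^*).
Proof.
move=> fi gi; have ki := @cintegrable_kernel s f g fi gi.
transitivity (cintegral (leb \x leb)%E (kernel s f g)).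
  by rewrite cfubini2//; apply: eq_cintegral => xi; rewrite kernel2.
by rewrite cfubini1//; apply: eq_cintegral => x; rewrite kernel1.
Qed.

Lemma cintegrable_ftkM s f g : cintegrable leb f -> cintegrable leb g ->
  cintegrable leb (fun xi => ftk s f xi * (g xi)^*).
Proof.
move=> fi gi; have := cintegrable_cintegral2 (@cintegrable_kernel s f g fi gi).
rewrite (_ : (fun y => _) = (fun xi => ftk s f xi * (g xi)^*))//.
by apply/funext => xi; rewrite kernel2.
Qed.

End fourier_integral.

(** * Fourier transforms of signed interval indicators *)

Section boxes.
Context {R : realType}.
Local Notation leb := (@lebesgue_measure R).
Implicit Types (s b c : R).

(* ebox b and ebox c are at squared distance |b - c|, and so are their Fourier
   transforms, by the integral of (1 - cos x) / x^2. *)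
Definition ebox b (x : R) : R[i] := cindic R `]0, b] x - cindic R `]b, 0] x.

Lemma ebox0 x : ebox 0 x = 0.
Proof. by rewrite /ebox subrr. Qed.

Lemma ebox_conj b x : (ebox b x)^* = ebox b x.
Proof. by rewrite /ebox rmorphB/= !cindic_conj. Qed.

Lemma lebesgue_itvoc_fin (a b : R) : (leb `]a, b] < +oo)%E.
Proof. by rewrite lebesgue_measure_itv/=; case: ifPn => _; rewrite ?ltry// -EFinB ltry. Qed.

Lemma cintegrable_ebox b : cintegrable leb (ebox b).
Proof.
rewrite /ebox; under eq_fun do rewrite -[X in _ + X]mulN1r.
apply: cintegrableD; last apply: cintegrableZ;
  by apply: cintegrable_cindic; [exact: measurable_itv|exact: lebesgue_itvoc_fin].
Qed.

Lemma sqint_ebox b : sqint leb (ebox b).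
Proof.
rewrite /ebox; under eq_fun do rewrite -[X in _ + X]mulN1r.
apply: sqintD; last apply: sqintZ;
  by apply: sqint_cindic; [exact: measurable_itv|exact: lebesgue_itvoc_fin].
Qed.

Lemma cindic_itvoc (a b : R) x : a <= b -> cindic R `]a, b] x = ebox b x - ebox a x.
Proof.
move=> ab; rewrite /ebox /cindic -!rmorphB/=; congr (_%:C).
rewrite !indicE !mem_setE !in_itv/=.
by have [? | ?] := ltP 0 x; have [? | ?] := leP x b; have [? | ?] := ltP b x;
  have [? | ?] := leP x 0; have [? | ?] := leP x a; have [? | ?] := ltP a x;
  rewrite /=; lra.
Qed.

Lemma normc_ebox_sub b c x : normc (ebox b x - ebox c x) ^+ 2 =
  \1_(`]Num.min b c, Num.max b c]%classic : set R) x.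
Proof.
wlog bc : b c / b <= c.
  move=> H; have [bc|/ltW cb] := leP b c; first by have := H b c bc; rewrite min_l// max_r.
  by have := H c b cb; rewrite min_l// max_r// -normcN opprB.
rewrite min_l// max_r// -normcN opprB -cindic_itvoc// normc_cindic.
exact: indic_sqr.
Qed.

Lemma integral_ebox_sub b c :
  (\int[leb]_x (normc (ebox b x - ebox c x) ^+ 2)%:E = `|b - c|%:E)%E.
Proof.
under eq_integral do rewrite normc_ebox_sub.
transitivity (leb `]Num.min b c, Num.max b c]).
  by rewrite integral_indic// setIT.
rewrite lebesgue_measure_itv/= lte_fin.
have [bc|cb] := ltP b c.
  by rewrite bc distrC ger0_norm ?subr_ge0 ?(ltW bc)// -EFinB.
rewrite -EFinB ger0_norm ?subr_ge0//; case: ltP => // bc.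
by congr EFin; apply/eqP; rewrite eq_sym subr_eq0 eq_le cb bc.
Qed.

Lemma cintegral_wave_itv (a b w : R) : a < b -> w != 0 ->
  cintegral leb (fun x => cindic R `]a, b] x * cexpi (w * x)) =
  ((sin (w * b) - sin (w * a)) / w) +i* ((cos (w * a) - cos (w * b)) / w).
Proof.
move=> ab w0.
have ftc (f F : R -> R) : continuous f -> (forall x : R, is_derive x 1 F (f x)) ->
    \int[leb]_x (\1_(`]a, b]%classic : set R) x * f x) = F b - F a.
  move=> cf dF.
  have cF x : {for x, continuous F}.
    by apply/differentiable_continuous/derivable1_diffP; apply: ex_derive.
  rewrite /Rintegral (_ : integral _ _ _ = (F b - F a)%:E)//.
  rewrite EFinB -(@continuous_FTC2 _ f F a b)//.
  - rewrite -integral_itv_obnd_cbnd; last first.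
      by apply/measurable_EFinP/measurable_funTS; exact: (continuous_measurable_fun cf).
    rewrite [RHS]integral_mkcond; apply: eq_integral => x _.
    by rewrite epatch_indic/= -EFinM mulrC.
  - exact: continuous_subspaceT.
  - split.
    + by move=> x _; apply: ex_derive.
    + by apply: cvg_at_right_filter; exact: cF.
    + by apply: cvg_at_left_filter; exact: cF.
  - by move=> x _; rewrite derive1E; exact: derive_val.
apply: complex_ext => /=.
  transitivity (\int[leb]_x (\1_(`]a, b]%classic : set R) x * cos (w * x))).
    by apply: eq_Rintegral => x _; rewrite /= mul0r subr0.
  have cc : continuous (fun x : R => cos (w * x)).
    move=> x; apply: continuous_comp; last exact: continuous_cos.
    by apply: cvgMr; exact: cvg_id.
  have dc (x : R) : is_derive x 1 (fun x => sin (w * x) / w) (cos (w * x)).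
    by apply: is_derive_eq; rewrite /GRing.scale/=; field.
  by rewrite (ftc _ _ cc dc) mulrBl.
transitivity (\int[leb]_x (\1_(`]a, b]%classic : set R) x * sin (w * x))).
  by apply: eq_Rintegral => x _; rewrite /= mul0r addr0.
have cs : continuous (fun x : R => sin (w * x)).
  move=> x; apply: continuous_comp; last exact: continuous_sin.
  by apply: cvgMr; exact: cvg_id.
have ds (x : R) : is_derive x 1 (fun x => - cos (w * x) / w) (sin (w * x)).
  by apply: is_derive_eq; rewrite /GRing.scale/=; field.
by rewrite (ftc _ _ cs ds) -mulrBl opprK addrC.
Qed.

(** The value is (exp(i w b) - 1) / (i w) for either sign of b: the sign in [ebox] is that of the
    oriented integral from 0 to b. *)
Lemma ftk_ebox s b xi : s * (2 * pi * xi) != 0 ->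
  let w := s * (2 * pi * xi) in
  ftk s (ebox b) xi = (sin (w * b) / w) +i* ((1 - cos (w * b)) / w).
Proof.
move=> w0 w.
have -> : ftk s (ebox b) xi = cintegral leb (fun x => ebox b x * cexpi (w * x)).
  by apply: eq_cintegral => x; rewrite /w; congr (_ * cexpi _); ring.
have [b0|b0|->] := ltgtP b 0.
- have -> : cintegral leb (fun x => ebox b x * cexpi (w * x)) =
      - cintegral leb (fun x => cindic R `]b, 0] x * cexpi (w * x)).
    rewrite -mulN1r -cintegralZ.
      apply: eq_cintegral => x; rewrite /ebox [cindic R `]0, b] x](_ : _ = 0) ?sub0r ?mulNr ?mul1r//.
      rewrite /cindic indicE memNset//= in_itv/= => /andP[x0 xb].
      by have := lt_le_trans x0 xb; rewrite ltNge (ltW b0).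
    apply: cintegrable_cexpi; apply: cintegrable_cindic; first exact: measurable_itv.
    exact: lebesgue_itvoc_fin.
  rewrite cintegral_wave_itv// mulr0 sin0 cos0.
  by apply: complex_ext => /=; lra.
- have -> : cintegral leb (fun x => ebox b x * cexpi (w * x)) =
      cintegral leb (fun x => cindic R `]0, b] x * cexpi (w * x)).
    apply: eq_cintegral => x; rewrite /ebox [cindic R `]b, 0] x](_ : _ = 0) ?subr0//.
    rewrite /cindic indicE memNset//= in_itv/= => /andP[x0 xb].
    by have := lt_le_trans x0 xb; rewrite ltNge (ltW b0).
  by rewrite cintegral_wave_itv// mulr0 sin0 cos0 subr0.
- rewrite mulr0 sin0 cos0 subrr mul0r.
  rewrite (@eq_cintegral _ _ _ leb _ (fun=> 0)); last first.
    by move=> x; rewrite ebox0 mul0r.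
  by rewrite /cintegral /Rintegral/= integral0.
Qed.

Lemma ae_neq0 : {ae leb, forall xi, (xi : R) != 0}.
Proof.
exists [set 0]; split; [exact: measurable_set1|exact: lebesgue_measure_set1|].
by move=> x /= /negP; rewrite negbK => /eqP.
Qed.

(** For w = 2 pi s xi different from 0 the integrand is 2 (1 - cos (w (b - c))) / w^2, and the
    Jacobian of this substitution cancels the 2 pi of [integral_cos_scaled]. *)
Lemma integral_ftk_ebox_sub s b c : s ^+ 2 = 1 ->
  (\int[leb]_xi (normc (ftk s (ebox b) xi - ftk s (ebox c) xi) ^+ 2)%:E = `|b - c|%:E)%E.
Proof.
move=> s1.
have s0 : s != 0 by apply: contra_eq_neq s1 => ->; rewrite expr0n eq_sym oner_neq0.
have sn : `|s| = 1.
  by apply/eqP; rewrite -(@eqrXn2 _ 2)// expr1n real_normK ?num_real// s1.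
have pi0 : 0 < (pi : R) := pi_gt0 R.
have p0 : s * (2 * pi) != 0 by rewrite !mulf_neq0// gt_eqF.
pose h w : \bar R := (2 * (1 - cos (w * (b - c))) / w ^+ 2)%:E.
have mh : measurable_fun setT h.
  apply/measurable_EFinP; apply: measurable_funM.
    apply: measurable_funM => //; apply: measurable_funB => //.
    apply: (measurableT_comp (continuous_measurable_fun (@continuous_cos R))).
    exact: measurable_funM.
  under eq_fun do rewrite -exprVn.
  apply: measurable_funX; exact: measurable_invr.
have h0 w : (0 <= h w)%E.
  by rewrite lee_fin !mulr_ge0 ?invr_ge0 ?sqr_ge0// subr_ge0 cos_le1.
transitivity (\int[leb]_xi h (s * (2 * pi) * xi + 0)%R)%E.
  apply: (integral_ae_imp (mu := leb) ae_neq0); last 2 first.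
  - apply: measurable_normc2; apply: cmeasurableB; apply: cmeasurable_ftk;
      exact: cintegrable_measurable (cintegrable_ebox _).
  - by apply: (measurableT_comp mh); exact: measurable_affine.
  move=> xi xi0.
  have w0 : s * (2 * pi * xi) != 0 by rewrite mulrA mulf_neq0.
  rewrite !ftk_ebox// /h addr0 -[s * (2 * pi) * xi]mulrA; move: w0; set w := s * _ => w0; congr EFin.
  rewrite normc2E /= [w * (b - c)]mulrBr cosB.
  have := cos2Dsin2 (w * b); have := cos2Dsin2 (w * c).
  move: (cos (w * b)) (sin (w * b)) (cos (w * c)) (sin (w * c)) => cb sb cc sc C B.
  transitivity ((cb ^+ 2 + sb ^+ 2 + (cc ^+ 2 + sc ^+ 2) -
    2 * (cb * cc + sb * sc)) / w ^+ 2); first by field.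
  by rewrite B C; congr (_ / _); ring.
rewrite ge0_integral_affine// integral_cos_scaled -EFinM; congr EFin.
rewrite normrM sn mul1r (ger0_norm (mulr_ge0 _ (ltW pi0)))// mulKf//.
by rewrite mulf_neq0// gt_eqF.
Qed.

End boxes.

Lemma le_normcD (R : realType) (z w : R[i]) : normc (z + w) <= normc z + normc w.
Proof.
have := @ler_normD R[i] R[i] z w.
by rewrite !normc_def -rmorphD lecR; case: z w => [a b] [a' b'].
Qed.

Lemma normcN (R : realType) (z : R[i]) : normc (- z) = normc z.
Proof. by case: z => a b /=; rewrite !sqrrN. Qed.

Lemma L2ipE d (T : measurableType d) (R : realType) (mu : {measure set T -> \bar R})
  (f g : L2 mu) : L2ip mu f g = inner f g.
Proof. by []. Qed.

(** * The unitary Fourier transform *)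

Section adjoint_pair.
Context {R : realType} {H1 H2 : lmodType R[i]}.
Variables (p1 : inner_product H1) (p2 : inner_product H2).
Hypothesis p1C : hcomplete p1.

Lemma ip_hbounded_eq (I : Type) (e : I -> H1) (A : H1 -> H2) u v : htotal p1 e ->
  hbounded p1 p2 A -> (forall i, p2 (A (e i)) u = p1 (e i) v) ->
  forall f, p2 (A f) u = p1 f v.
Proof.
move=> etot [Al [C AC]] Ae.
apply: (@hclosed_setT _ _ p1 p1C [set f | p2 (A f) u = p1 f v] _ _ _ I e) => //=.
- by rewrite (linear0_of Al) !ip0l.
- by move=> a g h gE hE; rewrite Al !ipDl !ipZl gE hE.
move=> g gS; apply/eqP; rewrite -subr_eq0; apply/eqP/Normc.eq0_normc.
apply: (@eq0_of_small _ _ (`|C| * hnorm p2 u + hnorm p1 v)).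
- exact: normc_ge0.
- by rewrite addr_ge0 ?mulr_ge0 ?hnorm_ge0.
move=> eps eps0; have [h hS gh] := gS _ eps0.
have -> : p2 (A g) u - p1 g v = p2 (A (g - h)) u - p1 (g - h) v.
  by rewrite (linearB_of Al) !ipBl hS opprB addrA subrK.
apply: (le_trans (le_normcD _ _)); rewrite normcN mulrDr lerD//.
  apply: (le_trans (cauchy_schwarz _ _ _)); rewrite mulrA ler_wpM2r ?hnorm_ge0//.
  apply: (le_trans (AC _)); rewrite mulrC.
  apply: (@le_trans _ _ (hnorm p1 (g - h) * `|C|)).
    by rewrite ler_wpM2l ?hnorm_ge0 ?ler_norm.
  by rewrite ler_wpM2r// ltW.
by apply: (le_trans (cauchy_schwarz _ _ _)); rewrite ler_wpM2r ?hnorm_ge0// ltW.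
Qed.

End adjoint_pair.

Section unitary_pair.
Context {R : realType} {H1 H2 : lmodType R[i]}.
Variables (p1 : inner_product H1) (p2 : inner_product H2).
Hypotheses (p1C : hcomplete p1) (p2C : hcomplete p2).
Variables (I J : Type) (e : I -> H1) (e' : J -> H2).
Hypotheses (etot : htotal p1 e) (e'tot : htotal p2 e').
Variables (A : H1 -> H2) (B : H2 -> H1).
Hypotheses (Ai : hisometry p1 p2 A) (Bi : hisometry p2 p1 B).
Hypothesis ABe : forall i j, p2 (A (e i)) (e' j) = p1 (e i) (B (e' j)).

(** Two density arguments: in f while g is one of the e' j, then in g after conjugating both
    sides. *)
Lemma hisometry_adjoint f g : p2 (A f) g = p1 f (B g).
Proof.
have Ae' j : forall f, p2 (A f) (e' j) = p1 f (B (e' j)).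
  by apply: (ip_hbounded_eq p1C etot) => //; exact: hisometry_bounded.
rewrite ipC [RHS]ipC; congr (_^*); apply/esym; move: g.
apply: (ip_hbounded_eq p2C e'tot); first exact: hisometry_bounded.
by move=> j; rewrite ipC -Ae' -ipC.
Qed.

End unitary_pair.

Definition hdist (R : realType) (H : lmodType R[i]) (p : inner_product H) f g : R :=
  hnorm p (f - g).

Lemma hdist_L2 d (T : measurableType d) (R : realType) (mu : {measure set T -> \bar R})
    (f g : L2 mu) :
  ((hdist (L2ip mu) f g ^+ 2)%:E = \int[mu]_x (normc (f x - g x) ^+ 2)%:E)%E.
Proof.
rewrite -L2norm_subE -hnorm_L2; reflexivity.
Qed.

(** Polarization with the common origin i0 recovers the real parts from the distances, and the
    imaginary parts vanish. Only distances between boxes then have to be integrated. *)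
Lemma gram_eq_dist (R : realType) (H1 H2 : lmodType R[i])
    (p1 : inner_product H1) (p2 : inner_product H2)
    (I : Type) (e : I -> H1) (e' : I -> H2) (i0 : I) :
  e i0 = 0 -> e' i0 = 0 ->
  (forall i j, Im (p1 (e i) (e j)) = 0) -> (forall i j, Im (p2 (e' i) (e' j)) = 0) ->
  (forall i j, hdist p1 (e i) (e j) ^+ 2 = hdist p2 (e' i) (e' j) ^+ 2) ->
  forall i j, p1 (e i) (e j) = p2 (e' i) (e' j).
Proof.
move=> e0 e'0 r1 r2 dist i j; apply: complex_ext; last by rewrite r1 r2.
have polar (H : lmodType R[i]) (p : inner_product H) f g :
    2 * Re (p f g) = hdist p f 0 ^+ 2 + hdist p g 0 ^+ 2 - hdist p f g ^+ 2.
  rewrite /hdist !hnorm_sqr !subr0 !ipBl !ipBr (ipC p f g) !(ReD, ReN) ReJ; ring.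
have two0 : (2 : R) != 0 by rewrite pnatr_eq0.
by apply: (mulfI two0); rewrite !polar -{1 2}e0 -{1 2}e'0 !dist.
Qed.

Section fourier_boxes.
Context {R : realType}.
Local Notation leb := (@lebesgue_measure R).
Implicit Types (s b c : R).

Lemma ftk_ebox0 s xi : ftk s (ebox 0) xi = 0.
Proof.
rewrite /ftk (@eq_cintegral _ _ _ leb _ (fun=> 0)); last first.
  by move=> x; rewrite ebox0 mul0r.
by rewrite /cintegral /Rintegral/= integral0.
Qed.

Lemma cmeasurable_ftk_ebox s b : cmeasurable (ftk s (ebox b)).
Proof. apply: cmeasurable_ftk; exact: cintegrable_measurable (cintegrable_ebox _). Qed.

Lemma sqint_ftk_ebox s b : s ^+ 2 = 1 -> sqint leb (ftk s (ebox b)).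
Proof.
move=> s1; split; first exact: cmeasurable_ftk_ebox.
have := integral_ftk_ebox_sub b 0 s1.
under [X in X = _]eq_integral do rewrite ftk_ebox0 subr0.
by move=> ->; rewrite ltry.
Qed.

Lemma ftk_oppJ s (f : R -> R[i]) xi : cintegrable leb f -> (forall x, (f x)^* = f x) ->
  ftk s f (- xi) = (ftk s f xi)^*.
Proof.
move=> fi fr; rewrite /ftk -cintegralJ; last exact: cintegrable_wave.
apply: eq_cintegral => x; rewrite rmorphM/= fr -cexpiN; congr (_ * cexpi _); ring.
Qed.

Lemma cintegral_opp (f : R -> R[i]) : cintegrable leb f ->
  cintegral leb (fun x => f (- x)) = cintegral leb f.
Proof.
move=> fi; have N10 : (-1 : R) != 0 by rewrite oppr_eq0 oner_neq0.
have := cintegral_affine 0 N10 fi; rewrite normrN1 invr1 mul1r => <-.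
by apply: eq_cintegral => x; rewrite mulN1r addr0.
Qed.

Definition box b : L2 leb := toL2 leb (ebox b).
Definition ftbox s b : L2 leb := toL2 leb (ftk s (ebox b)).

Lemma hdist_toL2 (f g : R -> R[i]) : sqint leb f -> sqint leb g ->
  ((hdist (L2ip leb) (toL2 leb f) (toL2 leb g) ^+ 2)%:E =
   \int[leb]_x (normc (f x - g x) ^+ 2)%:E)%E.
Proof.
move=> sf sg; rewrite hdist_L2; apply: ae_eq_integral => //.
- by apply: measurable_normc2; apply: cmeasurableB; exact: L2_cmeasurable.
- by apply: measurable_normc2; apply: cmeasurableB; [exact: sf.1|exact: sg.1].
- have := toL2_ae sg; have := toL2_ae sf.
  by apply: filterS2 => x -> ->.
Qed.

Lemma hdist_box b c : hdist (L2ip leb) (box b) (box c) ^+ 2 = `|b - c|.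
Proof.
have := hdist_toL2 (sqint_ebox b) (sqint_ebox c).
by rewrite integral_ebox_sub => -[].
Qed.

Lemma hdist_ftbox s b c : s ^+ 2 = 1 ->
  hdist (L2ip leb) (ftbox s b) (ftbox s c) ^+ 2 = `|b - c|.
Proof.
move=> s1; have := hdist_toL2 (sqint_ftk_ebox b s1) (sqint_ftk_ebox c s1).
by rewrite integral_ftk_ebox_sub// => -[].
Qed.

Lemma gram_box s b c : s ^+ 2 = 1 ->
  L2ip leb (box b) (box c) = L2ip leb (ftbox s b) (ftbox s c).
Proof.
move=> s1; move: b c.
apply: (@gram_eq_dist _ _ _ _ _ R box (ftbox s) 0).
- apply/L2_eqP; apply: (ae_imp2 _ (toL2_ae (sqint_ebox 0)) (L2_zero_ae leb)) => x h1 h2.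
  by rewrite [LHS]h1 [RHS]h2 ebox0.
- apply/L2_eqP; apply: (ae_imp2 _ (toL2_ae (sqint_ftk_ebox 0 s1)) (L2_zero_ae leb)) => x h1 h2.
  by rewrite [LHS]h1 [RHS]h2 ftk_ebox0.
- move=> b c; rewrite L2ipE inner_toL2; [|exact: sqint_ebox..].
  rewrite /cintegral/= (_ : (fun x => _) = (fun=> 0)).
    by rewrite /Rintegral integral0.
  by apply/funext => x; rewrite /= !subrr oppr0 mulr0 mul0r addr0.
- move=> b c; rewrite L2ipE inner_toL2; [|exact: sqint_ftk_ebox..].
  have ki : cintegrable leb (fun x => ftk s (ebox b) x * (ftk s (ebox c) x)^*).
    by apply: sqint_cintegrableJ; exact: sqint_ftk_ebox.
  (* Transforms of real functions are Hermitian, so xi -> -xi conjugates the integrand, and the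
     inner product is real. *)
  set I := cintegral _ _.
  have : I = I^*.
    rewrite /I -cintegralJ// -(cintegral_opp ki); apply: eq_cintegral => x.
    by rewrite !(ftk_oppJ _ _ (cintegrable_ebox _) (ebox_conj _)) -rmorphM.
  move/(congr1 (@complex.Im R)); rewrite ImJ => /eqP.
  by rewrite -addr_eq0 -mulr2n mulrn_eq0 => /eqP.
- by move=> b c; exact: etrans (hdist_box b c) (esym (hdist_ftbox b c s1)).
Qed.

(** An interval ]a, b] is the difference of two boxes, and these intervals form a generating
    pi-system. *)
Lemma cae_eq0_ebox (f : R -> R[i]) : cmeasurable f ->
  (forall b, cintegrable leb (fun x => f x * ebox b x)) ->
  (forall b, cintegral leb (fun x => f x * ebox b x) = 0) ->
  {ae leb, forall x, f x = 0}.
Proof.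
move=> mf fi f0.
have H A : ocitv A -> cintegrable leb (fun x => cindic R A x * f x) /\
    cintegral leb (fun x => cindic R A x * f x) = 0.
  move=> [[a b] _ <-] /=; have [ab|ba] := leP a b.
    have -> : (fun x => cindic R `]a, b] x * f x) =
        (fun x => f x * ebox b x - f x * ebox a x).
      by apply/funext => x; rewrite cindic_itvoc// mulrC mulrBr.
    split; last by rewrite cintegralB// !f0 subrr.
    under eq_fun do rewrite -[X in _ + X]mulN1r.
    by apply: cintegrableD => //; exact: cintegrableZ.
  have -> : (fun x => cindic R `]a, b] x * f x) = (fun x => f x * ebox 0 x).
    apply/funext => x; rewrite ebox0 mulr0 set_itv_ge ?bnd_simp -?leNgt ?(ltW ba)//.
    by rewrite /cindic indic0 mul0r.
  by split.
apply: (@cae_eq0_pisystem _ (measurableTypeR R) R leb f (@ocitv R)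
  (fun n => `]- n%:R, n%:R]%classic)) => //.
- exact: ocitvI.
- by move=> n; exists (- n%:R, n%:R).
- rewrite -subTset => x _; exists (Num.truncn `|x|).+1 => //=.
  rewrite in_itv/=; have := truncnS_gt `|x|; rewrite ltr_norml => /andP[-> /ltW ->]//.
- by move=> A /H[].
- by move=> A /H[].
Qed.

Lemma htotal_box : htotal (L2ip leb) box.
Proof.
suff H (h : L2 leb) : (forall b, inner h (box b) = 0) -> h = 0 by exact: H.
move=> hb; apply/L2_eqP.
have h0 : {ae leb, forall x, h x = 0}.
  apply: cae_eq0_ebox; first exact: (L2_cmeasurable h).
  - move=> b; under eq_fun do rewrite -ebox_conj.
    by apply: sqint_cintegrableJ; [exact: L2_sqint|exact: sqint_ebox].
  - move=> b; rewrite -(hb b) inner_toL2r; last exact: sqint_ebox.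
    by apply: eq_cintegral => x; rewrite ebox_conj.
by apply: (ae_imp2 _ h0 (L2_zero_ae leb)) => x -> h2; rewrite [RHS]h2.
Qed.

Lemma box_cintegrable b : cintegrable leb (box b : L2 leb).
Proof.
apply: ae_eq_cintegrable (cintegrable_ebox b); first exact: L2_cmeasurable.
by apply: (ae_imp _ (toL2_ae (sqint_ebox b))) => x.
Qed.

Lemma ftk_ae (f g : R -> R[i]) s xi : cmeasurable f -> cmeasurable g ->
  {ae leb, forall x, f x = g x} -> ftk s f xi = ftk s g xi.
Proof.
move=> mf mg fg; have mw : cmeasurable (fun x : R => cexpi (s * (2 * pi * x * xi))).
  have := cmeasurable_wave (s * (2 * pi * xi)).
  rewrite (_ : (fun x => _) = (fun x => cexpi (s * (2 * pi * x * xi))))//.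
  by apply/funext => x; congr (cexpi _); ring.
apply: ae_eq_cintegral; [exact: cmeasurableM..|].
by apply: (ae_imp _ fg) => x ->.
Qed.

Lemma inner_box (g : L2 leb) b :
  L2ip leb g (box b) = cintegral leb (fun x => g x * ebox b x).
Proof.
rewrite L2ipE /box inner_toL2r; last exact: sqint_ebox.
by apply: eq_cintegral => x; rewrite ebox_conj.
Qed.

Lemma inner_ftbox (g : L2 leb) s b : s ^+ 2 = 1 ->
  L2ip leb g (ftbox s b) = cintegral leb (fun x => g x * (ftk s (ebox b) x)^*).
Proof. by move=> s1; rewrite L2ipE /ftbox inner_toL2r//; exact: sqint_ftk_ebox. Qed.

(** The multiplication formula on boxes, from which the adjointness of the two extensions is
    propagated. *)
Lemma inner_ftbox_box s b c : s ^+ 2 = 1 ->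
  L2ip leb (ftbox s b) (box c) = L2ip leb (box b) (ftbox (- s) c).
Proof.
move=> ss; have ss' : (- s) ^+ 2 = 1 by rewrite sqrrN.
rewrite L2ipE /box /ftbox inner_toL2; [|exact: sqint_ftk_ebox|exact: sqint_ebox].
rewrite L2ipE inner_toL2; [|exact: sqint_ebox|exact: sqint_ftk_ebox].
by apply: ftk_mult; exact: cintegrable_ebox.
Qed.

#[local] Opaque box ftbox.

(* On integrable functions the extension agrees with the Fourier integral, by
   the multiplication formula against the boxes. *)
Lemma exists_fourier : exists A B : L2 leb -> L2 leb,
  [/\ hisometry (L2ip leb) (L2ip leb) A, hisometry (L2ip leb) (L2ip leb) B,
      cancel A B, cancel B A &
      (forall f : L2 leb, cintegrable leb f ->
        {ae leb, forall xi, A f xi = ftk (-1) f xi} /\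
        {ae leb, forall xi, B f xi = ftk 1 f xi})].
Proof.
have s1 : (-1 : R) ^+ 2 = 1 by rewrite sqrrN expr1n.
have t1 : (1 : R) ^+ 2 = 1 by rewrite expr1n.
have ex s : s ^+ 2 = 1 -> exists2 A, hisometry (L2ip leb) (L2ip leb) A &
    forall b, A (box b) = ftbox s b.
  move=> ss; apply: (isometry_extension _ _ htotal_box); try exact: L2_complete.
  by move=> b c; exact: gram_box.
have [A Ai Ae] := ex _ s1; have [B Bi Be] := ex _ t1.
have adj : forall f g, L2ip leb (A f) g = L2ip leb f (B g).
  apply: (hisometry_adjoint _ _ htotal_box htotal_box Ai Bi); try exact: L2_complete.
  by move=> b c; rewrite Ae Be (inner_ftbox_box b c s1) opprK.
have adj' f g : L2ip leb (B f) g = L2ip leb f (A g) by rewrite ipC -adj -ipC.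
(* C and D stand for the two extensions in either order, so that one argument yields both integral
   formulas. *)
have L1 s (C D : L2 leb -> L2 leb) (f : L2 leb) : s ^+ 2 = 1 ->
    (forall f g, L2ip leb (C f) g = L2ip leb f (D g)) ->
    (forall b, D (box b) = ftbox (- s) b) -> cintegrable leb f ->
    {ae leb, forall xi, C f xi = ftk s f xi}.
  move=> ss CD De fi; have mk : cmeasurable (fun xi => C f xi - ftk s f xi).
    apply: cmeasurableB; first exact: L2_cmeasurable.
    by apply: cmeasurable_ftk; exact: cintegrable_measurable fi.
  have i1 b : cintegrable leb (fun x => C f x * ebox b x).
    under eq_fun do rewrite -ebox_conj.
    by apply: sqint_cintegrableJ; [exact: L2_sqint|exact: sqint_ebox].
  have i2 b : cintegrable leb (fun x => ftk s f x * ebox b x).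
    under eq_fun do rewrite -ebox_conj.
    by apply: cintegrable_ftkM => //; exact: cintegrable_ebox.
  have : {ae leb, forall xi, C f xi - ftk s f xi = 0}.
    apply: cae_eq0_ebox => // b; under eq_fun do rewrite mulrBl.
      under eq_fun do rewrite -[X in _ + X]mulN1r.
      by apply: cintegrableD => //; exact: cintegrableZ.
    rewrite cintegralB//; apply/eqP; rewrite subr_eq0; apply/eqP.
    have := CD f (box b); rewrite De.
    rewrite inner_box inner_ftbox ?sqrrN// => ->.
    by rewrite -ftk_mult//; [apply: eq_cintegral => x; rewrite ebox_conj|exact: cintegrable_ebox].
  by apply: ae_imp => x /eqP; rewrite subr_eq0 => /eqP.
exists A, B; split => //.
(* Each extension is an isometry whose adjoint is the other one, so both composites are the
   identity; surjectivity needs no further argument. *)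
- by move=> g; apply: (@ip_extr _ _ (L2ip leb)) => f; rewrite -adj Ai.2.
- by move=> g; apply: (@ip_extl _ _ (L2ip leb)) => f; rewrite adj Bi.2.
move=> f fi; split.
  have Be' b : B (box b) = ftbox (- -1) b by rewrite opprK.
  exact: L1 s1 adj Be' fi.
exact: L1 t1 adj' Ae fi.
Qed.

(** Evaluates the definite description: [exists_fourier] provides a candidate, and any other one
    agrees with it on the boxes, which are integrable, hence everywhere. The kernel sign is -1 for
    [fourier] and 1 for its inverse. *)
Lemma fourierP : exists B : L2 leb -> L2 leb,
  @inverse_fourier R = B /\
  [/\ hisometry (L2ip leb) (L2ip leb) (@fourier R),
    hisometry (L2ip leb) (L2ip leb) B, cancel (@fourier R) B, cancel B (@fourier R) &
      (forall f : L2 leb, cintegrable leb f ->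
        {ae leb, forall xi, fourier f xi = ftk (-1) f xi} /\
        {ae leb, forall xi, B f xi = ftk 1 f xi})].
Proof.
have [A [B [Ai Bi AB BA L1]]] := exists_fourier.
pose P := [set F : L2 leb -> L2 leb | unitary_operator F /\
    forall f : L2 leb, cintegrable leb f ->
      {ae leb, forall xi, F f xi =
        cintegral leb (fun x => f x * cexpi (- (2 * pi * x * xi)))}].
have ftkN f xi : cintegral leb (fun x => f x * cexpi (- (2 * pi * x * xi))) = ftk (-1) f xi.
  by apply: eq_cintegral => x; rewrite mulN1r.
have PA : P A.
  split; first split; [exact: Ai.1| |exact: Ai.2|].
    by apply/seteqP; split => // g _; exists (B g).
  by move=> f fi; apply: (ae_imp _ (L1 f fi).1) => xi ->; rewrite ftkN.
have [[Fl Fs Fi] FL1] : P (@fourier R) by apply: xgetPex; exists A.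
have FA : @fourier R = A.
  have Fb : hbounded (L2ip leb) (L2ip leb) (@fourier R) by exact: (@hisometry_bounded _ _ _ (L2ip leb) (L2ip leb)).
  suff FAe b : fourier (box b) = A (box b).
    exact (@hbounded_eq _ _ _ (L2ip leb) (L2ip leb) (@L2_complete _ _ _ leb) _ _ _ _ htotal_box Fb (hisometry_bounded Ai) FAe).
   apply/L2_eqP.
  apply: (ae_imp2 _ (FL1 _ (box_cintegrable b)) (L1 _ (box_cintegrable b)).1).
  by move=> xi -> ->; rewrite ftkN.
have invB : @inverse_fourier R = B.
  apply/funext => g; rewrite /inverse_fourier FA -{1}(BA g).
  have injA : {in setT &, injective A} by move=> x y _ _; exact: (can_inj AB).
  by apply: (pinvKV _ injA); rewrite inE.
by exists B; rewrite invB FA.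
Qed.

End fourier_boxes.

(** * Tensor products *)

Section isometry_composition.
Context {R : realType} {H1 H2 H3 : lmodType R[i]}.
Variables (p1 : inner_product H1) (p2 : inner_product H2) (p3 : inner_product H3).

Lemma hisometry_comp (A : H2 -> H3) (B : H1 -> H2) :
  hisometry p2 p3 A -> hisometry p1 p2 B -> hisometry p1 p3 (A \o B).
Proof.
move=> [Al Ai] [Bl Bi]; split; first by move=> a f g /=; rewrite Bl Al.
by move=> f g /=; rewrite Ai Bi.
Qed.

Lemma hisometry_id : hisometry p1 p1 id.
Proof. by []. Qed.

End isometry_composition.

Section L2_operators.
Context d1 d2 (T1 : measurableType d1) (T2 : measurableType d2) (R : realType).
Variables (mu : {measure set T1 -> \bar R}) (nu : {measure set T2 -> \bar R}).

Lemma L2_hbounded_eq (I : Type) (e : I -> L2 mu) (A B : L2 mu -> L2 nu) :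
  htotal (L2ip mu) e -> hbounded (L2ip mu) (L2ip nu) A ->
  hbounded (L2ip mu) (L2ip nu) B -> (forall i, A (e i) = B (e i)) -> A = B.
Proof. exact (@hbounded_eq _ _ _ (L2ip mu) (L2ip nu) (@L2_complete _ _ _ mu) I e A B). Qed.

Lemma L2_isometry_extension (I : Type) (e : I -> L2 mu) (e' : I -> L2 nu) :
  htotal (L2ip mu) e -> (forall i j, L2ip mu (e i) (e j) = L2ip nu (e' i) (e' j)) ->
  exists2 A : L2 mu -> L2 nu, hisometry (L2ip mu) (L2ip nu) A & forall i, A (e i) = e' i.
Proof.
exact (@isometry_extension _ _ _ (L2ip mu) (L2ip nu) (@L2_complete _ _ _ mu)
  (@L2_complete _ _ _ nu) I e e').
Qed.

End L2_operators.

Section tensors.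
Context d1 d2 (T1 : measurableType d1) (T2 : measurableType d2) (R : realType).
Variables (mu : {sigma_finite_measure set T1 -> \bar R}).
Variables (nu : {sigma_finite_measure set T2 -> \bar R}).
Implicit Types (f : T1 -> R[i]) (g : T2 -> R[i]).

Lemma ae_prod_fst (P : T1 -> Prop) : {ae mu, forall x, P x} ->
  {ae (mu \x nu)%E, forall z, P z.1}.
Proof.
move=> [N [mN N0 PN]]; exists (N `*` setT); split.
- exact: measurableX.
- by have := product_measure1E mu nu mN measurableT => /= ->; rewrite N0 mul0e.
- by move=> z /= nP; split => //; exact: PN.
Qed.

Lemma ae_prod_snd (P : T2 -> Prop) : {ae nu, forall x, P x} ->
  {ae (mu \x nu)%E, forall z, P z.2}.
Proof.
move=> [N [mN N0 PN]]; exists (setT `*` N); split.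
- exact: measurableX.
- by have := product_measure1E mu nu measurableT mN => /= ->; rewrite N0 mule0.
- by move=> z /= nP; split => //; exact: PN.
Qed.

Lemma cmeasurable_tensor f g : cmeasurable f -> cmeasurable g ->
  cmeasurable (fun z : T1 * T2 => f z.1 * g z.2).
Proof.
move=> mf mg; apply: cmeasurableM.
  exact: (cmeasurable_comp (@measurable_fst _ _ T1 T2) mf).
exact: (cmeasurable_comp (@measurable_snd _ _ T1 T2) mg).
Qed.

Lemma cintegrable_normc2 d (T : measurableType d) (m : {measure set T -> \bar R})
  (h : T -> R[i]) : sqint m h -> cintegrable m (fun x => (normc (h x) ^+ 2)%:C).
Proof.
move=> [mh hi]; apply: cintegrableP.
  apply: cmeasurable_real; apply: measurable_funX; exact: measurable_normc.
rewrite (le_lt_trans _ hi)// le_eqVlt; apply/orP; left; apply/eqP.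
by apply: eq_integral => x _; rewrite /= expr0n addr0 sqrtr_sqr ger0_norm// sqr_ge0.
Qed.

Lemma sqint_tensor f g : sqint mu f -> sqint nu g ->
  sqint (mu \x nu)%E (fun z => f z.1 * g z.2).
Proof.
move=> sf sg; split; first by apply: cmeasurable_tensor; [exact: sf.1|exact: sg.1].
have := cintegrable_lt (cintegrable_tensor (cintegrable_normc2 sf) (cintegrable_normc2 sg)).
move=> h; rewrite (le_lt_trans _ h)// le_eqVlt; apply/orP; left; apply/eqP.
apply: eq_integral => z _; rewrite -rmorphM/= expr0n addr0 sqrtr_sqr.
by rewrite Normc.normcM exprMn ger0_norm// mulr_ge0// sqr_ge0.
Qed.

Lemma cintegral_tensor f g : cintegrable mu f -> cintegrable nu g ->
  cintegral (mu \x nu)%E (fun z => f z.1 * g z.2) = cintegral mu f * cintegral nu g.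
Proof.
move=> fi gi; rewrite cfubini1; last exact: cintegrable_tensor.
rewrite mulrC -cintegralZ//; apply: eq_cintegral => x /=.
by rewrite cintegralZ// mulrC.
Qed.

Lemma inner_tensor (f f' : L2 mu) (g g' : L2 nu) :
  inner (tensor f g) (tensor f' g') = inner f f' * inner g g'.
Proof.
rewrite /tensor inner_toL2; [|by apply: sqint_tensor; exact: L2_sqint..].
rewrite -cintegral_tensor; [|exact: inner_cintegrable..].
by apply: eq_cintegral => z; rewrite rmorphM/= mulrACA.
Qed.

Lemma tensor_ae (f : L2 mu) (g : L2 nu) f' g' :
  {ae mu, forall x, f x = f' x} -> {ae nu, forall y, g y = g' y} ->
  {ae (mu \x nu)%E, forall z, tensor f g z = f' z.1 * g' z.2}.
Proof.
move=> /ae_prod_fst ff' /ae_prod_snd gg'.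
have := toL2_ae (sqint_tensor (L2_sqint f) (L2_sqint g)).
by apply: filterS3 ff' gg' => z e1 e2 e3; rewrite /tensor e3 e1 e2.
Qed.

Definition tensors (p : L2 mu * L2 nu) : L2 (mu \x nu)%E := tensor p.1 p.2.

(** Indicators of rectangles of finite measure are elementary tensors, so [cae_eq0_rectangles]
    applies. *)
Lemma htotal_tensors : htotal (L2ip (mu \x nu)%E) tensors.
Proof.
suff H (h : L2 (mu \x nu)%E) : (forall p, inner h (tensors p) = 0) -> h = 0 by exact: H.
move=> hp; apply/L2_eqP.
have h0 : {ae (mu \x nu)%E, forall z, h z = 0}.
  apply: cae_eq0_rectangles; first exact: (L2_cmeasurable h).
  move=> A B mA mB Afin Bfin.
  have sA := sqint_cindic mA Afin; have sB := sqint_cindic mB Bfin.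
  have sAB := sqint_tensor sA sB.
  have e : (fun z => cindic R (A `*` B) z * h z) =
      (fun z => h z * (cindic R A z.1 * cindic R B z.2)^*).
    by apply/funext => z; rewrite cindicX mulrC rmorphM/= !cindic_conj.
  rewrite e; split; first by apply: sqint_cintegrableJ => //; exact: L2_sqint.
  rewrite -(hp (toL2 mu (cindic R A), toL2 nu (cindic R B))).
  apply/esym/inner_ae; [exact: L2_cmeasurable|exact: sAB.1|exact: aeW|].
  by apply: tensor_ae; exact: toL2_ae.
by apply: filterS2 h0 (L2_zero_ae _) => x -> h2; rewrite [RHS]h2.
Qed.

Lemma hbounded_L2 d3 d4 (T3 : measurableType d3) (T4 : measurableType d4)
    (m3 : {measure set T3 -> \bar R}) (m4 : {measure set T4 -> \bar R})
    (A : L2 m3 -> L2 m4) :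
  hbounded (L2ip m3) (L2ip m4) A <-> bounded_operator A.
Proof.
split=> -[Al [C AC]]; split => //; exists C => f; have := AC f; by rewrite !hnorm_L2.
Qed.

Lemma exists_tensor_operator (B : L2 nu -> L2 nu) : hisometry (L2ip nu) (L2ip nu) B ->
  exists2 U, hisometry (L2ip (mu \x nu)%E) (L2ip (mu \x nu)%E) U &
    forall (f : L2 mu) (g : L2 nu), U (tensor f g) = tensor f (B g).
Proof.
move=> Bi.
pose e' (p : L2 mu * L2 nu) : L2 (mu \x nu)%E := tensor p.1 (B p.2).
have Gr p q : L2ip (mu \x nu)%E (tensors p) (tensors q) = L2ip (mu \x nu)%E (e' p) (e' q).
  by rewrite !L2ipE !inner_tensor; congr (_ * _); have := Bi.2 p.2 q.2; rewrite !L2ipE.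
have [U Ui Ue] := L2_isometry_extension htotal_tensors Gr.
by exists U => // f g; have := Ue (f, g).
Qed.

(** V is the operator built in the same way from the left inverse B'. On elementary tensors V U is
    the identity, hence everywhere. *)
Lemma tensor_operatorP (B B' : L2 nu -> L2 nu) :
  hisometry (L2ip nu) (L2ip nu) B -> hisometry (L2ip nu) (L2ip nu) B' ->
  cancel B B' ->
  let U := @tensor_operator _ _ _ _ _ mu nu id B in
  exists V, [/\ hisometry (L2ip (mu \x nu)%E) (L2ip (mu \x nu)%E) V, cancel U V &
    forall (f : L2 mu) (g : L2 nu), U (tensor f g) = tensor f (B g)].
Proof.
move=> Bi B'i BK U.
have [U' U'i U'e] := exists_tensor_operator Bi.
have [V Vi Ve] := exists_tensor_operator B'i.
have [Ub Ue] : [set U | bounded_operator U /\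
    forall (f : L2 mu) (g : L2 nu), U (tensor f g) = tensor f (B g)] U.
  apply: (@xgetPex _ (fun=> 0) [set U | bounded_operator U /\
    forall (f : L2 mu) (g : L2 nu), U (tensor f g) = tensor (id f) (B g)]).
  by exists U'; split => //; apply/hbounded_L2; exact: hisometry_bounded.
have UU' : U = U'.
  apply: (L2_hbounded_eq htotal_tensors).
  - by apply/hbounded_L2.
  - exact: hisometry_bounded U'i.
  - by move=> [f g]; rewrite /tensors/= Ue U'e.
exists V; rewrite UU'; split => //.
have E : V \o U' = id.
  apply: (L2_hbounded_eq htotal_tensors).
  - exact: hisometry_bounded (hisometry_comp Vi U'i).
  - exact: hisometry_bounded (hisometry_id _).
  - by move=> [f g]; rewrite /tensors/= U'e Ve BK.
by move=> h; exact: (congr1 (fun A => A h) E).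
Qed.

End tensors.

(** The defect of linearity is orthogonal to the range of A and is itself a combination of values of
    A, so it vanishes. This spares almost-everywhere computations for operators defined through
    [toL2]. *)
Lemma ip_preserving_linear (R : realType) (H1 H2 : lmodType R[i])
    (p1 : inner_product H1) (p2 : inner_product H2) (A : H1 -> H2) :
  (forall f g, p2 (A f) (A g) = p1 f g) -> linear A.
Proof.
move=> Ai a f g; apply/eqP; rewrite -subr_eq0; apply/eqP/(@ip_eq0 _ _ p2).
set h := _ - _; have h0 k : p2 h (A k) = 0.
  by rewrite ipBl ipDl ipZl !Ai ipDl ipZl subrr.
by rewrite {2}/h ipBr ipDr ipZr !h0 mulr0 addr0 subrr.
Qed.

(** * The operators Q and Q^* *)

Section sqint_facts.
Context d (T : measurableType d) (R : realType) (m : {measure set T -> \bar R}).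

Lemma L2norm_toL2_sqr (h : T -> R[i]) : sqint m h ->
  ((L2norm (toL2 m h) ^+ 2)%:E = \int[m]_x (normc (h x) ^+ 2)%:E)%E.
Proof.
move=> sh; rewrite L2norm_sqrE; apply: ae_eq_integral => //.
- exact/measurable_normc2/L2_cmeasurable.
- exact: measurable_normc2 sh.1.
- by apply: filterS (toL2_ae sh) => x ->.
Qed.

Lemma cauchy_schwarz_cintegral (h k : T -> R[i]) : sqint m h -> sqint m k ->
  (\int[m]_x (normc (k x) ^+ 2)%:E = 1)%E ->
  ((normc (cintegral m (fun x => h x * (k x)^*)) ^+ 2)%:E <=
    \int[m]_x (normc (h x) ^+ 2)%:E)%E.
Proof.
move=> sh sk k1; rewrite -inner_toL2// -L2norm_toL2_sqr// lee_fin.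
have k1' : L2norm (toL2 m k) = 1.
  have := L2norm_toL2_sqr sk; rewrite k1 => -[] /eqP.
  by rewrite sqrf_eq1 => /predU1P[//|/eqP kN]; have := sqrtr_ge0 (\int[m]_x (normc (toL2 m k x) ^+ 2));
    rewrite -/(L2norm _) kN lerNr oppr0 ler10.
rewrite ler_sqr ?nnegrE ?sqrtr_ge0 ?normc_ge0//.
by have := cauchy_schwarz (L2ip m) (toL2 m h) (toL2 m k); rewrite !hnorm_L2 k1' mulr1.
Qed.

Lemma cintegral_normc2 (h : T -> R[i]) (r : R) :
  (\int[m]_x (normc (h x) ^+ 2)%:E = r%:E)%E ->
  cintegral m (fun x => h x * (h x)^*) = r%:C.
Proof.
move=> hr; apply: complex_ext => /=.
  by rewrite (_ : r = fine r%:E)// -hr; apply: eq_Rintegral => x _; rewrite mulcJ.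
under eq_Rintegral do rewrite mulcJ/=.
by rewrite /Rintegral integral0.
Qed.

Lemma sqint_cintegrable_normc2 (h : T -> R[i]) : cmeasurable h ->
  cintegrable m (fun x => (normc (h x) ^+ 2)%:C) -> sqint m h.
Proof.
move=> mh /cintegrable_lt hi; split => //.
rewrite (le_lt_trans _ hi)// le_eqVlt; apply/orP; left; apply/eqP.
by apply: eq_integral => x _; rewrite /= expr0n addr0 sqrtr_sqr ger0_norm// sqr_ge0.
Qed.

End sqint_facts.

Section multiplier_isometry.
Context d1 d2 (T1 : measurableType d1) (T2 : measurableType d2) (R : realType).
Variables (m1 : {sigma_finite_measure set T1 -> \bar R}).
Variables (m2 : {sigma_finite_measure set T2 -> \bar R}).
Variable l : T1 -> T2 -> R[i].
Hypothesis ml : cmeasurable (fun z : T1 * T2 => l z.1 z.2).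
Hypothesis l1 : {ae m2, forall w, (\int[m1]_t (normc (l t w) ^+ 2)%:E = 1)%E}.

(** For l = [ell c Psi] this is [Q_op], and [mult_adj] is [Q_adj], by conversion; the two cases
    share the proofs that follow. *)
Definition mult_op (f : L2 m2) : L2 (m1 \x m2)%E :=
  toL2 (m1 \x m2)%E (fun z => f z.2 * l z.1 z.2).

Definition mult_adj (F : L2 (m1 \x m2)%E) : L2 m2 :=
  toL2 m2 (fun w => cintegral m1 (fun t => F (t, w) * (l t w)^*)).

Lemma cmeasurable_slice1 (k : T1 * T2 -> R[i]) w : cmeasurable k ->
  cmeasurable (fun t => k (t, w)).
Proof. by move=> mk; exact: (cmeasurable_comp (pair2_measurable w) mk). Qed.

Lemma cmeasurable_mult (f : T2 -> R[i]) : cmeasurable f ->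
  cmeasurable (fun z : T1 * T2 => f z.2 * l z.1 z.2).
Proof.
move=> mf; apply: cmeasurableM => //.
exact: (cmeasurable_comp (@measurable_snd _ _ T1 T2) mf).
Qed.

Lemma sqint_mult (f : T2 -> R[i]) : sqint m2 f ->
  sqint (m1 \x m2)%E (fun z => f z.2 * l z.1 z.2).
Proof.
move=> [mf fi]; have mfl := cmeasurable_mult mf; split => //.
have mE : measurable_fun setT
    (fun z : T1 * T2 => (normc (f z.2 * l z.1 z.2) ^+ 2)%:E) by exact: measurable_normc2.
rewrite (@fubini_tonelli2 _ _ _ _ _ m1 m2
  (fun z => (normc (f z.2 * l z.1 z.2) ^+ 2)%:E))//; last first.
  by move=> z; rewrite lee_fin sqr_ge0.
rewrite (le_lt_trans _ fi)// le_eqVlt; apply/orP; left; apply/eqP.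
apply: ae_eq_integral => //.
- apply: (@measurable_fun_fubini_tonelli_G _ _ _ _ _ m1
    (fun z => (normc (f z.2 * l z.1 z.2) ^+ 2)%:E)) => //.
  by move=> z; rewrite lee_fin sqr_ge0.
- exact: measurable_normc2.
apply: filterS l1 => w w1 _; rewrite /fubini_G /=.
under eq_integral do rewrite Normc.normcM exprMn EFinM.
rewrite ge0_integralZl//.
- by rewrite w1 mule1.
- by apply: measurable_normc2; exact: (cmeasurable_slice1 w ml).
- by move=> x _; rewrite lee_fin sqr_ge0.
- by rewrite lee_fin sqr_ge0.
Qed.

Lemma ae_sqint_slice (F : L2 (m1 \x m2)%E) :
  {ae m2, forall w, sqint m1 (fun t => F (t, w))}.
Proof.
have := ae_cintegrable2 (cintegrable_normc2 (L2_sqint F)).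
apply: filterS => w; apply: sqint_cintegrable_normc2.
exact: (cmeasurable_slice1 w (L2_cmeasurable F)).
Qed.

Lemma ae_sqint_multiplier : {ae m2, forall w, sqint m1 (l^~ w)}.
Proof.
apply: filterS l1 => w w1; split; last by rewrite w1 ltry.
exact: (cmeasurable_slice1 w ml).
Qed.

Lemma cmeasurable_mult_adj (F : L2 (m1 \x m2)%E) :
  cmeasurable (fun z : T1 * T2 => F z * (l z.1 z.2)^*).
Proof. by apply: cmeasurableM; [exact: L2_cmeasurable|exact: cmeasurableJ]. Qed.

(** Almost every fibre of F is square-integrable and almost every l(., w) is a unit vector, so
    Cauchy-Schwarz on fibres bounds the squared modulus at w by the integral of |F(., w)|^2; Tonelli
    sums this up. *)
Lemma sqint_mult_adj (F : L2 (m1 \x m2)%E) :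
  sqint m2 (fun w => cintegral m1 (fun t => F (t, w) * (l t w)^*)).
Proof.
have mA := cmeasurable_cintegral2 m1 (cmeasurable_mult_adj F); split => //.
have [mF Fi] := L2_sqint F.
have mE := measurable_normc2 mF.
apply: le_lt_trans Fi.
rewrite [leRHS](@fubini_tonelli2 _ _ _ _ _ m1 m2 (fun z => (normc (F z) ^+ 2)%:E))//; last first.
  by move=> z; rewrite lee_fin sqr_ge0.
apply: ae_ge0_le_integral => //.
- by move=> w _; rewrite lee_fin sqr_ge0.
- exact: measurable_normc2.
- by move=> w _; apply: integral_ge0 => t _; rewrite lee_fin sqr_ge0.
- apply: (@measurable_fun_fubini_tonelli_G _ _ _ _ _ m1 (fun z => (normc (F z) ^+ 2)%:E)) => //.
  by move=> z; rewrite lee_fin sqr_ge0.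
- apply: filterS3 l1 ae_sqint_multiplier (ae_sqint_slice F) => w w1 sl sF _.
  exact: cauchy_schwarz_cintegral.
Qed.

Lemma inner_mult_adj F g : inner (mult_adj F) g = inner F (mult_op g).
Proof.
have sg := sqint_mult (L2_sqint g).
rewrite /mult_op inner_toL2r// cfubini2; last by apply: sqint_cintegrableJ => //; exact: L2_sqint.
have mk : cmeasurable (fun z : T1 * T2 => F z * (g z.2 * l z.1 z.2)^*).
  by apply: cmeasurableM; [exact: L2_cmeasurable|apply: cmeasurableJ; exact: sg.1].
rewrite (inner_ae (sqint_mult_adj F).1 (L2_cmeasurable g) (toL2_ae (sqint_mult_adj F)) (aeW _ (fun=> erefl))).
apply: ae_eq_cintegral.
- apply: cmeasurableM; first exact: (sqint_mult_adj F).1.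
  by apply: cmeasurableJ; exact: L2_cmeasurable.
- exact: (cmeasurable_cintegral2 m1 mk).
apply: filterS2 ae_sqint_multiplier (ae_sqint_slice F) => w sl sF.
rewrite mulrC -cintegralZ; last exact: sqint_cintegrableJ.
by apply: eq_cintegral => t /=; rewrite rmorphM/= mulrCA.
Qed.

Lemma inner_mult_op f g : inner (mult_op f) (mult_op g) = inner f g.
Proof.
have sf := sqint_mult (L2_sqint f); have sg := sqint_mult (L2_sqint g).
rewrite /mult_op inner_toL2//.
rewrite cfubini2; last exact: sqint_cintegrableJ.
have mk : cmeasurable (fun z : T1 * T2 => (f z.2 * l z.1 z.2) * (g z.2 * l z.1 z.2)^*).
  by apply: cmeasurableM; [exact: sf.1|apply: cmeasurableJ; exact: sg.1].
apply: ae_eq_cintegral.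
- exact: (cmeasurable_cintegral2 m1 mk).
- by apply: cmeasurableM; [|apply: cmeasurableJ]; exact: L2_cmeasurable.
apply: filterS2 l1 ae_sqint_multiplier => w w1 sl.
transitivity (f w * (g w)^* * cintegral m1 (fun t => l t w * (l t w)^*)).
  rewrite -cintegralZ; last exact: sqint_cintegrableJ.
  by apply: eq_cintegral => t /=; rewrite rmorphM/= mulrACA.
by rewrite (cintegral_normc2 w1) mulr1.
Qed.

Lemma hisometry_mult_op : hisometry (L2ip m2) (L2ip (m1 \x m2)%E) mult_op.
Proof.
split; last exact: inner_mult_op.
apply: (@ip_preserving_linear _ _ _ (L2ip m2) (L2ip (m1 \x m2)%E)).
exact: inner_mult_op.
Qed.

End multiplier_isometry.

Section rectangle_tests.
Context d1 d2 (T1 : measurableType d1) (T2 : measurableType d2) (R : realType).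
Variables (m1 : {sigma_finite_measure set T1 -> \bar R}).
Variables (m2 : {sigma_finite_measure set T2 -> \bar R}).

(** Rewrites a rectangle test as an inner product with an elementary tensor, across which an
    isometry can be moved. *)
Lemma inner_tensor_cindic (h : L2 (m1 \x m2)%E) (A : set T1) (B : set T2) :
  measurable A -> measurable B -> (m1 A < +oo)%E -> (m2 B < +oo)%E ->
  cintegrable (m1 \x m2)%E (fun z => cindic R (A `*` B) z * h z) /\
  cintegral (m1 \x m2)%E (fun z => cindic R (A `*` B) z * h z) =
    inner h (tensor (toL2 m1 (cindic R A)) (toL2 m2 (cindic R B))).
Proof.
move=> mA mB Afin Bfin.
have sA := sqint_cindic mA Afin; have sB := sqint_cindic mB Bfin.
have sAB := sqint_tensor sA sB.
have -> : (fun z => cindic R (A `*` B) z * h z) =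
    (fun z => h z * (cindic R A z.1 * cindic R B z.2)^*).
  by apply/funext => z; rewrite cindicX mulrC rmorphM/= !cindic_conj.
split; first by apply: sqint_cintegrableJ => //; exact: L2_sqint.
apply/esym/inner_ae; [exact: L2_cmeasurable|exact: sAB.1|exact: aeW|].
by apply: tensor_ae; exact: toL2_ae.
Qed.

End rectangle_tests.

(** * The transform as a multiplier *)

Section synthesis.
Context d1 (T1 : measurableType d1) (R : realType).
Local Notation leb := (@lebesgue_measure R).
Local Notation mR := (measurableTypeR R).
Variables (m1 : {sigma_finite_measure set T1 -> \bar R}).
Variable l : T1 -> R -> R[i].
Hypothesis ml : cmeasurable (fun z : T1 * mR => l z.1 z.2).
Hypothesis l1 : {ae leb, forall w : R, (\int[m1]_t (normc (l t w) ^+ 2)%:E = 1)%E}.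
Variable C : R.
Hypothesis lC : forall t, sqint leb (l t) /\
  (\int[leb]_w (normc (l t w) ^+ 2)%:E <= C%:E)%E.
Variables (s : R) (B' : L2 leb -> L2 leb).
Hypothesis B'L1 : forall f : L2 leb, cintegrable leb f ->
  {ae leb, forall xi, B' f xi = ftk (- s) f xi}.
Variables (U V : L2 (m1 \x leb)%E -> L2 (m1 \x leb)%E).
Hypotheses (UV : cancel U V) (Vi : hisometry (L2ip (m1 \x leb)%E) (L2ip (m1 \x leb)%E) V).
Hypothesis UE : forall (f : L2 m1) (g : L2 leb), U (tensor f g) = tensor f (B' g).

(** The values <f, Psi_zeta> written as Fourier integrals of g l(t, .), defined at every point; g is
    the Fourier transform of f with s = 1 for wavelets, and f itself with s = -1 for windows. *)
Definition wave_transform (g : R -> R[i]) (z : T1 * mR) : R[i] :=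
  ftk s (fun w => g w * l z.1 w) z.2.

Lemma cintegrable_gl (g : L2 leb) t : cintegrable leb (fun w => g w * l t w).
Proof. by apply: sqint_cintegrable; [exact: L2_sqint|exact: (lC t).1]. Qed.

(** The bound [lC] is uniform in t, so the transform is bounded on the whole product. This gives
    integrability over rectangles of finite measure before square-integrability is known. *)
Lemma normc_wave_transform_le (g : L2 leb) z :
  normc (wave_transform g z) <= 2 * (L2norm g ^+ 2 + C).
Proof.
apply: (le_trans (normc_ftk_le _ _ (cintegrable_gl g z.1))); rewrite ler_pM2l//.
have [sl lz] := lC z.1; have sg := L2_sqint g.
have igl := integrable_normc (cintegrable_gl g z.1).
rewrite -lee_fin fineK; last exact: (integrable_fin_num measurableT igl).
apply: (@le_trans _ _ (\int[leb]_w ((normc (g w) ^+ 2)%:E + (normc (l z.1 w) ^+ 2)%:E))%E).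
  apply: ge0_le_integral => //.
  - by move=> w _; rewrite lee_fin normc_ge0.
  - by have [/measurable_int] := igl.
  - by apply: emeasurable_funD; apply: measurable_normc2; [exact: sg.1|exact: sl.1].
  - by move=> w _; rewrite -EFinD lee_fin normcM_le.
rewrite ge0_integralD//.
- by rewrite EFinD L2norm_sqrE leeD.
- by move=> w _; rewrite lee_fin sqr_ge0.
- exact: measurable_normc2 sg.1.
- by move=> w _; rewrite lee_fin sqr_ge0.
- exact: measurable_normc2 sl.1.
Qed.

Lemma cmeasurable_wave_transform (g : L2 leb) : cmeasurable (wave_transform g).
Proof.
pose k (y : (T1 * mR) * mR) : R[i] :=
  g y.2 * l y.1.1 y.2 * cexpi (s * (2 * pi * (y.2 : R) * (y.1.2 : R))).
have m12 : measurable_fun setT (fun y : (T1 * mR) * mR => (y.1.1, y.2)).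
  by apply: measurable_fun_pair => //; exact: (measurableT_comp measurable_fst).
have m2 : measurable_fun setT (fun y : (T1 * mR) * mR => y.2 : R) by exact: measurable_snd.
have mk : cmeasurable k.
  apply: cmeasurableM; first apply: cmeasurableM.
  - exact: (cmeasurable_comp (@measurable_snd _ _ (T1 * mR)%type mR) (L2_cmeasurable g)).
  - exact: (cmeasurable_comp m12 ml).
  - apply: cmeasurable_cexpi; apply: measurable_funM => //.
    apply: measurable_funM; first exact: measurable_funM.
    exact: (measurableT_comp measurable_snd measurable_fst).
exact: (cmeasurable_cintegral1 leb mk).
Qed.

Lemma cintegrable_wave_transform (g : L2 leb) (A : set T1) (J : set mR) :
  measurable A -> measurable J -> (m1 A < +oo)%E -> (leb J < +oo)%E ->
  cintegrable (m1 \x leb)%E (fun z => cindic R (A `*` J) z * wave_transform g z).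
Proof.
move=> mA mJ Afin Jfin.
have AJ := cintegrable_tensor (cintegrable_cindic mA Afin) (cintegrable_cindic mJ Jfin).
apply: (cintegrable_dom _ (cintegrableZ (2 * (L2norm g ^+ 2 + C))%:C AJ)).
  apply: cmeasurableM; first by apply: cmeasurable_cindic; exact: measurableX.
  exact: cmeasurable_wave_transform.
move=> z; rewrite -cindicX mulrC !Normc.normcM ler_wpM2r ?normc_ge0//.
apply: (le_trans (normc_wave_transform_le g z)).
rewrite (_ : normc _ = `|2 * (L2norm g ^+ 2 + C)|) ?ler_norm//.
by rewrite /= expr0n addr0 sqrtr_sqr.
Qed.

(* The Fourier variable is moved onto the indicator of J by the multiplication
   formula. *)
Lemma toL2_wave_transform (g : L2 leb) :
  toL2 (m1 \x leb)%E (wave_transform g) = V (@mult_op _ _ T1 mR R m1 leb l g).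
Proof.
have mw := cmeasurable_wave_transform g.
apply: ae_eq_toL2 => //; set h := V _.
suff : {ae (m1 \x leb)%E, forall z, wave_transform g z - h z = 0}.
  by apply: filterS => z /eqP; rewrite subr_eq0 => /eqP.
apply: cae_eq0_rectangles.
  by apply: cmeasurableB => //; exact: L2_cmeasurable.
move=> A J mA mJ Afin Jfin.
have iw := cintegrable_wave_transform g mA mJ Afin Jfin.
have [ih Eh] := inner_tensor_cindic h mA mJ Afin Jfin.
have -> : (fun z => cindic R (A `*` J) z * (wave_transform g z - h z)) =
    (fun z => cindic R (A `*` J) z * wave_transform g z - cindic R (A `*` J) z * h z).
  by apply/funext => z; rewrite mulrBr.
split.
  under eq_fun do rewrite -[X in _ + X]mulN1r.
  by apply: cintegrableD => //; exact: cintegrableZ.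
rewrite cintegralB// Eh; apply/eqP; rewrite subr_eq0; apply/eqP.
set a := toL2 m1 _; set b := toL2 leb _.
(* As V is isometric and V U = I, pairing V x with a tensor is pairing x with the image of that
   tensor under U, where only the second factor changes. *)
have -> : inner h (tensor a b) = inner (@mult_op _ _ T1 mR R m1 leb l g) (tensor a (B' b)).
  rewrite -UE -[X in inner h X]UV; exact: Vi.2.
have iJ := cintegrable_cindic mJ Jfin; have iA := cintegrable_cindic mA Afin.
have sJ := sqint_cindic mJ Jfin; have sA := sqint_cindic mA Afin.
have ib : cintegrable leb b.
  apply: (ae_eq_cintegrable (L2_cmeasurable b) _ iJ).
  by have := toL2_ae sJ; apply: filterS => x.
have B'b : {ae leb, forall xi, B' b xi = ftk (- s) (cindic R J) xi}.
  apply: (ae_imp _ (B'L1 ib)) => xi ->.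
  by apply: ftk_ae; [exact: (L2_cmeasurable b)|exact: sJ.1|exact: (toL2_ae sJ)].
have sB'b : sqint leb (ftk (- s) (cindic R J)).
  by apply: (ae_eq_sqint _ B'b (L2_sqint _)); apply: cmeasurable_ftk; exact: sJ.1.
have sm := sqint_mult ml l1 (L2_sqint g).
have st := sqint_tensor sA sB'b.
rewrite (inner_ae sm.1 st.1 (toL2_ae sm) (tensor_ae (toL2_ae sA) B'b)).
rewrite cfubini1// cfubini1; last exact: sqint_cintegrableJ.
apply: eq_cintegral => t.
have igl := cintegrable_gl g t.
transitivity (cindic R A t * cintegral leb (fun v => ftk s (fun w => g w * l t w) v * (cindic R J v)^*)).
  rewrite -cintegralZ; last exact: cintegrable_ftkM.
  by apply: eq_cintegral => v; rewrite cindicX /wave_transform/= cindic_conj; ring.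
rewrite ftk_mult// -cintegralZ; last first.
  have := cintegrableJ (cintegrable_ftkM (- s) iJ igl).
  rewrite (_ : (fun x => _) = (fun x => g x * l t x * (ftk (- s) (cindic R J) x)^*))//.
  by apply/funext => x; rewrite rmorphM/= conjCK mulrC.
by apply: eq_cintegral => w /=; rewrite rmorphM/= cindic_conj; ring.
Qed.

End synthesis.

Section abstract_adjoint.
Context {R : realType} {H1 H2 : lmodType R[i]}.
Variables (p1 : inner_product H1) (p2 : inner_product H2).

(** Yields linearity of R_Psi from its adjoint identity alone. *)
Lemma ip_adjoint_linear (A : H1 -> H2) (B : H2 -> H1) :
  (forall f g, p2 (A f) g = p1 f (B g)) -> linear A.
Proof.
move=> AB a f g; apply: (@ip_extl _ _ p2) => h.
by rewrite AB ipDl ipZl ipDl ipZl !AB.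
Qed.

Lemma orthogonal_projection_unique (S : set H1) f a b :
  (forall x y, S x -> S y -> S (x - y)) -> S a -> S b ->
  (forall g, S g -> p1 (f - a) g = 0) -> (forall g, S g -> p1 (f - b) g = 0) ->
  a = b.
Proof.
move=> SB Sa Sb fa fb; apply/eqP; rewrite -subr_eq0; apply/eqP/(@ip_eq0 _ _ p1).
have Sab := SB _ _ Sa Sb.
have -> : p1 (a - b) (a - b) = p1 (f - b) (a - b) - p1 (f - a) (a - b).
  by rewrite -ipBl opprB [f - b + _]addrC addrA subrK.
by rewrite fa// fb// subrr.
Qed.

End abstract_adjoint.

(** * Factorization *)

Section definite_descriptions.
Context d1 d2 (T1 : measurableType d1) (T2 : measurableType d2) (R : realType).
Variables (mu : {measure set T1 -> \bar R}) (nu : {measure set T2 -> \bar R}).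

Lemma adjointE (A : L2 mu -> L2 nu) (g : L2 nu) (h : L2 mu) :
  (forall f, inner (A f) g = inner f h) -> adjoint A g = h.
Proof.
move=> Ah.
have Ah' : forall f, inner (A f) g = inner f (adjoint A g).
  exact: (@xgetPex _ 0 [set h | forall f, inner (A f) g = inner f h] (ex_intro _ h Ah)).
apply: (@ip_extr _ _ (L2ip mu)) => f.
by rewrite !L2ipE -Ah -Ah'.
Qed.

Lemma orth_projE (S : set (L2 mu)) (f q : L2 mu) :
  (forall x y, S x -> S y -> S (x - y)) ->
  S q -> (forall g, S g -> inner (f - q) g = 0) -> orth_proj S f = q.
Proof.
move=> SB Sq fq.
have [Sp fp] : S (orth_proj S f) /\ forall g, S g -> inner (f - orth_proj S f) g = 0.
  apply: (@xgetPex _ 0 [set p | S p /\ forall g, S g -> inner (f - p) g = 0]).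
  by exists q.
exact: (@orthogonal_projection_unique _ _ (L2ip mu) S f _ _ SB Sp Sq fp fq).
Qed.

End definite_descriptions.

(** * The statement for an abstract factorization W = V Q t *)

Section factorization.
Context d1 d2 (T1 : measurableType d1) (T2 : measurableType d2) (R : realType).
Variables (mu : {measure set T1 -> \bar R}) (nu : {measure set T2 -> \bar R}).
Variables (U V : L2 mu -> L2 mu) (Q : L2 nu -> L2 mu) (Qs : L2 mu -> L2 nu).
Hypotheses (Vi : hisometry (L2ip mu) (L2ip mu) V) (UV : cancel U V).
Hypothesis Qi : hisometry (L2ip nu) (L2ip mu) Q.
Hypothesis QsQ : forall F g, inner (Qs F) g = inner F (Q g).
Variables (W : L2 nu -> L2 mu) (t t' : L2 nu -> L2 nu).
Hypotheses (t'K : cancel t' t) (WE : forall f, W f = V (Q (t f))).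

Let Rop := Qs \o U.
Let VQ := V \o Q.

Let innerV F G : inner (V F) (V G) = inner F G. Proof. exact: Vi.2. Qed.
Let innerQ f g : inner (Q f) (Q g) = inner f g. Proof. exact: Qi.2. Qed.

(** An isometric left inverse of U is its adjoint. *)
Let inner_UV F G : inner (U F) G = inner F (V G).
Proof. by rewrite -innerV UV. Qed.

Let RopE F g : inner (Rop F) g = inner F (VQ g).
Proof. by rewrite /Rop/= QsQ inner_UV. Qed.

Let VQi : hisometry (L2ip nu) (L2ip mu) VQ.
Proof. exact: hisometry_comp Vi Qi. Qed.

Let L2norm_VQ f : L2norm (VQ f) = L2norm f.
Proof. by have := hisometry_norm VQi f; rewrite !hnorm_L2. Qed.

Let RopK g : Rop (VQ g) = g.
Proof.
apply: (@ip_extl _ _ (L2ip nu)) => h; rewrite !L2ipE RopE /VQ/= innerV.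
exact: innerQ.
Qed.

Let Rop_linear : linear Rop.
Proof. exact: (@ip_adjoint_linear _ _ _ (L2ip mu) (L2ip nu) Rop VQ RopE). Qed.

(** [t'K] makes t surjective, so precomposition with t leaves the range unchanged. *)
Let range_W : range W = range VQ.
Proof.
apply/seteqP; split => F /= [g _ <-]; first by exists (t g); rewrite ?WE.
by exists (t' g); rewrite ?WE ?t'K.
Qed.

Let adjoint_Rop : adjoint Rop = VQ.
Proof. by apply/funext => g; apply: adjointE => F; exact: RopE. Qed.

Let adjoint_U : adjoint U = V.
Proof. by apply/funext => F; apply: adjointE => G; exact: inner_UV. Qed.

(** All six claims come from the isometry [VQ], the adjoint identity [RopE] and its consequence
    [RopK]. *)
Lemma factorization :
  range Rop = setT /\
  isometric_isomorphism (range W) setT Rop /\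
  adjoint Rop = adjoint U \o Q /\
  isometric_isomorphism setT (range W) (adjoint Rop) /\
  Rop \o adjoint Rop = id /\
  adjoint Rop \o Rop = orth_proj (range W).
Proof.
rewrite adjoint_U adjoint_Rop range_W; split; [|split; [|split; [|split; [|split]]]].
- by apply/seteqP; split => // g _; exists (VQ g); rewrite ?RopK.
- split.
  + by move=> a f g _ _; exact: Rop_linear.
  + split => //.
    * by move=> _ _ /set_mem[f _ <-] /set_mem[g _ <-]; rewrite !RopK => ->.
    * by move=> g _; exists (VQ g); [exists g|exact: RopK].
  + by move=> _ [f _ <-]; rewrite RopK L2norm_VQ.
- by [].
- split.
  + by move=> a f g _ _; exact: VQi.1.
  + split.
    * by move=> f _; exists f.
    * by move=> f g _ _ fg; rewrite -(RopK f) fg RopK.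
    * by move=> _ [f _ <-]; exists f.
  + by move=> f _; exact: L2norm_VQ.
- by apply/funext => g; exact: RopK.
- apply/funext => F; apply/esym; apply: (@orth_projE _ _ _ mu).
  + move=> _ _ [f _ <-] [g _ <-]; exists (f - g) => //.
    exact: (linearB_of VQi.1).
  + by exists (Rop F).
  (* Paired with VQ g, the remainder gives the difference of <R F, g> and <R VQ R F, g>, which
     vanishes by [RopK]. *)
  + move=> _ [g _ <-].
    apply: (etrans (ipBl (L2ip mu) F (VQ (Rop F)) (VQ g))).
    by rewrite !L2ipE -!RopE RopK subrr.
Qed.

End factorization.

Section multiplier_factorization.
Context d1 (T1 : measurableType d1) (R : realType).
Local Notation leb := (@lebesgue_measure R).
Local Notation mR := (measurableTypeR R).
Variables (m1 : {sigma_finite_measure set T1 -> \bar R}).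
Variable l : T1 -> R -> R[i].
Hypothesis ml : cmeasurable (fun z : T1 * mR => l z.1 z.2).
Hypothesis l1 : {ae leb, forall w : R, (\int[m1]_t (normc (l t w) ^+ 2)%:E = 1)%E}.
Variable C : R.
Hypothesis lC : forall t, sqint leb (l t) /\
  (\int[leb]_w (normc (l t w) ^+ 2)%:E <= C%:E)%E.
Variables (s : R) (B B' : L2 leb -> L2 leb).
Hypotheses (Bi : hisometry (L2ip leb) (L2ip leb) B).
Hypotheses (B'i : hisometry (L2ip leb) (L2ip leb) B').
Hypothesis B'K : cancel B' B.
Hypothesis B'L1 : forall f : L2 leb, cintegrable leb f ->
  {ae leb, forall xi, B' f xi = ftk (- s) f xi}.
Variables (W : L2 leb -> L2 (m1 \x leb)%E) (t t' : L2 leb -> L2 leb).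
Hypotheses (t'K : cancel t' t).
Hypothesis WE : forall f, W f = toL2 (m1 \x leb)%E (wave_transform l s (t f)).

(** The operator B' acting in the second variable has kernel sign -s, opposite to that of W.
    Wavelets take s = 1, B' = t = [fourier]; windows take s = -1, B' = [inverse_fourier], t = id. *)
Lemma multiplier_factorization :
  let U := @tensor_operator _ _ T1 mR R m1 leb id B' in
  let Rop := @mult_adj _ _ T1 mR R m1 leb l \o U in
  range Rop = setT /\
  isometric_isomorphism (range W) setT Rop /\
  adjoint Rop = adjoint U \o @mult_op _ _ T1 mR R m1 leb l /\
  isometric_isomorphism setT (range W) (adjoint Rop) /\
  Rop \o adjoint Rop = id /\
  adjoint Rop \o Rop = orth_proj (range W).
Proof.
move=> U Rop.
have [V [Vi UV Ue]] := tensor_operatorP m1 B'i Bi B'K.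
have WE' f : W f = V (@mult_op _ _ T1 mR R m1 leb l (t f)).
  by rewrite WE; exact: (toL2_wave_transform ml l1 lC B'L1 UV Vi Ue).
exact (factorization Vi UV (hisometry_mult_op ml l1) (inner_mult_adj ml l1) t'K WE').
Qed.

End multiplier_factorization.

Section affine_ae.
Context {R : realType}.
Local Notation leb := (@lebesgue_measure R).

Lemma ae_affine (P : R -> Prop) (a b : R) : a != 0 -> {ae leb, forall x, P x} ->
  {ae leb, forall x, P (a * x + b)}.
Proof.
move=> a0 [N [mN N0 PN]].
have mpre : measurable [set x : R | N (a * x + b)].
  have := measurable_affine a b measurableT mN; rewrite setTI; exact.
exists [set x : R | N (a * x + b)]; split => //.
  have -> : leb [set x : R | N (a * x + b)] =
      (\int[leb]_x (\1_[set x : R | N (a * x + b)] x)%:E)%E.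
    by rewrite integral_indic// setIT.
  transitivity (\int[leb]_x (fun y => (\1_N y)%:E) (a * x + b)%R)%E; first by [].
  rewrite (@ge0_integral_affine R (fun y => (\1_N y)%:E))//; last exact/measurable_EFinP/measurable_indic.
  have -> : (\int[leb]_x (\1_N x)%:E = 0)%E by rewrite integral_indic// setIT.
  by rewrite mule0.
by move=> x /= nP; exact: PN.
Qed.

Lemma ge0_integral_reflect (f : R -> \bar R) (b : R) : measurable_fun setT f ->
  (forall x, 0 <= f x)%E -> (\int[leb]_x f (b - x)%R = \int[leb]_x f x)%E.
Proof.
move=> mf f0; have N10 : (-1 : R) != 0 by rewrite oppr_eq0 oner_neq0.
have := ge0_integral_affine b N10 mf f0; rewrite normrN1 invr1 mul1e => <-.
by apply: eq_integral => x _; rewrite mulN1r addrC.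
Qed.

End affine_ae.

(** * Wavelets and windows *)

Section dilations.
Context {R : realType}.
Local Notation leb := (@lebesgue_measure R).
Variables (u v : R).
Hypothesis u0 : 0 < u.

Let uV0 : u^-1 != 0. Proof. by rewrite invr_neq0// gt_eqF. Qed.
Let un0 : u != 0. Proof. by rewrite gt_eqF. Qed.
Let su0 : Num.sqrt u != 0. Proof. by rewrite sqrtr_eq0 -ltNge. Qed.

Let sub_divE (x : R) : (x - v) / u = u^-1 * x + - (v / u).
Proof. by rewrite mulrBl [x / u]mulrC. Qed.

Let dil (f : R -> R[i]) x : R[i] := ((Num.sqrt u)^-1)%:C * f ((x - v) / u).

(** What dilation and translation by (u, v) become on the Fourier side. *)
Let mdil (f : R -> R[i]) w : R[i] :=
  (Num.sqrt u)%:C * cexpi (- (2 * pi * v * w)) * f (u * w).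

Let dilE f : dil f = (fun x => ((Num.sqrt u)^-1)%:C * f (u^-1 * x + - (v / u))).
Proof. by apply/funext => x; rewrite /dil sub_divE. Qed.

Let mulr0E (f : R -> R[i]) : (fun w => f (u * w)) = (fun w => f (u * w + 0)).
Proof. by apply/funext => w; rewrite addr0. Qed.

Let sqint_dil f : sqint leb f -> sqint leb (dil f).
Proof. by move=> sf; rewrite dilE; apply: sqintZ; exact: sqint_affine. Qed.

Let cmeasurable_mod : cmeasurable (fun w : R => (Num.sqrt u)%:C * cexpi (- (2 * pi * v * w))).
Proof.
apply: cmeasurableM; first exact: cmeasurable_cst.
have := @cmeasurable_wave R (- (2 * pi * v)).
by rewrite (_ : (fun x => _) = (fun w => cexpi (- (2 * pi * v * w))))//;
  apply/funext => w; rewrite mulNr.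
Qed.

Let normc_real (r : R) : 0 <= r -> normc r%:C = r.
Proof. by move=> r0; rewrite /= expr0n addr0 sqrtr_sqr ger0_norm. Qed.

Let sqint_mdil f : sqint leb f -> sqint leb (mdil f).
Proof.
move=> sf; have sa : sqint leb (fun w => f (u * w)) by rewrite mulr0E; exact: sqint_affine.
have [mz zi] := sqintZ (Num.sqrt u)%:C sa; split.
  by apply: cmeasurableM => //; exact: sa.1.
rewrite (le_lt_trans _ zi)// le_eqVlt; apply/orP; left; apply/eqP.
by apply: eq_integral => w _; rewrite !Normc.normcM normc_cexpi mulr1.
Qed.

Definition dilation (f : L2 leb) : L2 leb := toL2 leb (dil f).
Definition dual_dilation (f : L2 leb) : L2 leb := toL2 leb (mdil f).

Lemma inner_dual_dilationr f (g : L2 leb) : inner f (dual_dilation g) = cintegral leb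
  (fun w => f w * ((Num.sqrt u)%:C * cexpi (- (2 * pi * v * w)) * g (u * w))^*).
Proof. exact: (inner_toL2r f (sqint_mdil (L2_sqint g))). Qed.

Let inner_dilation f g : inner (dilation f) (dilation g) = inner f g.
Proof.
rewrite /dilation inner_toL2; [|exact/sqint_dil/L2_sqint..].
transitivity (cintegral leb (fun x => (u^-1)%:C *
    (fun y => f y * (g y)^*) (u^-1 * x + - (v / u)))).
  apply: eq_cintegral => x; rewrite !dilE /= rmorphM/= mulrACA; congr (_ * _).
  rewrite -[X in _ * X]conjcE conjc_real -rmorphM/= -invfM -expr2 sqr_sqrtr//.
  exact: ltW.
have ki := inner_cintegrable f g.
rewrite (cintegralZ _ (cintegrable_affine _ uV0 ki)) (cintegral_affine _ uV0 ki).
rewrite mulrA -rmorphM/= ger0_norm ?invr_ge0 ?(ltW u0)// divff// ?mul1r//.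
Qed.

Let inner_dual_dilation f g : inner (dual_dilation f) (dual_dilation g) = inner f g.
Proof.
rewrite /dual_dilation inner_toL2; [|exact/sqint_mdil/L2_sqint..].
transitivity (cintegral leb (fun x => u%:C * (fun y => f y * (g y)^*) (u * x + 0))).
  apply: eq_cintegral => x; rewrite /mdil /= rmorphM/= mulrACA addr0; congr (_ * _).
  rewrite rmorphM/= mulrACA !mulcJ normc_cexpi expr1n mulr1.
  by rewrite normc_real ?sqrtr_ge0// sqr_sqrtr// ltW.
have ki := inner_cintegrable f g.
rewrite (cintegralZ _ (cintegrable_affine _ un0 ki)) (cintegral_affine _ un0 ki).
rewrite mulrA -rmorphM/= ger0_norm ?(ltW u0)// divff// ?mul1r//.
Qed.

Lemma hisometry_dilation : hisometry (L2ip leb) (L2ip leb) dilation.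
Proof.
split; last exact: inner_dilation.
exact: (@ip_preserving_linear _ _ _ (L2ip leb) (L2ip leb) _ inner_dilation).
Qed.

Lemma hisometry_dual_dilation : hisometry (L2ip leb) (L2ip leb) dual_dilation.
Proof.
split; last exact: inner_dual_dilation.
exact: (@ip_preserving_linear _ _ _ (L2ip leb) (L2ip leb) _ inner_dual_dilation).
Qed.

Let ftk_dil (f : R -> R[i]) w : cintegrable leb f ->
  ftk (-1) (dil f) w = mdil (ftk (-1) f) w.
Proof.
move=> fi; have ki := cintegrable_wave (-1) (u * w) fi.
transitivity (cintegral leb (fun x =>
    (((Num.sqrt u)^-1)%:C * cexpi (- (2 * pi * v * w))) *
    (fun y => f y * cexpi (-1 * (2 * pi * y * (u * w)))) (u^-1 * x + - (v / u)))).
  apply: eq_cintegral => x; rewrite dilE /=.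
  rewrite -!mulrA; congr (_ * _); rewrite [RHS]mulrCA; congr (_ * _).
  by rewrite -cexpiD; congr cexpi; field.
rewrite (cintegralZ _ (cintegrable_affine _ uV0 ki)) (cintegral_affine _ uV0 ki) /mdil /ftk mulrA; congr (_ * _).
rewrite mulrAC -rmorphM/=; congr (_%:C * _).
rewrite ger0_norm ?invr_ge0 ?(ltW u0)// invrK -[X in _ * X](sqr_sqrtr (ltW u0)) expr2.
by rewrite mulKf.
Qed.

(** Both composites are isometries, so they may be compared on boxes, where [fourier] is an integral
    and the affine substitution applies. *)
Lemma fourier_dilation (f : L2 leb) :
  fourier (dilation f) = dual_dilation (fourier f).
Proof.
have [B [_ [Fi _ _ _ L1]]] := @fourierP R.
have dd := hisometry_dual_dilation; have d := hisometry_dilation.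
suff E : @fourier R \o dilation = dual_dilation \o @fourier R.
  exact: (congr1 (fun A => A f) E).
apply: (L2_hbounded_eq (@htotal_box R)).
- exact: hisometry_bounded (hisometry_comp Fi d).
- exact: hisometry_bounded (hisometry_comp dd Fi).
move=> b /=; have bi := box_cintegrable b; set e := box b in bi *.
have di : cintegrable leb (dil e).
  by rewrite dilE; apply: cintegrableZ; exact: cintegrable_affine.
have de := toL2_ae (sqint_dil (L2_sqint e)).
have dli : cintegrable leb (dilation e).
  apply: (ae_eq_cintegrable (L2_cmeasurable (dilation e)) _ di).
  by apply: (ae_imp _ de) => x.
apply/L2_eqP.
have h1 := (L1 _ dli).1.
have h2 := toL2_ae (sqint_mdil (L2_sqint (fourier e))).
(* The formula for the transform of e holds almost everywhere but is needed at u w, so it is pulled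
   back along w -> u w. *)
have h3 := ae_affine 0 un0 (L1 _ bi).1.
apply: (ae_imp2 _ h1 (filterI h2 h3)) => w e1 [e2 e3].
have E : ftk (-1) (dilation e) w = ftk (-1) (dil e) w.
  by apply: ftk_ae; [exact: (L2_cmeasurable (dilation e))|exact: cintegrable_measurable di|].
rewrite [LHS]e1 E [RHS]e2 ftk_dil// /mdil; congr (_ * _).
by rewrite addr0 in e3.
Qed.

End dilations.

Section voices.
Context {R : realType}.
Local Notation leb := (@lebesgue_measure R).
Local Notation mR := (measurableTypeR R).
Implicit Types (c : transform_case) (Psi f : L2 leb).

Lemma cmeasurable_ell c Psi : cmeasurable (fun z : mR * mR => ell c Psi z.1 z.2).
Proof.
case: c => /=.
- apply: cmeasurableM.
    apply: cmeasurable_real; apply: measurableT_comp measurable_fst_R.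
    exact: (continuous_measurable_fun (@sqrt_continuous R)).
  apply: cmeasurableJ.
  have mM : measurable_fun setT (fun z : mR * mR => (z.1 : R) * (z.2 : R) : mR).
    by apply: measurable_funM; [exact: measurable_fst_R|exact: measurable_snd_R].
  exact: (cmeasurable_comp mM (L2_cmeasurable (fourier Psi))).
- apply: (@cmeasurableJ _ _ _ (fun z : mR * mR => Psi ((z.2 : R) - (z.1 : R)))).
  have mB : measurable_fun setT (fun z : mR * mR => (z.2 : R) - (z.1 : R) : mR).
    by apply: measurable_funB; [exact: measurable_snd_R|exact: measurable_fst_R].
  exact: (cmeasurable_comp mB (L2_cmeasurable Psi)).
Qed.

Lemma normc_ell_wavelet Psi t w : 0 <= t ->
  normc (ell Wavelet Psi t w) ^+ 2 = t * normc (fourier Psi (t * w)) ^+ 2.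
Proof.
move=> t0; rewrite /ell Normc.normcM normcJ exprMn; congr (_ * _).
by rewrite /= expr0n addr0 sqrtr_sqr ger0_norm ?sqrtr_ge0// sqr_sqrtr.
Qed.

Lemma ell_wavelet0 Psi t w : t <= 0 -> ell Wavelet Psi t w = 0.
Proof. by move=> t0; rewrite /ell ler0_sqrtr// mul0r. Qed.

Lemma normc_ell_window Psi t w :
  normc (ell TimeFrequency Psi t w) = normc (Psi (w - t)).
Proof. by rewrite /ell -[RHS]normcJ. Qed.

(** For wavelets the factor t of |ell|^2 and the density t^-2 combine to the 1/t of the
    admissibility condition. For windows a reflection and translation turn the integral into
    |Psi|^2. *)
Lemma ell_admissible c Psi : admissible c Psi ->
  {ae leb, forall w : R,
    (\int[measure_G1 R c]_t (normc (ell c Psi t w) ^+ 2)%:E = 1)%E}.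
Proof.
case: c => [[_ adm]|adm].
- apply: (ae_imp _ adm) => w <-.
  have mell : measurable_fun setT (fun t : mR => (normc (ell Wavelet Psi t w) ^+ 2)%:E).
    exact: measurable_normc2 (cmeasurable_slice1 w (cmeasurable_ell Wavelet Psi)).
  pose rho (t : R) : R := if 0 < t then t ^- 2 else 0.
  have mrho : measurable_fun setT rho.
    by apply/measurable_EFinP; exact: (@measurable_isq_density R).
  have rho0 t : 0 <= rho t.
    by rewrite /rho; case: ifPn => // _; rewrite invr_ge0 sqr_ge0.
  have := @ge0_integral_density _ _ R (@isq_measure R) leb rho mrho rho0 (fun _ _ => erefl) _ mell.
  rewrite /= => -> //; last by move=> t; rewrite lee_fin sqr_ge0.
  rewrite [RHS]integral_mkcond; apply: eq_integral => t _.
  rewrite patchE mem_setE in_itv/= andbT /rho -EFinM; case: ltP => [t0|t0].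
    by rewrite normc_ell_wavelet ?(ltW t0)//; congr EFin; field; rewrite gt_eqF.
  by rewrite mulr0.
- apply: aeW => w; under eq_integral do rewrite normc_ell_window.
  have mP := measurable_normc2 (L2_cmeasurable Psi).
  rewrite (@ge0_integral_reflect R (fun x => (normc (Psi x) ^+ 2)%:E) w mP).
    by rewrite -L2norm_sqrE adm expr1n.
  by move=> x; rewrite lee_fin sqr_ge0.
Qed.

(** The constant is the squared norm of the transformed wavelet, resp. of the window: for t > 0 the
    factor t of |ell|^2 cancels the Jacobian of w -> t w, and translations preserve the norm. *)
Lemma sqint_ell c Psi : exists C : R, forall t, sqint leb (ell c Psi t) /\
  (\int[leb]_w (normc (ell c Psi t w) ^+ 2)%:E <= C%:E)%E.
Proof.
case: c.
- exists (L2norm (fourier Psi) ^+ 2) => t.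
  have sP := L2_sqint (fourier Psi).
  have [t0|t0] := leP t 0.
    have -> : ell Wavelet Psi t = (fun=> 0).
      by apply/funext => w; exact: ell_wavelet0.
    split; first exact: sqint0.
    rewrite integral0_eq ?lee_fin ?sqr_ge0// => x _.
    by rewrite normc2E/= expr0n addr0.
  have tn0 : t != 0 by rewrite gt_eqF.
  split.
    apply: sqintZ; apply: sqintJ; have := sqint_affine 0 tn0 sP.
    by rewrite (_ : (fun x => _) = (fun w => fourier Psi (t * w)))//;
      apply/funext => w; rewrite addr0.
  have mP := measurable_normc2 (L2_cmeasurable (fourier Psi)).
  under eq_integral do rewrite normc_ell_wavelet ?(ltW t0)// EFinM -[t * _]addr0.
  rewrite ge0_integralZl//.
  + rewrite (@ge0_integral_affine R (fun x => (normc (fourier Psi x) ^+ 2)%:E) t 0)//.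
    * by rewrite muleA -EFinM ger0_norm ?(ltW t0)// divff// mul1e L2norm_sqrE.
    * by move=> x; rewrite lee_fin sqr_ge0.
  + by apply: (measurableT_comp mP); exact: measurable_affine.
  + by move=> x _; rewrite lee_fin sqr_ge0.
  + by rewrite lee_fin ltW.
- exists (L2norm Psi ^+ 2) => t; have sP := L2_sqint Psi.
  have mP := measurable_normc2 (L2_cmeasurable Psi).
  split.
    have sPt : sqint leb (fun w => Psi (w - t)).
      have := sqint_affine (- t) (oner_neq0 R) sP.
      by rewrite (_ : (fun x => _) = (fun w => Psi (w - t)))//;
        apply/funext => w; rewrite mul1r.
    exact (sqintJ sPt).
  under eq_integral do rewrite normc_ell_window -[X in Psi (X - _)]mul1r.
  rewrite (@ge0_integral_affine R (fun x => (normc (Psi x) ^+ 2)%:E) 1 (- t))//.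
  + by rewrite normr1 invr1 mul1e L2norm_sqrE.
  + by move=> x; rewrite lee_fin sqr_ge0.
Qed.

(** Plancherel moves the product to the Fourier side, where translation by v is the factor exp(2 pi
    i v w) of an inverse Fourier integral. *)
Lemma inner_atom_wavelet Psi f (z : mR * mR) :
  inner f (atom Wavelet Psi z) = wave_transform (ell Wavelet Psi) 1 (fourier f) z.
Proof.
case: z => u v; rewrite /wave_transform /=.
(* For u <= 0 both sides are 0, since [Num.sqrt] and the inverse of 0 are 0 there; hence the
   identity holds at every point. *)
have [u0|u0] := leP u 0.
  rewrite (_ : (fun x => _) = (fun=> 0)); last first.
    by apply/funext => x; rewrite ler0_sqrtr// invr0 mul0r.
  rewrite inner_toL2r; last exact: sqint0.
  by apply: eq_cintegral => x; rewrite ler0_sqrtr// mul0r mulr0 mul0r conjC0 mulr0.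
have [B [_ [Fi _ _ _ _]]] := @fourierP R.
(* The atom unfolds to [dilation u v Psi]. *)
have -> : inner f (dilation u v Psi) =
    inner (fourier f) (dual_dilation u v (fourier Psi)).
  by rewrite -(fourier_dilation v u0); exact/esym/Fi.2.
rewrite (inner_dual_dilationr v u0).
apply: eq_cintegral => w; rewrite !rmorphM/= -cexpiN opprK mul1r.
rewrite -[X in _ * (X * _ * _)]conjcE conjc_real.
by rewrite (_ : 2 * pi * v * w = 2 * pi * w * v); [ring|ring].
Qed.

(** The modulation by p is already a Fourier kernel, so the identity holds without passing to the
    Fourier side. *)
Lemma inner_atom_window Psi f (z : mR * mR) :
  inner f (atom TimeFrequency Psi z) = wave_transform (ell TimeFrequency Psi) (-1) f z.
Proof.
case: z => q p; rewrite /wave_transform /=.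
have sP : sqint leb (fun x => Psi (x - q)).
  have := sqint_affine (- q) (oner_neq0 R) (L2_sqint Psi).
  by rewrite (_ : (fun x => _) = (fun w => Psi (w - q)))//;
    apply/funext => w; rewrite mul1r.
rewrite inner_toL2r; last first.
  have [mP iP] := sP; split.
    by apply: cmeasurableM => //; exact: cmeasurable_wave.
  by under eq_integral do rewrite Normc.normcM normc_cexpi mul1r.
apply: eq_cintegral => x; rewrite rmorphM/= -cexpiN conjcE -[RHS]mulrA; congr (_ * _).
by rewrite mulrC; congr (_ * cexpi _); ring.
Qed.

End voices.

Theorem theorem2p1 (R : realType) (c : transform_case)
    (Psi : L2 (@lebesgue_measure R)) (hPsi : admissible c Psi) :
  let W := W_op c Psi in
  let U := U_op R c in
  let Q := Q_op c Psi in
  let Qs := Q_adj c Psi in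
  let Rop := Qs \o U in
  let P := orth_proj (range W) in
  range Rop = setT /\
  isometric_isomorphism (range W) setT Rop /\
  adjoint Rop = adjoint U \o Q /\
  isometric_isomorphism setT (range W) (adjoint Rop) /\
  Rop \o adjoint Rop = id /\
  adjoint Rop \o Rop = P.
Proof.
have ml := cmeasurable_ell c Psi; have l1 := ell_admissible hPsi.
have [C lC] := sqint_ell c Psi.
have [B [invF [Fi Bi FB BF L1]]] := @fourierP R.
case: c hPsi ml l1 lC => hPsi ml l1 lC.
- have WE f : W_op Wavelet Psi f =
      toL2 (measure_G R Wavelet) (wave_transform (ell Wavelet Psi) 1 (fourier f)).
    by congr toL2; apply/funext => z; exact: inner_atom_wavelet.
  exact (multiplier_factorization ml l1 lC Bi Fi FB (fun f fi => (L1 f fi).1) BF WE).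
- have WE f : W_op TimeFrequency Psi f =
      toL2 (measure_G R TimeFrequency) (wave_transform (ell TimeFrequency Psi) (-1) f).
    by congr toL2; apply/funext => z; exact: inner_atom_window.
  have L1' (f : L2 (@lebesgue_measure R)) : cintegrable (@lebesgue_measure R) f ->
      {ae (@lebesgue_measure R), forall xi, inverse_fourier f xi = ftk (- -1) f xi}.
    by rewrite invF opprK => /L1[].
  rewrite -invF in Bi BF FB.
  exact (multiplier_factorization ml l1 lC Fi Bi BF L1' (fun=> erefl : id _ = _) WE).
Qed.
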